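(* Let $\mathcal{H}$ be a finite-dimensional complex Hilbert space, let $\Theta_1,\Theta_2\in H^\infty(\mathcal{L}(\mathcal{H}))$ be two pure inner functions and let $A:K_{\Theta_1}\to K_{\Theta_2}$ be a bounded linear operator. Then $A$ belongs to $\mathcal{MT}(\Theta_1,\Theta_2)$ if and only if there exist bounded linear operators $\widetilde B_1:\widetilde{\mathcal{D}}_{\Theta_1}\to K_{\Theta_2}$ and $\widetilde B_2:\widetilde{\mathcal{D}}_{\Theta_2}\to K_{\Theta_1}$ such that $$A-S_{\Theta_2}^*AS_{\Theta_1}=\widetilde B_1\widetilde D_{\Theta_1}+\widetilde D_{\Theta_2}\widetilde B_2^*.$$
   Context: $\mathcal{H}$ is a finite-dimensional complex Hilbert space, $\mathcal{L}(\mathcal{H})$ is the algebra of linear operators on $\mathcal{H}$, $\mathbb{D}$ is the open unit disk, $\mathbb{T}$ the unit circle with normalized Lebesgue measure $m$. $L^2(\mathcal{H})$ is the Hilbert space of square-integrable $\mathcal{H}$-valued functions on $\mathbb{T}$, $H^2(\mathcal{H})\subset L^2(\mathcal{H})$ the Hardy space of functions whose Fourier coefficients with negative indices vanish; $H^\infty(\mathcal{H})$ the essentially bounded functions in $H^2(\mathcal{H})$. $L^2(\mathcal{L}(\mathcal{H}))$, $H^2(\mathcal{L}(\mathcal{H}))$, $H^\infty(\mathcal{L}(\mathcal{H}))$ are the analogous operator-valued spaces ($\mathcal{L}(\mathcal{H})$ with Hilbert–Schmidt norm for the $L^2$ spaces). Functions in Hardy spaces are identified with their analytic extensions to $\mathbb{D}$.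 An inner function is $\Theta\in H^\infty(\mathcal{L}(\mathcal{H}))$ whose boundary values $\Theta(z)$ are unitary for a.e. $z\in\mathbb{T}$; it is pure if $\|\Theta(0)\|<1$. The model space is $K_\Theta=H^2(\mathcal{H})\ominus\Theta H^2(\mathcal{H})$, $P_\Theta$ is the orthogonal projection of $L^2(\mathcal{H})$ onto $K_\Theta$, and $K_\Theta^\infty=K_\Theta\cap H^\infty(\mathcal{H})$, which is dense in $K_\Theta$. For $\Phi\in L^2(\mathcal{L}(\mathcal{H}))$, $A_\Phi^{\Theta_1,\Theta_2}f=P_{\Theta_2}(\Phi f)$ for $f\in K_{\Theta_1}^\infty$. If this densely defined operator is bounded it is identified with its bounded extension $K_{\Theta_1}\to K_{\Theta_2}$. $\mathcal{MT}(\Theta_1,\Theta_2)$ is the set of all such bounded operators $A_\Phi^{\Theta_1,\Theta_2}$, $\Phi\in L^2(\mathcal{L}(\mathcal{H}))$. The compressed shift on $K_\Theta$ is $S_\Theta f=P_\Theta(zf)$, with adjoint $S_\Theta^*f=P_\Theta(\bar zf)$. Put $\widetilde D_\Theta=I_{K_\Theta}-S_\Theta^*S_\Theta$ and $\widetilde{\mathcal{D}}_\Theta=\{\bar z(\Theta(z)-\Theta(0))x:\ x\in\mathcal{H}\}\subset K_\Theta$; the operator $\widetilde D_\Theta$ has range in $\widetilde{\mathcal{D}}_\Theta$. *)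

(* Defs.v *)
From HB Require Import structures.
From mathcomp Require Import all_boot all_order all_algebra.
From mathcomp Require Import complex sesquilinear.
From mathcomp Require Import all_classical all_reals all_analysis.

Set Implicit Arguments.
Unset Strict Implicit.
Unset Printing Implicit Defensive.

Import Order.TTheory GRing.Theory Num.Theory.
Import numFieldNormedType.Exports.

Local Open Scope classical_set_scope.
Local Open Scope ring_scope.

(* A finite-dimensional complex Hilbert space is a [vectType] over [R[i]] with
   a positive definite Hermitian form [dot], linear in its first argument. *)

Section Orthonormal.
Variables (R : realType) (H : vectType R[i]) (dot : {dot H for Num.conj}).

Lemma gram_schmidt (S : seq H) :
  exists2 s : seq H, orthonormal dot s & (span S <= span s)%VS.
Proof.
elim: S => [|x S [s os Ss]]; first by exists [::]; rewrite ?subvv.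
have [X sX [Y [xE _ oY]]] := orthogonal_split dot s x.
have [Y0|Y0] := eqVneq Y 0.
  exists s => //; rewrite span_cons subv_add Ss andbT -memvE.
  by rewrite xE Y0 addr0.
have c0 : sqrtC (dot Y Y) != 0 by rewrite sqrtC_eq0 dnorm_eq0.
pose y := (sqrtC (dot Y Y))^-1 *: Y.
have oy : orthogonal dot [:: y] s.
  apply/orthoPl => z zs.
  by rewrite linearZl_LR /= (orthoPl oY _ zs) mulr0.
exists (y :: s).
  rewrite -cat1s orthonormal_cat os oy andbT /=.
  rewrite /orthonormal /= !andbT dnormZ normfV ger0_norm ?sqrtC_ge0 ?dnorm_ge0//.
  by rewrite exprVn sqrtCK mulVf ?dnorm_eq0.
rewrite !span_cons subv_add (subv_trans Ss (addvSr _ _)) andbT -memvE xE addrC.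
rewrite memv_add//; apply/vlineP; exists (sqrtC (dot Y Y)).
by rewrite scalerA mulfV// scale1r.
Qed.

Lemma onb_exists : exists s : seq H, orthonormal dot s /\ span s = fullv.
Proof.
have [s os sub] := gram_schmidt (vbasis (@fullv _ H)).
exists s; split=> //; apply/eqP; rewrite eqEsubv subvf /=.
by rewrite (span_basis (vbasisP _)) in sub.
Qed.

Definition onb : seq H := sval (cid onb_exists).

Lemma onbP : orthonormal dot onb /\ span onb = fullv.
Proof. exact: (svalP (cid onb_exists)). Qed.

(* The Hilbert--Schmidt inner product, tr(T^* S). *)
Definition hs (S T : 'End(H)) : R[i] := \sum_(e <- onb) dot (S e) (T e).

Lemma hs_bilinear : bilinear_for *%R (Num.conj \; *%R) hs.
Proof.
split=> [T a S S'|S a T T'] /=; rewrite /hs mulr_sumr -big_split /=;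
  apply: eq_bigr => e _; rewrite add_lfunE scale_lfunE.
- by rewrite linearDl /= linearZl_LR.
- by rewrite linearDr /= linearZr_LR.
Qed.

HB.instance Definition _ :=
  bilinear_isBilinear.Build R[i] 'End(H) 'End(H) R[i] *%R
    (Num.conj \; *%R) hs hs_bilinear.

Lemma hs_hermitian S T : hs S T = (-1) ^+ false * Num.conj (hs T S).
Proof.
rewrite expr0 mul1r /hs rmorph_sum; apply: eq_bigr => e _ /=.
by rewrite (hermC dot) /= expr0 mul1r.
Qed.

HB.instance Definition _ :=
  isHermitianSesquilinear.Build R[i] 'End(H) false Num.conj hs hs_hermitian.

Lemma hs_gt0 T : T != 0 -> 0 < hs T T.
Proof.
move=> T0; rewrite lt_def sumr_ge0 ?andbT; last by move=> e _; exact: dnorm_ge0.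
apply: contra T0; rewrite psumr_eq0; last by move=> e _; exact: dnorm_ge0.
move=> /allP Te; apply/eqP/lfunP => x; rewrite zero_lfunE.
have : x \in span onb by rewrite (onbP.2) memvf.
move=> /(@coord_span _ _ _ (in_tuple onb)) ->.
rewrite linear_sum big1// => i _; rewrite linearZ /=.
have /eqP := Te _ (mem_nth 0 (ltn_ord i)).
by move/eqP; rewrite /= dnorm_eq0 => /eqP ->; rewrite scaler0.
Qed.

HB.instance Definition _ := isDotProduct.Build R[i] 'End(H) hs hs_gt0.

End Orthonormal.

Section Circle.
Variable R : realType.

Local Notation ReC := (@complex.Re R).
Local Notation ImC := (@complex.Im R).

(* The unit circle is parametrised by [t |-> exp (2 * pi * i * t)], t in [0, 1],
   which carries Lebesgue measure on [0, 1] to normalised Lebesgue measure.  A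
   function on the circle is represented by a function of the parameter [t]. *)
Definition circ (t : R) : R[i] := Complex (cos (2 * pi * t)) (sin (2 * pi * t)).

Definition unitI : set R := `[0, 1].

Definition leb : {measure set (measurableTypeR R) -> \bar R} := lebesgue_measure.

Definition cint (f : R -> R[i]) : R[i] :=
  Complex (\int[leb]_(t in unitI) ReC (f t))
          (\int[leb]_(t in unitI) ImC (f t)).

Definition cmeasurable (f : R -> R[i]) :=
  measurable_fun unitI (ReC \o f) /\
  measurable_fun unitI (ImC \o f).

Definition aeeq (U : Type) (f g : R -> U) := f = g %[ae leb in unitI].

Section Vector.
Variable U : vectType R[i].
Implicit Types f : R -> U.

Definition vint f : U :=
  \sum_i cint (fun t => coord (vbasis (@fullv _ U)) i (f t))
         *: (vbasis (@fullv _ U))`_i.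

Definition vmeasurable f :=
  forall i, cmeasurable (fun t => coord (vbasis (@fullv _ U)) i (f t)).

Definition fourier f (k : int) : U := vint (fun t => circ t ^ (- k) *: f t).

(* The analytic extension of a Hardy-space function to the open unit disk, by
   Cauchy's formula; its Taylor coefficients at 0 are the [fourier f k]. *)
Definition extension f (z : R[i]) : U :=
  vint (fun t => (1 - z * Num.conj (circ t))^-1 *: f t).

End Vector.

Section Spaces.
Variables (U : vectType R[i]) (dot : {dot U for Num.conj}).
Implicit Types f g : R -> U.

Definition hnorm (u : U) : R := Num.sqrt (ReC (dot u u)).

Definition L2 : set (R -> U) := [set f | vmeasurable f /\
  (\int[leb]_(t in unitI) (hnorm (f t) ^+ 2)%:E < +oo)%E].

Definition ip f g : R[i] := cint (fun t => dot (f t) (g t)).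

Definition L2norm f : R := Num.sqrt (ReC (ip f f)).

Definition H2 : set (R -> U) :=
  [set f | L2 f /\ forall k : int, k < 0 -> fourier f k = 0].

Definition Hinf : set (R -> U) := [set f | H2 f /\
  exists M : R, \forall t \ae leb, unitI t -> hnorm (f t) <= M].

End Spaces.

End Circle.

Section ModelSpaces.
Variables (R : realType) (H : vectType R[i]) (dot : {dot H for Num.conj}).

(* A vector of L^2(H) is an a.e.-class of functions.  Subspaces are given by
   their measurable representatives, and operators act on representatives. *)
Local Notation Hfun := (R -> H).
Local Notation Lfun := (R -> 'End(H)).
Implicit Types (V W : set Hfun) (A B : Hfun -> Hfun) (f g : Hfun).
Implicit Types Theta Phi : Lfun.

Definition bounded_operator V W A : Prop :=
  [/\ forall f, V f -> W (A f),
      forall f g, V f -> V g -> aeeq f g -> aeeq (A f) (A g),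
      forall (c : R[i]) f g, V f -> V g ->
        aeeq (A (fun t => c *: f t + g t)) (fun t => c *: A f t + A g t)
    & exists M : R, forall f, V f -> L2norm dot (A f) <= M * L2norm dot f].

(* The adjoint of a bounded operator [B] with domain the closed subspace [V]; it
   is determined up to a.e. equality, like [projection] below. *)
Definition adjoint_on V B : Hfun -> Hfun := fun f =>
  xget (fun=> 0) [set d | V d /\ forall g, V g -> ip dot (B g) f = ip dot g d].

Definition projection V : Hfun -> Hfun := fun f =>
  xget (fun=> 0) [set p | V p /\
    forall g, V g -> ip dot (fun t => f t - p t) g = 0].

Definition mulop Phi f : Hfun := fun t => Phi t (f t).

Definition opnorm (T : 'End(H)) : R :=
  sup [set hnorm dot (T x) | x in [set x | hnorm dot x <= 1]].

Definition unitary_operator (T : 'End(H)) := isometry dot dot T /\ limg T = fullv.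

Definition inner_function Theta :=
  Hinf (hs dot) Theta /\ \forall t \ae leb R, unitI t -> unitary_operator (Theta t).

Definition is_pure Theta := opnorm (extension Theta 0) < 1.

Definition model_space Theta : set Hfun := [set f | H2 dot f /\
  forall g, H2 dot g -> ip dot f (mulop Theta g) = 0].

Definition model_space_inf Theta : set Hfun := model_space Theta `&` Hinf dot.

Definition model_proj Theta := projection (model_space Theta).

Definition truncated_toeplitz Theta2 Phi f : Hfun := model_proj Theta2 (mulop Phi f).

(* A bounded [A] is the truncated Toeplitz operator of symbol [Phi] when it
   extends it from the dense subspace [model_space_inf Theta1]. *)
Definition MT Theta1 Theta2 : set (Hfun -> Hfun) :=
  [set A | bounded_operator (model_space Theta1) (model_space Theta2) A /\
    exists2 Phi, L2 (hs dot) Phi &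
      forall f, model_space_inf Theta1 f ->
        aeeq (A f) (truncated_toeplitz Theta2 Phi f)].

Definition compressed_shift Theta f : Hfun := model_proj Theta (fun t => circ t *: f t).

(* The adjoint of [compressed_shift Theta], as P_Theta(\bar z f). *)
Definition compressed_shift_adj Theta f : Hfun :=
  model_proj Theta (fun t => Num.conj (circ t) *: f t).

Definition Dop Theta f : Hfun := fun t =>
  f t - compressed_shift_adj Theta (compressed_shift Theta f) t.

(* For pure inner [Theta] this lies in [model_space Theta] and has finite
   dimension; [L2] only asks for a measurable representative. *)
Definition Dspace Theta : set Hfun := [set f | L2 dot f /\
  exists x : H, aeeq f (fun t =>
    Num.conj (circ t) *: (Theta t x - extension Theta 0 x))].

End ModelSpaces.

(* Main.v *)
(* Let S_i be the compressed shift of K_{Theta_i} and J_i x = \bar z (Theta_i - Theta_i(0)) x.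
   For f in K_{Theta_i} one has z f = S_i f + Theta_i c_i(f) with c_i(f) in H, and then
   c_i = J_i^* and I - S_i^* S_i = J_i c_i.  Since Theta_i is pure, J_i is bounded below, so
   with E_i = B_i J_i the operator equation amounts to
     <A f, g> - <A S_1 f, S_2 g> = <E_1 c_1(f), g> + <f, E_2 c_2(g)>,
   where E_1 : H -> K_{Theta_2} and E_2 : H -> K_{Theta_1} are arbitrary linear maps.
   If A has symbol Phi, expanding z f and z g on the left-hand side gives this identity with
   E_1 x = P_{Theta_2}(\bar z P_{Theta_2}(Phi Theta_1 x)) and
   E_2 y = P_{Theta_1}(\bar z Phi^* Theta_2 y).
   Conversely, S_i^n f tends to 0 and Theta_i^* f is the sum of the \bar z^{n+1} c_i(S_i^n f),
   so summing the identity along the orbits of f and g telescopes to <A f, g> = <Phi f, g>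
   with Phi = z E_1 Theta_1^* + \bar z Theta_2 E_2^*, the E_i being read as functions
   with values in L(H). *)
From HB Require Import structures.
From mathcomp Require Import all_boot all_order all_algebra.
From mathcomp Require Import complex sesquilinear ring lra.
From mathcomp Require Import all_classical all_reals all_analysis.
From mathcomp Require Import measurable_realfun.
Require Import Defs.

Set Implicit Arguments.
Unset Strict Implicit.
Unset Printing Implicit Defensive.

Import Order.TTheory GRing.Theory Num.Theory.
Import numFieldNormedType.Exports.

Local Open Scope classical_set_scope.
Local Open Scope ring_scope.

(** * Semi-inner-product spaces *)

(** Two obstacles shape the proof. A vector of L^2 is represented by a function, so projections,
    adjoints and the given operators are determined, and linear, only up to null functions. The
    operator theory is therefore carried out in an abstract space with a semidefinite form, where
    equality becomes [n2 (f - g) = 0], and where S_Theta, its adjoint and the defect maps have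
    explicit formulas that involve no choice; the concrete operators are compared with these
    formulas afterwards. The analytic input is the completeness of L^2(H) and the totality of the
    functions z^k x. The second obstacle is that Phi is merely square integrable, so that Phi f is
    in L^2 for bounded f only. The defect identity is checked for bounded f, which is possible
    because S_Theta f = z f - Theta c(f) is bounded when f is; conversely <A f, g> = <Phi f, g> is
    proved for bounded f and g. Both extend by density: polynomials, corrected by Theta times
    polynomials, are bounded and dense in K_Theta. *)

Section ComplexParts.
Variable R : realType.
Implicit Types z c : R[i].
Local Notation Re := (@complex.Re R).
Local Notation Im := (@complex.Im R).

Lemma eq_complexP z c : Re z = Re c -> Im z = Im c -> z = c.
Proof. by case: z c => [a b] [a' b'] /= -> ->. Qed.

Lemma ReD z c : Re (z + c) = Re z + Re c. Proof. by case: z c => [? ?] [? ?]. Qed.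
Lemma ImD z c : Im (z + c) = Im z + Im c. Proof. by case: z c => [? ?] [? ?]. Qed.
Lemma ReM z c : Re (z * c) = Re z * Re c - Im z * Im c.
Proof. by case: z c => [? ?] [? ?]. Qed.
Lemma ImM z c : Im (z * c) = Re z * Im c + Im z * Re c.
Proof. by case: z c => [? ?] [? ?]. Qed.
Lemma ReJ z : Re (Num.conj z) = Re z. Proof. by case: z. Qed.
Lemma ImJ z : Im (Num.conj z) = - Im z. Proof. by case: z. Qed.

Lemma ge0_Re_Im z : 0 <= z -> 0 <= Re z /\ Im z = 0.
Proof. by case: z => a b; rewrite lecE /= => /andP[/eqP -> ->]. Qed.

Definition sqmod z : R := Re z ^+ 2 + Im z ^+ 2.

Lemma sqmod_ge0 z : 0 <= sqmod z. Proof. by rewrite addr_ge0 ?sqr_ge0. Qed.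

Lemma sqmod_eq0 z : sqmod z = 0 -> z = 0.
Proof.
by move=> /eqP; rewrite paddr_eq0 ?sqr_ge0// !sqrf_eq0 => /andP[/eqP ? /eqP ?]; exact: eq_complexP.
Qed.

Lemma sqmodD z c : sqmod (z + c) <= 2 * sqmod z + 2 * sqmod c.
Proof.
case: z c => [a b] [a' b']; rewrite /sqmod /=.
have := sqr_ge0 (a - a'); have := sqr_ge0 (b - b'); rewrite !expr2; lra.
Qed.

Lemma sqmodM z c : sqmod (z * c) = sqmod z * sqmod c.
Proof. by case: z c => [a b] [a' b']; rewrite /sqmod /=; ring. Qed.

Lemma le0_of_small (x C : R) : (forall e, 0 < e -> x <= e * C) -> x <= 0.
Proof.
move=> small; rewrite leNgt; apply/negP => x0.
have C0 : 0 < C by have := small 1 ltr01; rewrite mul1r; exact: lt_le_trans.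
have := small (x / C / 2); rewrite !divr_gt0// => /(_ isT).
rewrite mulrAC divfK ?gt_eqF// => h; lra.
Qed.

Lemma exp4V_small (e : R) : 0 < e -> exists n, 4^-1 ^+ n < e.
Proof.
move=> e0; have := archi_boundP (ltW (_ : 0 < e^-1)); rewrite invr_gt0 => /(_ e0).
set n := Num.bound _ => ne; exists n; rewrite exprVn invf_plt ?posrE ?exprn_gt0//.
by rewrite (lt_le_trans ne)// -natrX ler_nat ltnW// ltn_expl.
Qed.

End ComplexParts.

Section SemiHilbert.
Variables (R : realType) (V : lmodType R[i]).
Local Notation Re := (@complex.Re R).

(* Elements of [V] will be functions rather than a.e. classes, hence [ip] is only
   semidefinite.  Completeness is asked of geometrically Cauchy sequences only,
   with a rate, so that [V] needs no topology. *)
Record semi_hilbert (L : V -> Prop) (ip : V -> V -> R[i]) : Prop := SemiHilbert {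
  sh_P : forall a f g, L f -> L g -> L (a *: f + g);
  sh_0 : L 0;
  sh_ipP : forall a f g h, L f -> L g -> L h -> ip (a *: f + g) h = a * ip f h + ip g h;
  sh_ipC : forall f g, L f -> L g -> ip f g = Num.conj (ip g f);
  sh_ge0 : forall f, L f -> 0 <= ip f f;
  sh_complete : forall f : nat -> V, (forall n, L (f n)) ->
    (forall n m, (n <= m)%N -> Re (ip (f m - f n) (f m - f n)) <= 4^-1 ^+ n) ->
    exists2 h, L h & exists C, forall n, Re (ip (h - f n) (h - f n)) <= C * 4^-1 ^+ n }.

Variables (L : V -> Prop) (ip : V -> V -> R[i]) (sh : semi_hilbert L ip).
Implicit Types (f g h : V) (a : R[i]).

Definition sqnorm f := Re (ip f f).
Local Notation n2 := sqnorm.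

Lemma sh_D f g : L f -> L g -> L (f + g).
Proof. by move=> Lf Lg; rewrite -[f]scale1r; exact: sh_P sh _ _ _ Lf Lg. Qed.

Lemma sh_Z a f : L f -> L (a *: f).
Proof. by move=> Lf; rewrite -[_ *: _]addr0; exact: sh_P sh _ _ _ Lf (sh_0 sh). Qed.

Lemma sh_N f : L f -> L (- f).
Proof. by move=> Lf; rewrite -scaleN1r; exact: sh_Z. Qed.

Lemma sh_B f g : L f -> L g -> L (f - g).
Proof. by move=> Lf Lg; apply: sh_D => //; exact: sh_N. Qed.

Lemma sh_sum I (r : seq I) (F : I -> V) : (forall i, L (F i)) -> L (\sum_(i <- r) F i).
Proof.
by move=> LF; elim/big_rec: _ => [|i f _ Lf]; [exact: sh_0 sh|exact: sh_D].
Qed.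

Lemma sh_ipDl f g h : L f -> L g -> L h -> ip (f + g) h = ip f h + ip g h.
Proof. by move=> Lf Lg Lh; rewrite -[f in LHS]scale1r (sh_ipP sh)// mul1r. Qed.

Lemma sh_ip0l h : L h -> ip 0 h = 0.
Proof.
move=> Lh; have L0 := sh_0 sh; apply: (addrI (ip 0 h)).
by rewrite -sh_ipDl// !addr0.
Qed.

Lemma sh_ipZl a f h : L f -> L h -> ip (a *: f) h = a * ip f h.
Proof.
move=> Lf Lh; rewrite -[_ *: _]addr0 (sh_ipP sh) ?sh_ip0l ?addr0//; exact: sh_0 sh.
Qed.

Lemma sh_ipNl f h : L f -> L h -> ip (- f) h = - ip f h.
Proof. by move=> Lf Lh; rewrite -scaleN1r sh_ipZl// mulN1r. Qed.

Lemma sh_ipBl f g h : L f -> L g -> L h -> ip (f - g) h = ip f h - ip g h.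
Proof. by move=> Lf Lg Lh; rewrite sh_ipDl ?sh_ipNl//; exact: sh_N. Qed.

Lemma sh_ipDr f g h : L f -> L g -> L h -> ip h (f + g) = ip h f + ip h g.
Proof.
move=> Lf Lg Lh; rewrite (sh_ipC sh Lh (sh_D Lf Lg)) sh_ipDl// rmorphD.
by rewrite (sh_ipC sh Lh Lf) (sh_ipC sh Lh Lg).
Qed.

Lemma sh_ipZr a f h : L f -> L h -> ip h (a *: f) = Num.conj a * ip h f.
Proof.
by move=> Lf Lh; rewrite (sh_ipC sh Lh (sh_Z _ Lf)) sh_ipZl// rmorphM (sh_ipC sh Lh Lf).
Qed.

Lemma sh_ip0r h : L h -> ip h 0 = 0.
Proof. by move=> Lh; rewrite (sh_ipC sh Lh (sh_0 sh)) sh_ip0l// rmorph0. Qed.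

Lemma sh_ipNr f h : L f -> L h -> ip h (- f) = - ip h f.
Proof. by move=> Lf Lh; rewrite -scaleN1r sh_ipZr// rmorphN1 mulN1r. Qed.

Lemma sh_ipBr f g h : L f -> L g -> L h -> ip h (f - g) = ip h f - ip h g.
Proof. by move=> Lf Lg Lh; rewrite sh_ipDr ?sh_ipNr//; exact: sh_N. Qed.

Lemma sh_ip_suml I (r : seq I) (F : I -> V) h : (forall i, L (F i)) -> L h ->
  ip (\sum_(i <- r) F i) h = \sum_(i <- r) ip (F i) h.
Proof.
move=> LF Lh; elim: r => [|i r IH]; first by rewrite !big_nil sh_ip0l.
by rewrite !big_cons sh_ipDl ?IH//; exact: sh_sum.
Qed.

Lemma sh_ip_sumr I (r : seq I) (F : I -> V) h : (forall i, L (F i)) -> L h ->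
  ip h (\sum_(i <- r) F i) = \sum_(i <- r) ip h (F i).
Proof.
move=> LF Lh; elim: r => [|i r IH]; first by rewrite !big_nil sh_ip0r.
by rewrite !big_cons sh_ipDr ?IH//; exact: sh_sum.
Qed.

Lemma sqnorm_ge0 f : L f -> 0 <= n2 f.
Proof. by move=> /(sh_ge0 sh)/ge0_Re_Im[]. Qed.

Lemma ip_sqnorm f : L f -> ip f f = Complex (n2 f) 0.
Proof.
move=> Lf; rewrite /sqnorm; have [_] := ge0_Re_Im (sh_ge0 sh Lf).
by case: (ip f f) => x y /= ->.
Qed.

Lemma sqnormD f g : L f -> L g -> n2 (f + g) = n2 f + n2 g + 2 * Re (ip f g).
Proof.
move=> Lf Lg; rewrite /sqnorm sh_ipDl ?sh_ipDr//; try exact: sh_D.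
by rewrite !ReD (sh_ipC sh Lg Lf) ReJ; ring.
Qed.

Lemma sqnormZ a f : L f -> n2 (a *: f) = sqmod a * n2 f.
Proof.
move=> Lf; have Laf := sh_Z a Lf.
rewrite /sqnorm sh_ipZl// sh_ipZr// ip_sqnorm// /sqmod.
by rewrite !ReM !ImM ReJ ImJ /=; ring.
Qed.

Lemma sqnormN f : L f -> n2 (- f) = n2 f.
Proof. by move=> Lf; have LN := sh_N Lf; rewrite /sqnorm sh_ipNl// sh_ipNr// opprK. Qed.

Lemma sqnormB f g : L f -> L g -> n2 (f - g) = n2 f + n2 g - 2 * Re (ip f g).
Proof.
move=> Lf Lg; have LN := sh_N Lg; rewrite sqnormD// sqnormN// sh_ipNr//.
by case: (ip f g) => x y /=; rewrite mulrN.
Qed.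

Lemma sqnormBC f g : L f -> L g -> n2 (f - g) = n2 (g - f).
Proof. by move=> Lf Lg; rewrite -(sqnormN (sh_B Lf Lg)) opprB. Qed.

Lemma sqnormD_le f g : L f -> L g -> n2 (f + g) <= 2 * n2 f + 2 * n2 g.
Proof.
move=> Lf Lg; have := sqnorm_ge0 (sh_B Lf Lg); rewrite sqnormB// sqnormD//; lra.
Qed.

(** The square norm of f - s c g, with c = <f, g> and s real, is the nonnegative polynomial [key] in
    s; s = 1 / [n2 g] gives the bound. The form is semidefinite, so [n2 g] may vanish for nonzero g:
    the polynomial is then affine in s, and the value chosen for s would make it -1 unless c = 0. *)
Lemma sh_CauchySchwarz f g : L f -> L g -> sqmod (ip f g) <= n2 f * n2 g.
Proof.
move=> Lf Lg; set c := ip f g.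
have key s : 0 <= n2 f + s ^+ 2 * sqmod c * n2 g - 2 * s * sqmod c.
  have LZ := sh_Z (Complex s 0 * c) Lg.
  have := sqnorm_ge0 (sh_B Lf LZ); rewrite sqnormB// sqnormZ// sh_ipZr// -/c sqmodM.
  by case: c {LZ} => a b; rewrite /sqmod /=; congr (0 <= _); ring.
have := sqnorm_ge0 Lg; rewrite le_eqVlt => /predU1P[g0|gp].
  have := key ((n2 f + 1) / (2 * sqmod c)); rewrite -g0 !mulr0 addr0.
  move: (sqmod c) (n2 f) => q a; have [->//|q0] := eqVneq q 0.
  have -> : a - 2 * ((a + 1) / (2 * q)) * q = - 1 by field.
  by rewrite ler0N1.
have := key (n2 g)^-1; move: (sqmod c) (n2 f) (n2 g) gp => q a b b0.
have -> : a + b^-1 ^+ 2 * q * b - 2 * b^-1 * q = a - q / b by field; exact: lt0r_neq0.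
by rewrite subr_ge0 ler_pdivrMr.
Qed.

Lemma sqnorm0_ip f g : L f -> L g -> n2 f = 0 -> ip f g = 0.
Proof.
move=> Lf Lg f0; apply: sqmod_eq0; apply/eqP.
by rewrite eq_le sqmod_ge0 andbT (le_trans (sh_CauchySchwarz Lf Lg))// f0 mul0r.
Qed.

(** Substitution of equals: [n2 (f - g) = 0] is the abstract form of almost everywhere equality. *)
Lemma sqnorm0_subl f g h : L f -> L g -> L h -> n2 (f - g) = 0 -> ip f h = ip g h.
Proof.
move=> Lf Lg Lh fg; apply/eqP; rewrite -subr_eq0 -sh_ipBl//.
by rewrite sqnorm0_ip//; exact: sh_B.
Qed.

Definition approximable (T : V -> Prop) p :=
  forall e : R, 0 < e -> exists2 t, T t & n2 (p - t) < e.

Lemma approximable_ip (T : V -> Prop) p g : (forall t, T t -> L t) -> L p -> L g ->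
  approximable T p -> (forall t, T t -> ip t g = 0) -> ip p g = 0.
Proof.
move=> TL Lp Lg pT Tg; apply: sqmod_eq0; apply/eqP; rewrite eq_le sqmod_ge0 andbT.
apply: (@le0_of_small _ _ (n2 g)) => e e0.
have [t Tt pt] := pT e e0; have Lt := TL _ Tt.
have -> : ip p g = ip (p - t) g by rewrite sh_ipBl// (Tg t)// subr0.
rewrite (le_trans (sh_CauchySchwarz (sh_B Lp Lt) Lg))// ler_wpM2r ?sqnorm_ge0//.
exact: ltW.
Qed.

(* [T] need not be closed: the minimizing sequence for the distance from [f] to
   [T] converges in the complete space [L], and its limit [p] is merely a limit
   of elements of [T]. *)
Lemma orthogonal_projection (T : V -> Prop) f : (forall t, T t -> L t) -> T 0 ->
  (forall a t t', T t -> T t' -> T (a *: t + t')) -> L f ->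
  exists p, [/\ L p, approximable T p & forall t, T t -> ip (f - p) t = 0].
Proof.
move=> TL T0 TP Lf.
pose D : set R := [set n2 (f - t) | t in [set t | T t]].
have D0 : D !=set0 by exists (n2 (f - 0)), 0.
have Dlb : lbound D 0 by move=> _ [t Tt <-]; rewrite sqnorm_ge0//; exact: sh_B (TL _ Tt).
have hD : has_inf D by split => //; exists 0.
pose d := inf D.
have d_le t : T t -> d <= n2 (f - t) by move=> Tt; apply: ge_inf; [exists 0|exists t].
(* With the factor 1/4 the parallelogram law gives 2 [eps n] + 2 [eps m] <= 4^-n, the rate that
   [sh_complete] asks for. *)
pose eps n : R := 4^-1 ^+ n / 4.
have eps0 n : 0 < eps n by rewrite divr_gt0// exprn_gt0// invr_gt0.
have /choice[t tP] : forall n, exists t, T t /\ n2 (f - t) < d + eps n.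
  by move=> n; have [_ [t Tt <-]] := inf_adherent (eps0 n) hD; exists t.
have Lt n : L (t n) by apply: TL; have [] := tP n.
have tC n m : (n <= m)%N -> n2 (t m - t n) <= 4^-1 ^+ n.
  move=> nm; pose u := (Complex 2^-1 0 : R[i]) *: (t n + t m).
  have Tu : T u.
    rewrite /u -[_ *: _]addr0; apply: (TP) => //.
    by rewrite -[t n]scale1r; apply: TP; [case: (tP n)|case: (tP m)].
  have := d_le _ Tu; have [_ hn] := tP n; have [_ hm] := tP m.
  have : (4^-1 : R) ^+ m <= 4^-1 ^+ n.
    by apply: ler_wiXn2l nm; rewrite ?invr_ge0 ?invf_le1 ?ler1n.
  rewrite -[4^-1 ^+ m](divfK (_ : 4 != 0)) ?pnatr_eq0// -/(eps m).
  have -> : 4^-1 ^+ n = eps n * 4 by rewrite /eps divfK// pnatr_eq0.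
  have E : n2 (t m - t n) = 2 * n2 (f - t n) + 2 * n2 (f - t m) - 4 * n2 (f - u).
    have Ls := sh_D (Lt n) (Lt m).
    rewrite /u !sqnormB// ?sqnormZ ?sh_ipZr ?sh_ipDr ?sqnormD//; try exact: sh_Z.
    rewrite (sh_ipC sh (Lt m) (Lt n)) !ReM !ReD !ReJ !ImJ /sqmod /=.
    by field.
  rewrite E; lra.
have [p Lp [C pC]] := sh_complete sh Lt tC.
have C0 : 0 <= C.
  by have := pC 0%N; rewrite expr0 mulr1; apply: le_trans; exact/sqnorm_ge0/sh_B.
exists p; split => //.
  move=> e e0; have [n ne] : exists n, 4^-1 ^+ n < e / (C + 1).
    by apply: exp4V_small; rewrite divr_gt0// ltr_wpDl.
  exists (t n); first by case: (tP n).
  apply: (le_lt_trans (pC n)); apply: (@le_lt_trans _ _ ((C + 1) * 4^-1 ^+ n)).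
    by rewrite ler_wpM2r ?exprn_ge0 ?invr_ge0// lerDl.
  by rewrite mulrC -ltr_pdivlMr// ltr_wpDl.
move=> t0 Tt0; have L0 := TL _ Tt0.
(* Moving [t n] along [t0] cannot bring the squared distance below [d]. The optimal step involves 1
   / [n2 t0]; the slightly shorter step 1 / (1 + [n2 t0]) also covers null [t0]. *)
have small n : sqmod (ip (f - t n) t0) <= eps n * (1 + n2 t0).
  pose c := ip (f - t n) t0; pose s : R := (1 + n2 t0)^-1.
  have L1 := sh_B Lf (Lt n); have g0 := sqnorm_ge0 L0.
  have := d_le ((Complex s 0 * c) *: t0 + t n) (TP _ _ _ Tt0 (tP n).1).
  rewrite opprD addrA addrAC => dle.
  have {dle} : d <= n2 (f - t n) + s ^+ 2 * sqmod c * n2 t0 - 2 * s * sqmod c.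
    apply: le_trans dle _; have LZ := sh_Z (Complex s 0 * c) L0.
    rewrite (sqnormB L1 LZ) sqnormZ// sh_ipZr// -/c sqmodM.
    rewrite le_eqVlt; apply/orP; left; apply/eqP.
    by case: c {LZ} => a b; rewrite /sqmod /=; ring.
  have [_] := tP n; have := sqmod_ge0 c; rewrite /s.
  move: (sqmod c) (n2 t0) (n2 (f - t n)) (sqnorm_ge0 L0) => q b x b0 q0 xd.
  have s0 : 0 < (1 + b)^-1 by rewrite invr_gt0 ltr_wpDr.
  have sb : (1 + b)^-1 * b = 1 - (1 + b)^-1 by field; rewrite gt_eqF// ltr_wpDr.
  have -> : (1 + b)^-1 ^+ 2 * q * b = (1 + b)^-1 * q * ((1 + b)^-1 * b) by ring.
  rewrite sb -ler_pdivrMr ?ltr_wpDr// => h.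
  have := mulr_ge0 (mulr_ge0 (ltW s0) q0) (ltW s0).
  move: h xd; rewrite -/(q / (1 + b)); move: (1 + b)^-1 => r; lra.
apply: sqmod_eq0; apply/eqP; rewrite eq_le sqmod_ge0 andbT.
apply: (@le0_of_small _ _ ((1 + n2 t0) / 2 + 2 * C * n2 t0)) => e e0.
have [n ne] := exp4V_small e0.
have -> : ip (f - p) t0 = ip (f - t n) t0 + - ip (p - t n) t0.
  by rewrite -sh_ipBl//; [congr ip; rewrite opprB subrKA|exact: sh_B..].
apply: le_trans (sqmodD _ _) _.
have -> : sqmod (- ip (p - t n) t0) = sqmod (ip (p - t n) t0).
  by case: (ip _ _) => a b; rewrite /sqmod /= !sqrrN.
apply: (@le_trans _ _ (4^-1 ^+ n * ((1 + n2 t0) / 2 + 2 * C * n2 t0))); last first.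
  rewrite ler_wpM2r ?(ltW ne)//.
  by rewrite addr_ge0 ?divr_ge0 ?mulr_ge0 ?addr_ge0 ?sqnorm_ge0.
have := small n; have := le_trans (sh_CauchySchwarz (sh_B Lp (Lt n)) L0)
  (ler_wpM2r (sqnorm_ge0 L0) (pC n)).
rewrite /eps; move: (4^-1 ^+ n) (n2 t0) (sqmod _) (sqmod _) => x b y z; lra.
Qed.

End SemiHilbert.

Section OrthonormalBasis.
Variables (R : realType) (H : vectType R[i]) (dot : {dot H for Num.conj}).
Local Notation onb := (onb dot).

Lemma dotC x y : dot x y = Num.conj (dot y x).
Proof. by rewrite (hermC dot) /= expr0 mul1r. Qed.

Lemma onb_expansion x : x = \sum_(e <- onb) dot x e *: e.
Proof.
have [oo so] := onbP dot; have fo := orthonormal_free oo.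
have xo : x \in span onb by rewrite so memvf.
have xE := coord_span (X := in_tuple onb) xo.
rewrite [LHS]xE (big_nth 0) big_mkord; apply: eq_bigr => i _; congr (_ *: _).
rewrite {2}xE linear_sumlz (bigD1 i)//= big1 ?addr0 => [|j ji].
  rewrite linearZl_LR /=; have /orthonormalP[_ ->] := oo; rewrite ?mem_nth//.
  by rewrite eqxx mulr1.
rewrite linearZl_LR /=; have /orthonormalP[uo ->] := oo; rewrite ?mem_nth//.
by rewrite nth_uniq//= val_eqE (negbTE ji) mulr0.
Qed.

Lemma dot_inj x y : (forall z, dot x z = dot y z) -> x = y.
Proof.
move=> xy; apply/eqP; rewrite -subr_eq0 -(dnorm_eq0 dot) linearBl /=.
by rewrite xy subrr.
Qed.

Definition riesz (phi : H -> R[i]) : H := \sum_(e <- onb) Num.conj (phi e) *: e.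

Lemma dot_riesz phi x : (forall a u v, phi (a *: u + v) = a * phi u + phi v) ->
  dot x (riesz phi) = phi x.
Proof.
move=> phiP; have phi0 : phi 0 = 0.
  by have := phiP 1 0 0; rewrite scale1r mul1r addr0 => /(canLR (addrK _)); rewrite subrr.
rewrite linear_sumr [in RHS](onb_expansion x).
elim: onb => [|e r IH]; first by rewrite !big_nil phi0.
by rewrite !big_cons phiP -IH linearZr_LR /= conjCK mulrC.
Qed.

End OrthonormalBasis.

(** * Expansions along a sequence of mutually orthogonal copies of H *)

Section OrthonormalFamily.
Variables (R : realType) (H : vectType R[i]) (dot : {dot H for Num.conj}).
Variables (V : lmodType R[i]) (L : V -> Prop) (ip : V -> V -> R[i]).
Hypothesis sh : semi_hilbert L ip.
Local Notation n2 := (sqnorm ip).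
Variable b : nat -> H -> V.
Hypothesis bP : forall n a x y, b n (a *: x + y) = a *: b n x + b n y.
Hypothesis bL : forall n x, L (b n x).
Hypothesis bb : forall m n x y, ip (b m x) (b n y) = if m == n then dot x y else 0.

Lemma family0 n : b n 0 = 0.
Proof.
by have := bP n 1 0 0; rewrite !scale1r !addr0 => /(canLR (addrK _)); rewrite subrr.
Qed.

(** This is the adjoint of [b n] applied to f. The conjugation makes the functional linear in x, and
    Riesz is applied in the finite-dimensional H rather than in V. *)
Definition coef f n : H := riesz dot (fun x => Num.conj (ip f (b n x))).

Lemma dot_coef f n x : L f -> dot (coef f n) x = ip f (b n x).
Proof.
move=> Lf; rewrite dotC dot_riesz ?conjCK// => a u v; rewrite bP.
rewrite (sh_ipDr sh (sh_Z sh a (bL n u)) (bL n v) Lf) (sh_ipZr sh a (bL n u) Lf).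
by rewrite rmorphD rmorphM /= conjCK.
Qed.

Definition fsum (v : nat -> H) n := \sum_(i < n) b i (v i).

Lemma fsumL v n : L (fsum v n). Proof. by apply: (sh_sum sh) => i. Qed.

Lemma ip_fsum v n m x : ip (fsum v n) (b m x) = if (m < n)%N then dot (v m) x else 0.
Proof.
rewrite (sh_ip_suml sh)//; under eq_bigr do rewrite bb.
case: ltnP => mn.
  rewrite (bigD1 (Ordinal mn))//= eqxx big1 ?addr0// => i.
  by rewrite -val_eqE /= => /negbTE ->.
by rewrite big1// => i _; case: eqP => // im; move: (ltn_ord i); rewrite im ltnNge mn.
Qed.

Lemma fsumP a v w n : fsum (fun i => a *: v i + w i) n = a *: fsum v n + fsum w n.
Proof.
by rewrite /fsum scaler_sumr -big_split; apply: eq_bigr => i _; rewrite bP.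
Qed.

Lemma fsum_widen v n m : (n <= m)%N ->
  fsum v n = fsum (fun i => if (i < n)%N then v i else 0) m.
Proof.
move=> nm; rewrite /fsum (big_ord_widen m (fun i => b i (v i)) nm) big_mkcond.
by apply: eq_bigr => i _; case: ifP => //; rewrite family0.
Qed.

(** The remainder f - [fsum (coef f) m] is orthogonal to the first m copies of H, which contain
    [fsum v n]; then Pythagoras. Allowing n < m turns one good approximation into a bound for all
    later partial sums. *)
Lemma coef_best f v n m : L f -> (n <= m)%N ->
  n2 (f - fsum (coef f) m) <= n2 (f - fsum v n).
Proof.
move=> Lf nm; have Lr := sh_B sh Lf (fsumL (coef f) m).
set w := fun i => if (i < n)%N then v i else 0.
have Ld := sh_B sh (fsumL (coef f) m) (fsumL w m).
have -> : f - fsum v n = (f - fsum (coef f) m) + (fsum (coef f) m - fsum w m).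
  by rewrite subrKA (fsum_widen v nm).
rewrite (sqnormD sh Lr Ld).
suff -> : ip (f - fsum (coef f) m) (fsum (coef f) m - fsum w m) = 0.
  by rewrite mulr0 addr0 lerDl (sqnorm_ge0 sh).
rewrite [X in ip _ X]addrC -(scaleN1r (fsum w m)) -fsumP /fsum.
rewrite (sh_ip_sumr sh); [|by move=> i; exact: bL|exact: Lr].
by apply: big1 => i _; rewrite (sh_ipBl sh Lf (fsumL _ _) (bL _ _)) ip_fsum ltn_ord dot_coef// subrr.
Qed.

Definition in_span t := exists v n, t = fsum v n.

Lemma in_spanL t : in_span t -> L t. Proof. by move=> [v [n ->]]; exact: fsumL. Qed.

Lemma in_spanP a t t' : in_span t -> in_span t' -> in_span (a *: t + t').
Proof.
move=> [v [n ->]] [v' [n' ->]].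
rewrite (fsum_widen v (leq_maxl n n')) (fsum_widen v' (leq_maxr n n')) -fsumP.
by eexists; eexists.
Qed.

Section Total.
Variable C : V -> Prop.
Hypothesis CL : forall c, C c -> L c.
Hypothesis bC : forall n x c, C c -> ip (b n x) c = 0.
Hypothesis bC_total : forall h, L h -> (forall n x, ip h (b n x) = 0) ->
  (forall c, C c -> ip h c = 0) -> n2 h = 0.

(** Only [b] and [C] together are total. The projection p of f onto the span of [b] is a limit of
    vectors orthogonal to [C], so f - p is orthogonal to both families and hence null. The monomials
    of nonnegative and of negative degree will take the two roles in turn. *)
Lemma span_approximable f : L f -> (forall c, C c -> ip f c = 0) ->
  approximable ip in_span f.
Proof.
move=> Lf fC.
have [|p [Lp pT fpT]] := orthogonal_projection sh in_spanL _ in_spanP Lf.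
  by exists (fun=> 0), 0%N; rewrite /fsum big_ord0.
have tC t c : in_span t -> C c -> ip t c = 0.
  by move=> [v [n ->]] Cc; rewrite (sh_ip_suml sh)//; [apply: big1 => i _; exact: bC|exact: CL].
have pC c : C c -> ip p c = 0.
  by move=> Cc; apply: (approximable_ip sh in_spanL Lp (CL Cc) pT) => t /tC; apply.
have Lfp := sh_B sh Lf Lp.
have fp0 : n2 (f - p) = 0.
  apply: bC_total => // [n x|c Cc]; last by rewrite (sh_ipBl sh)// ?fC ?pC ?subrr//; exact: CL.
  apply: fpT; exists (fun i => if i == n then x else 0), n.+1.
  rewrite /fsum big_ord_recr /= eqxx big1 ?add0r// => i _.
  by rewrite ltn_eqF ?family0//; exact: ltn_ord.
move=> e e0; have [t Tt pt] := pT (e / 2) (divr_gt0 e0 (ltr0n _ 2)).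
exists t => //; have Lt := in_spanL Tt.
rewrite -(subrKA p) (le_lt_trans (sqnormD_le sh Lfp (sh_B sh Lp Lt)))//.
by rewrite fp0 mulr0 add0r mulrC -ltr_pdivlMr.
Qed.

Lemma fsum_coef_cvg f : L f -> (forall c, C c -> ip f c = 0) ->
  forall e : R, 0 < e -> exists N, forall n, (N <= n)%N -> n2 (f - fsum (coef f) n) < e.
Proof.
move=> Lf fC e e0; have [_ [v [N ->]] h] := span_approximable Lf fC e0.
by exists N => n Nn; exact: le_lt_trans (coef_best v Lf Nn) h.
Qed.

End Total.
End OrthonormalFamily.

(** * Shifts and inner multipliers *)

Section BilateralShift.
Variables (R : realType) (H : vectType R[i]) (dot : {dot H for Num.conj}).
Variables (V : lmodType R[i]) (L : V -> Prop) (ip : V -> V -> R[i]).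
Local Notation Re := (@complex.Re R).

(* The abstract form of L^2(H): [U] and [W] multiply by z and \bar z, and [k]
   embeds the constants. *)
Record bilateral_shift (U W : V -> V) (k : H -> V) : Prop := {
  bs_UP : forall a f g, U (a *: f + g) = a *: U f + U g;
  bs_WP : forall a f g, W (a *: f + g) = a *: W f + W g;
  bs_UW : forall f, U (W f) = f;
  bs_WU : forall f, W (U f) = f;
  bs_UL : forall f, L f -> L (U f);
  bs_WL : forall f, L f -> L (W f);
  bs_ipU : forall f g, L f -> L g -> ip (U f) (U g) = ip f g;
  bs_kP : forall a x y, k (a *: x + y) = a *: k x + k y;
  bs_kL : forall x, L (k x);
  bs_kk : forall x y, ip (k x) (k y) = dot x y;
  bs_kU : forall n x y, ip (iter n.+1 U (k x)) (k y) = 0;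
  bs_total : forall f, L f -> (forall n x, ip f (iter n U (k x)) = 0) ->
    (forall n x, ip f (iter n.+1 W (k x)) = 0) -> Re (ip f f) = 0 }.

Hypothesis sh : semi_hilbert L ip.
Local Notation n2 := (sqnorm ip).
Variables (U W : V -> V) (k : H -> V).
Hypothesis bs : bilateral_shift U W k.

Definition monomial n x := iter n U (k x).
(** The successor keeps the two families disjoint: [comonomial n] has degree -(n+1). *)
Definition comonomial n x := iter n.+1 W (k x).
Local Notation bu := monomial.
Local Notation bw := comonomial.

Lemma iterUL n f : L f -> L (iter n U f).
Proof. by move=> Lf; elim: n => //= n; exact: bs_UL bs _. Qed.

Lemma iterWL n f : L f -> L (iter n W f).
Proof. by move=> Lf; elim: n => //= n; exact: bs_WL bs _. Qed.

Lemma buL n x : L (bu n x). Proof. exact/iterUL/(bs_kL bs). Qed.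
Lemma bwL n x : L (bw n x). Proof. exact/iterWL/(bs_kL bs). Qed.

Lemma shiftUB f g : U (f - g) = U f - U g.
Proof. by rewrite [f - g]addrC -(scaleN1r g) (bs_UP bs) scaleN1r addrC. Qed.

Lemma shiftWB f g : W (f - g) = W f - W g.
Proof. by rewrite [f - g]addrC -(scaleN1r g) (bs_WP bs) scaleN1r addrC. Qed.

Lemma shift_kB x y : k (x - y) = k x - k y.
Proof. by rewrite [x - y]addrC -(scaleN1r y) (bs_kP bs) scaleN1r addrC. Qed.

Lemma iterUP n a f g : iter n U (a *: f + g) = a *: iter n U f + iter n U g.
Proof. by elim: n => //= n ->; rewrite (bs_UP bs). Qed.

Lemma iterWP n a f g : iter n W (a *: f + g) = a *: iter n W f + iter n W g.
Proof. by elim: n => //= n ->; rewrite (bs_WP bs). Qed.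

Lemma buP n a x y : bu n (a *: x + y) = a *: bu n x + bu n y.
Proof. by rewrite /monomial (bs_kP bs) iterUP. Qed.

Lemma bwP n a x y : bw n (a *: x + y) = a *: bw n x + bw n y.
Proof. by rewrite /comonomial (bs_kP bs) iterWP. Qed.

Lemma ipUW f g : L f -> L g -> ip (U f) g = ip f (W g).
Proof. by move=> Lf Lg; rewrite -{1}(bs_UW bs g) (bs_ipU bs)//; exact: bs_WL bs _ Lg. Qed.

Lemma ipWU f g : L f -> L g -> ip (W f) g = ip f (U g).
Proof. by move=> Lf Lg; rewrite -{2}(bs_UW bs f) (bs_ipU bs)//; exact: bs_WL bs _ Lf. Qed.

Lemma ipWW f g : L f -> L g -> ip (W f) (W g) = ip f g.
Proof. by move=> Lf Lg; rewrite ipWU ?(bs_UW bs)//; exact: bs_WL bs _ Lg. Qed.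

Lemma ip_iterU n f g : L f -> L g -> ip (iter n U f) g = ip f (iter n W g).
Proof.
elim: n f g => //= n IH f g Lf Lg.
by rewrite (ipUW (iterUL n Lf) Lg) (IH _ _ Lf (bs_WL bs Lg)) -iterSr.
Qed.

Lemma ip_iterW n f g : L f -> L g -> ip (iter n W f) g = ip f (iter n U g).
Proof.
elim: n f g => //= n IH f g Lf Lg.
by rewrite (ipWU (iterWL n Lf) Lg) (IH _ _ Lf (bs_UL bs Lg)) -iterSr.
Qed.

Lemma iterWK n f : iter n W (iter n U f) = f.
Proof. by elim: n => //= n IH; rewrite -[W _]iterS iterSr (bs_WU bs). Qed.

Lemma iterUK n f : iter n U (iter n W f) = f.
Proof. by elim: n => //= n IH; rewrite -[U _]iterS iterSr (bs_UW bs). Qed.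

Lemma bu_bw m n x y : ip (bu m x) (bw n y) = 0.
Proof.
rewrite ip_iterU; [|exact: bs_kL bs _|exact: bwL].
rewrite /comonomial -iterD addnS -ip_iterU; try exact: bs_kL bs _.
exact: bs_kU bs _ _ _.
Qed.

Lemma bu_bu m n x y : ip (bu m x) (bu n y) = if m == n then dot x y else 0.
Proof.
have lt a b u v : (a < b)%N -> ip (bu a u) (bu b v) = 0.
  move=> /subnKC <-; rewrite addSnnS /monomial iterD.
  rewrite (ip_iterU _ (bs_kL bs u) (iterUL a (iterUL _ (bs_kL bs v)))) iterWK.
  rewrite (sh_ipC sh (bs_kL bs u) (iterUL _ (bs_kL bs v))).
  by rewrite (bs_kU bs) rmorph0.
case: (ltngtP m n) => [/lt->//|nm|->].
  by rewrite (sh_ipC sh (buL _ _) (buL _ _)) lt// rmorph0.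
by rewrite ip_iterU ?iterWK ?(bs_kk bs)//; [exact: bs_kL bs _|exact: buL].
Qed.

Lemma bw_bw m n x y : ip (bw m x) (bw n y) = if m == n then dot x y else 0.
Proof.
have shift c f g : L f -> L g -> ip (iter c U f) (iter c U g) = ip f g.
  by move=> Lf Lg; rewrite ip_iterU ?iterWK//; exact: iterUL.
(* A common shift by z^(m+n+2) turns \bar z^(m+1) x and \bar z^(n+1) y into z^(n+1) x and z^(m+1)
   y. *)
rewrite -(shift (m.+1 + n.+1)%N _ _ (bwL _ _) (bwL _ _)) /comonomial.
rewrite {1}addnC !iterD !iterUK -[LHS]/(ip (bu n.+1 x) (bu m.+1 y)) bu_bu.
by rewrite eqSS eq_sym.
Qed.

Definition hardy f := L f /\ forall n x, ip f (bw n x) = 0.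
Local Notation H2 := hardy.

Lemma hardyP a f g : H2 f -> H2 g -> H2 (a *: f + g).
Proof.
move=> [Lf f0] [Lg g0]; split=> [|n x]; first exact: sh_P sh _ _ _ Lf Lg.
by rewrite (sh_ipP sh)// ?f0 ?g0 ?mulr0 ?addr0//; exact: bwL.
Qed.

Lemma hardyB f g : H2 f -> H2 g -> H2 (f - g).
Proof. by move=> Hf Hg; rewrite addrC -scaleN1r; exact: hardyP. Qed.

Lemma hardy_U f : H2 f -> H2 (U f).
Proof.
move=> [Lf f0]; split=> [|n x]; first exact: bs_UL bs _ Lf.
rewrite ipUW//; last exact: bwL.
exact: (f0 n.+1).
Qed.

Lemma hardy_k x : H2 (k x).
Proof. by split=> [|n y]; [exact: bs_kL bs _|exact: (bu_bw 0)]. Qed.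

Lemma hardy_fsum v n : H2 (fsum bu v n).
Proof.
split=> [|m x]; first exact: (fsumL sh buL).
rewrite (sh_ip_suml sh); [|by move=> i; exact: buL|exact: bwL].
by apply: big1 => i _; exact: bu_bw.
Qed.

Lemma hardy_fsum_cvg f : H2 f -> forall e : R, 0 < e -> exists N,
  forall n, (N <= n)%N -> n2 (f - fsum bu (coef dot ip bu f) n) < e.
Proof.
move=> [Lf f0]; pose C c := exists n x, c = bw n x.
apply: (fsum_coef_cvg sh buP buL bu_bu (C := C)) => //.
- by move=> _ [n [x ->]]; exact: bwL.
- by move=> m y _ [n [x ->]]; exact: bu_bw.
- move=> h Lh h1 h2; have h2' n x : ip h (iter n.+1 W (k x)) = 0 by apply: h2; exists n, x.
  exact: (bs_total bs Lh h1 h2').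
- by move=> _ [n [x ->]]; exact: f0.
Qed.

Lemma anti_fsum_cvg f : L f -> (forall n x, ip f (bu n x) = 0) ->
  forall e : R, 0 < e -> exists N,
  forall n, (N <= n)%N -> n2 (f - fsum bw (coef dot ip bw f) n) < e.
Proof.
move=> Lf f0; pose C c := exists n x, c = bu n x.
apply: (fsum_coef_cvg sh bwP bwL bw_bw (C := C)) => //.
- by move=> _ [n [x ->]]; exact: buL.
- move=> m y _ [n [x ->]]; rewrite (sh_ipC sh (bwL _ _) (buL _ _)).
  by rewrite bu_bw rmorph0.
- move=> h Lh h1 h2; have h2' n x : ip h (iter n U (k x)) = 0 by apply: h2; exists n, x.
  exact: (bs_total bs Lh h2' h1).
- by move=> _ [n [x ->]]; exact: f0.
Qed.

Lemma anti_hardy h g : L h -> (forall n x, ip h (bu n x) = 0) -> H2 g -> ip h g = 0.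
Proof.
move=> Lh h0 Hg; have [Lg _] := Hg; rewrite (sh_ipC sh Lh Lg).
suff -> : ip g h = 0 by rewrite rmorph0.
apply: (approximable_ip sh (T := in_span bu)) => //.
- by move=> t; exact: (in_spanL sh buL).
- move=> e e0; have [N gN] := hardy_fsum_cvg Hg e0.
  by eexists; last exact: (gN N (leqnn _)); eexists; eexists.
- move=> _ [v [n ->]]; rewrite (sh_ip_suml sh)//; last by move=> i; exact: buL.
  by apply: big1 => i _; rewrite (sh_ipC sh (buL _ _) Lh) h0 rmorph0.
Qed.

Definition constant_term f := coef dot ip bu f 0.
Local Notation ev0 := constant_term.

Lemma dot_constant_term f x : L f -> dot (ev0 f) x = ip f (k x).
Proof. by move=> Lf; rewrite /constant_term (dot_coef _ sh buP buL). Qed.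

(** For f in H^2 this is (f - f(0)) / z, the adjoint of the shift on H^2. *)
Definition backward_shift f := W (f - k (ev0 f)).
Local Notation Bop := backward_shift.

Lemma hardy_backward_shift f : H2 f -> H2 (Bop f).
Proof.
move=> [Lf f0]; have Lk := bs_kL bs (ev0 f); have Lfk := sh_B sh Lf Lk.
split=> [|n x]; first exact: bs_WL bs _ Lfk.
have kx := bs_kL bs x; rewrite (ipWU Lfk (bwL _ _)) /comonomial /= (bs_UW bs).
case: n => [|n]; rewrite (sh_ipBl sh)//; try exact: bwL.
  by rewrite -dot_constant_term// (bs_kk bs) subrr.
by rewrite [ip f _](f0 n) [ip (k _) _](bu_bw 0) subrr.
Qed.

(** The difference is \bar z g(0), of degree -1. So for g in K_Theta the vector [Bop g] serves as
    S_Theta^* g, with no projection to choose. *)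
Lemma backward_shift_perp g h : L g -> H2 h -> ip (W g - Bop g) h = 0.
Proof.
move=> Lg [Lh h0]; rewrite /backward_shift shiftWB opprB addrC subrK.
have LWk := bs_WL bs (bs_kL bs (ev0 g)).
by rewrite (sh_ipC sh LWk Lh) [ip h _](h0 0%N) rmorph0.
Qed.

End BilateralShift.

Section ModelSpace.
Variables (R : realType) (H : vectType R[i]) (dot : {dot H for Num.conj}).
Variables (V : lmodType R[i]) (L : V -> Prop) (ip : V -> V -> R[i]).
Local Notation Re := (@complex.Re R).
Variables (U W : V -> V) (k : H -> V).

(* [M] and [N] multiply by an inner function Theta and by Theta^*; [im_H2] says that
   the negative Fourier coefficients of Theta vanish. *)
Record inner_multiplier (M N : V -> V) : Prop := {
  im_MP : forall a f g, M (a *: f + g) = a *: M f + M g;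
  im_ML : forall f, L f -> L (M f);
  im_NL : forall f, L f -> L (N f);
  im_ip : forall f g, L f -> L g -> ip (M f) g = ip f (N g);
  im_isoM : forall f g, L f -> L g -> ip (M f) (M g) = ip f g;
  im_isoN : forall f g, L f -> L g -> ip (N f) (N g) = ip f g;
  im_MU : forall f, M (U f) = U (M f);
  im_H2 : forall n x y, ip (M (k x)) (comonomial W k n y) = 0 }.

Hypothesis sh : semi_hilbert L ip.
Hypothesis bs : bilateral_shift dot L ip U W k.
Local Notation n2 := (sqnorm ip).
Local Notation bu := (monomial U k).
Local Notation H2 := (hardy L ip W k).
Local Notation ev0 := (constant_term dot ip U k).
Local Notation Bop := (backward_shift dot ip U W k).
Variables M N : V -> V.
Hypothesis im : inner_multiplier M N.

Let UL f : L f -> L (U f). Proof. exact: bs_UL bs _. Qed.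
Let WL f : L f -> L (W f). Proof. exact: bs_WL bs _. Qed.
Let kL x : L (k x). Proof. exact: bs_kL bs _. Qed.
Let ML f : L f -> L (M f). Proof. exact: im_ML im _. Qed.
Let NL f : L f -> L (N f). Proof. exact: im_NL im _. Qed.
Let H2L f : H2 f -> L f. Proof. by case. Qed.
Let bwL := bwL bs.
Let buL := buL bs.
Local Hint Resolve kL buL bwL : core.

Lemma innerM0 : M 0 = 0.
Proof.
by have := im_MP im 1 0 0; rewrite !scale1r !addr0 => /(canLR (addrK _)); rewrite subrr.
Qed.

Lemma innerMB f g : M (f - g) = M f - M g.
Proof. by rewrite [f - g]addrC -(scaleN1r g) (im_MP im) scaleN1r addrC. Qed.

Lemma innerM_iterU n f : M (iter n U f) = iter n U (M f).
Proof. by elim: n => //= n <-; rewrite (im_MU im). Qed.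

(** [im_H2] speaks of Theta applied to constants. By duality it makes Theta^* (\bar z^(n+1) y)
    orthogonal to every monomial, hence to H^2 by [anti_hardy], so that no limit has to be taken
    inside [M]. *)
Lemma innerM_H2 g : H2 g -> H2 (M g).
Proof.
move=> Hg; have Lg := H2L Hg; split=> [|n y]; first exact: ML.
have LN := NL (bwL n y).
rewrite (im_ip im) // (sh_ipC sh) // (anti_hardy sh bs LN) ?rmorph0// => m x.
rewrite (sh_ipC sh)// -(im_ip im)//.
rewrite innerM_iterU (ip_iterU bs)//; last exact: ML.
by rewrite /comonomial -iterD addnS [ip _ _](im_H2 im) rmorph0.
Qed.

Definition model f := H2 f /\ forall g, H2 g -> ip f (M g) = 0.
Local Notation K := model.

Lemma model_L f : K f -> L f. Proof. by case=> /H2L. Qed.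
Lemma model_hardy f : K f -> H2 f. Proof. by case. Qed.

Lemma modelP a f g : K f -> K g -> K (a *: f + g).
Proof.
move=> [Hf fK] [Hg gK]; split=> [|h Hh]; first exact: (hardyP sh bs).
have Lf := H2L Hf; have Lg := H2L Hg; have LM := ML (H2L Hh).
by rewrite (sh_ipP sh)// fK// gK// mulr0 addr0.
Qed.

Lemma model0 : K 0.
Proof.
have L0 := sh_0 sh; split=> [|g /H2L/ML Lg]; last by rewrite (sh_ip0l sh).
by split=> // n x; rewrite (sh_ip0l sh).
Qed.

Lemma modelB f g : K f -> K g -> K (f - g).
Proof. by move=> Kf Kg; rewrite addrC -scaleN1r; exact: modelP. Qed.

Lemma model_perp f p : K f -> H2 p -> ip (M p) f = 0.
Proof.
move=> Kf Hp; have Lf := model_L Kf; have LM := ML (H2L Hp).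
by rewrite (sh_ipC sh)// Kf.2// rmorph0.
Qed.

(** The hypothesis says weakly that p = P_{H^2} Theta^* h; then h - Theta p is the orthogonal
    projection of h onto K_Theta. It is met by a constant p when h = z f with f in K_Theta, and by a
    polynomial p when h is a monomial. *)
Lemma model_sub h p : H2 h -> H2 p -> (forall g, H2 g -> ip h (M g) = ip p g) -> K (h - M p).
Proof.
move=> Hh Hp hp; split=> [|g Hg]; first exact/(hardyB sh bs)/innerM_H2.
have Lg := H2L Hg; have Lh := H2L Hh; have Lp := H2L Hp.
rewrite (sh_ipBl sh)//; [|exact: ML..].
by rewrite hp// (im_isoM im)// subrr.
Qed.

Lemma H2_split g : H2 g -> g = k (ev0 g) + U (Bop g).
Proof. by move=> _; rewrite /backward_shift (bs_UW bs) addrC subrK. Qed.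

Lemma k_U_H2 x g : H2 g -> ip (k x) (U g) = 0.
Proof.
move=> Hg; have Lg := H2L Hg; have LU := UL Lg.
rewrite (sh_ipC sh)// (ipUW bs)//.
by have := Hg.2 0%N x; rewrite /comonomial /= => ->; rewrite rmorph0.
Qed.

(* [compression f] is S_Theta f = z f - Theta c with c = [defect_vector f], and
   [defect_map x] is \bar z (Theta - Theta(0)) x. *)
Definition defect_vector f : H := riesz dot (fun x => Num.conj (ip (U f) (M (k x)))).
Local Notation cvec := defect_vector.

Lemma dot_defect_vector f x : L f -> dot (cvec f) x = ip (U f) (M (k x)).
Proof.
move=> Lf; rewrite (dotC dot) dot_riesz ?conjCK// => a u v.
have LU := UL Lf; have LM u := ML (kL u).
rewrite (bs_kP bs) (im_MP im) (sh_ipDr sh)//; last exact: (sh_Z sh).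
by rewrite (sh_ipZr sh)// rmorphD rmorphM /= conjCK.
Qed.

Definition compression f := U f - M (k (cvec f)).
Local Notation Sop := compression.

(** The analytic part of Theta^* (z f) is the constant c(f): for g = g(0) + z g1 in H^2 the second
    term contributes <z f, z Theta g1> = <f, Theta g1> = 0. *)
Lemma model_compression f : K f -> K (Sop f).
Proof.
move=> Kf; have Lf := model_L Kf; have LUf := UL Lf.
apply: model_sub; [exact/(hardy_U bs)/(model_hardy Kf)|exact: (hardy_k bs)|move=> g Hg].
have HB := hardy_backward_shift sh bs Hg; have LB := H2L HB; have LUB := UL LB.
have LkM x := ML (kL x); have LMU := ML LUB.
rewrite (H2_split Hg) -[k (ev0 g) in LHS]scale1r (im_MP im) scale1r.
rewrite (sh_ipDr sh)// (sh_ipDr sh)// k_U_H2// (im_MU im) (bs_ipU bs)//; last exact: ML.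
by rewrite Kf.2// -dot_defect_vector// (bs_kk bs).
Qed.

Lemma compression_perp f h : K f -> K h -> ip (U f - Sop f) h = 0.
Proof.
by move=> Kf Kh; rewrite /compression opprB addrC subrK; apply: model_perp => //; exact: (hardy_k bs).
Qed.

(** Moving \bar z to the other side leaves z Theta h = Theta (z h), which is orthogonal to g, and
    the subtracted constant is orthogonal to z H^2. *)
Lemma model_backward_shift g : K g -> K (Bop g).
Proof.
move=> [Hg gK]; have Lg := H2L Hg; split=> [|h Hh]; first exact: (hardy_backward_shift sh bs).
have LMh := ML (H2L Hh); have Lk := kL (ev0 g).
rewrite /backward_shift (ipWU bs)//; last exact: (sh_B sh).
rewrite (sh_ipBl sh)//; last exact: UL.
rewrite -(im_MU im) gK ?sub0r; last exact: (hardy_U bs).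
rewrite (im_MU im) k_U_H2 ?oppr0//; exact: innerM_H2.
Qed.

Definition value0 x := ev0 (M (k x)).
Local Notation theta := value0.

Definition defect_map x := Bop (M (k x)).
Local Notation Jop := defect_map.

(** <J x, Theta h> = <Theta x, z Theta h> = <x, z h> = 0, because Theta(0) x is orthogonal to z H^2
    and Theta is isometric. *)
Lemma model_defect_map x : K (Jop x).
Proof.
have HM := innerM_H2 (hardy_k bs x); have LM := H2L HM; have Lk y := kL y.
split=> [|h Hh]; first exact: (hardy_backward_shift sh bs).
have Lh := H2L Hh; have LMh := ML Lh; have LUh := UL Lh.
rewrite /defect_map /backward_shift (ipWU bs)//; last exact: (sh_B sh).
rewrite (sh_ipBl sh)//; last exact: UL.
rewrite k_U_H2 ?subr0; last exact: innerM_H2.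
by rewrite -(im_MU im) (im_isoM im)// k_U_H2.
Qed.

(** J x differs from \bar z Theta x by \bar z Theta(0) x, which is orthogonal to H^2. *)
Lemma ip_defect_map f x : H2 f -> ip f (Jop x) = dot (cvec f) x.
Proof.
move=> Hf; have Lf := H2L Hf; have LUf := UL Lf; have Lk y := kL y; have LM := ML (Lk x).
rewrite /defect_map /backward_shift -(ipUW bs)//; last exact: (sh_B sh).
rewrite (sh_ipBr sh)// dot_defect_vector// [X in _ - X](sh_ipC sh)//.
by rewrite k_U_H2// rmorph0 subr0.
Qed.

Lemma defect_mapP a x y : Jop (a *: x + y) = a *: Jop x + Jop y.
Proof.
have LM u := ML (kL u).
have thetaP : theta (a *: x + y) = a *: theta x + theta y.
  apply: (dot_inj (dot := dot)) => z; rewrite linearPl /= /value0 !(dot_constant_term sh bs)//.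
  by rewrite (bs_kP bs) (im_MP im) (sh_ipP sh).
rewrite /defect_map /backward_shift -!/(theta _) thetaP !(bs_kP bs) (im_MP im).
by rewrite opprD addrACA -scalerBr (bs_WP bs).
Qed.

Lemma constant_term_U f : H2 f -> ev0 (U f) = 0.
Proof.
move=> Hf; have Lf := H2L Hf; have LUf := UL Lf; apply: (dot_inj (dot := dot)) => z.
have Lk := kL z; rewrite (dot_constant_term sh bs)// linear0l (sh_ipC sh)// k_U_H2//.
by rewrite rmorph0.
Qed.

(** Since S f = z f - Theta c with c = c(f), its constant term is - Theta(0) c; hence f - \bar z (S
    f + Theta(0) c) = \bar z (Theta - Theta(0)) c. *)
Lemma defect f : K f -> f - Bop (Sop f) = Jop (cvec f).
Proof.
move=> Kf; have Lf := model_L Kf; have LUf := UL Lf.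
have k0 : k 0 = 0.
  by have := bs_kP bs 1 0 0; rewrite !scale1r !addr0 => /(canLR (addrK _)); rewrite subrr.
have Lc := ML (kL (cvec f)); have LS : L (Sop f) by exact: (sh_B sh).
have ev : ev0 (Sop f) = - theta (cvec f).
  apply: (dot_inj (dot := dot)) => z; have Lz := kL z.
  rewrite linearNl /= (dot_constant_term sh bs)// /compression (sh_ipBl sh)// -!(dot_constant_term sh bs)//.
  by rewrite (constant_term_U (model_hardy Kf)) linear0l sub0r.
have kN x : k (- x) = - k x by rewrite -(scaleN1r x) -[-1 *: x]addr0 (bs_kP bs) k0 addr0 scaleN1r.
rewrite /defect_map /backward_shift ev /compression kN opprK -/(theta _).
rewrite -{1}(bs_WU bs f) -(shiftWB bs); congr W.
by rewrite opprD opprB addrA addrCA subrr addr0.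
Qed.

(** Theta x = Theta(0) x + z J x is an orthogonal decomposition of a vector of norm |x|. Through
    this formula purity will bound J from below. *)
Lemma sqnorm_defect_map x : n2 (Jop x) = Re (dot x x) - Re (dot (theta x) (theta x)).
Proof.
have LM := ML (kL x); have Lk := kL (theta x); have LB := sh_B sh LM Lk.
rewrite /sqnorm /defect_map /backward_shift (ipWW bs)// -/(theta x).
rewrite -/(sqnorm ip _) (sqnormB sh)// -(dot_constant_term sh bs)// -/(theta x).
by rewrite /sqnorm (im_isoM im)// !(bs_kk bs); ring.
Qed.

(** * Density of the bounded vectors in a model space *)

Section Density.
Variable Bd : V -> Prop.
Hypothesis BdP : forall a f g, Bd f -> Bd g -> Bd (a *: f + g).
Hypothesis Bd0 : Bd 0.
Hypothesis BdU : forall f, Bd f -> Bd (U f).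
Hypothesis BdM : forall f, Bd f -> Bd (M f).
Hypothesis Bdk : forall x, Bd (k x).

Let Bd_bu n x : Bd (bu n x).
Proof. by elim: n => [|n] /=; [exact: Bdk|exact: BdU]. Qed.

Let Bd_fsum v n : Bd (fsum bu v n).
Proof. by apply: big_ind => // f g Bf Bg; rewrite -[f]scale1r; exact: BdP. Qed.

(* [N (bu n x)] has no Fourier coefficient of index greater than [n], so its
   analytic part is a polynomial. *)
Lemma model_monomial n x : exists p, [/\ H2 p, Bd p & K (bu n x - M p)].
Proof.
set p := fsum bu (coef dot ip bu (N (bu n x))) n.+1.
have Hp : H2 p := hardy_fsum sh bs _ _.
have Hb : H2 (bu n x).
  by rewrite -[bu n x]/(iter n U (k x)); elim: n {p Hp} => [|n IH] /=;
    [exact: (hardy_k bs)|exact: (hardy_U bs)].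
exists p; split; [exact: Hp|exact: Bd_fsum|apply: model_sub => // g Hg].
have Lg := H2L Hg; have LN := NL (buL n x); have Lp := H2L Hp.
have LMg := ML Lg; have LD := sh_B sh LN Lp.
rewrite (sh_ipC sh)// (im_ip im)// -(sh_ipC sh)//; apply/eqP; rewrite -subr_eq0.
rewrite -(sh_ipBl sh)//; apply/eqP; apply: (anti_hardy sh bs) => // m y.
rewrite (sh_ipBl sh)// (ip_fsum sh buL (bu_bu sh bs)) ltnS.
case: leqP => mn; first by rewrite (dot_coef _ sh (buP bs) buL)// subrr.
rewrite subr0 (sh_ipC sh)// -(im_ip im)// innerM_iterU (ip_iterU bs)//; last exact: ML.
by rewrite -(subnKC mn) addSnnS addnC iterD (iterWK bs) [ip _ _](im_H2 im) rmorph0.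
Qed.

(** A polynomial t close to g is corrected to t - Theta p in K_Theta. The two terms of g - t = (g -
    (t - Theta p)) - Theta p are orthogonal, so the correction does not increase the distance to
    g. *)
Lemma model_dense g e : K g -> 0 < e -> exists h, [/\ K h, Bd h & n2 (g - h) < e].
Proof.
move=> Kg e0; have [n0 h0] := hardy_fsum_cvg sh bs (model_hardy Kg) e0.
have := h0 _ (leqnn _); set v := coef _ _ _ _; set t := fsum _ _ _ => gt.
have Kb n x := cid (model_monomial n x); pose p := \sum_(i < n0) sval (Kb i (v i)).
have Hp : H2 p.
  rewrite /p; apply: big_ind => [|f h Hf Hh|i _].
  - exact: model_hardy model0.
  - by rewrite -[f]scale1r; exact: (hardyP sh bs).
  - by case: (svalP (Kb i (v i))).
have Bp : Bd p.
  rewrite /p; apply: big_ind => [//|f h Hf Hh|i _].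
    by rewrite -[f]scale1r; exact: BdP.
  by case: (svalP (Kb i (v i))).
have Kt : K (t - M p).
  have -> : t - M p = \sum_(i < n0) (bu i (v i) - M (sval (Kb i (v i)))).
    rewrite /t /fsum sumrB; congr (_ - _).
    rewrite /p; elim: (index_enum _) => [|i r IH]; first by rewrite !big_nil innerM0.
    by rewrite !big_cons -[sval _]scale1r (im_MP im) IH !scale1r.
  apply: big_ind => [|f h Hf Hh|i _]; first exact: model0.
    by rewrite -[f]scale1r; exact: modelP.
  by case: (svalP (Kb i (v i))).
exists (t - M p); split => //.
  by rewrite addrC -scaleN1r; apply: BdP; [exact: BdM|exact: Bd_fsum].
apply: le_lt_trans gt; have Kd := modelB Kg Kt.
have LMp := ML (H2L Hp); have Ld := model_L Kd.
have -> : g - t = (g - (t - M p)) - M p by rewrite opprB addrA [RHS]addrAC addrK.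
rewrite (sqnormB sh Ld LMp) Kd.2// mulr0 subr0 lerDl.
exact: (sqnorm_ge0 sh).
Qed.

End Density.

(** [orthogonal_projection] yields only a limit of elements of K_Theta; it lies in K_Theta because
    membership consists of orthogonality relations. *)
Lemma model_projection f : L f -> exists p, K p /\ forall g, K g -> ip (f - p) g = 0.
Proof.
move=> Lf; have [p [Lp pK fpK]] := orthogonal_projection sh model_L model0 modelP Lf.
exists p; split => //; split; first split=> [//|n x].
  by apply: (approximable_ip sh model_L Lp (bwL n x) pK) => t [[_ t0] _]; exact: t0.
move=> g Hg; apply: (approximable_ip sh model_L Lp (ML (H2L Hg)) pK) => t [_ t0].
exact: t0.
Qed.

End ModelSpace.

(** * Orbits of the compressed shift *)

Section ShiftOrbit.
Variables (R : realType) (H : vectType R[i]) (dot : {dot H for Num.conj}).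
Variables (V : lmodType R[i]) (L : V -> Prop) (ip : V -> V -> R[i]).
Local Notation Re := (@complex.Re R).
Variables (U W : V -> V) (k : H -> V).
Hypothesis sh : semi_hilbert L ip.
Hypothesis bs : bilateral_shift dot L ip U W k.
Local Notation n2 := (sqnorm ip).
Local Notation bu := (monomial U k).
Local Notation bw := (comonomial W k).
Variables M N : V -> V.
Hypothesis im : inner_multiplier L ip U W k M N.
Local Notation K := (model L ip W k M).
Local Notation Sop := (compression dot ip U k M).
Local Notation cvec := (defect_vector dot ip U k M).

Let KL f : K f -> L f. Proof. exact: model_L. Qed.

Lemma sqnorm_compression f : K f -> n2 (Sop f) <= n2 f.
Proof.
move=> Kf; have Lf := KL Kf; have KS := model_compression sh bs im Kf; have LS := KL KS.
have LM := im_ML im (bs_kL bs (cvec f)).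
have E : U f = Sop f + M (k (cvec f)) by rewrite subrK.
rewrite -[leRHS]/(Re (ip f f)) -(bs_ipU bs Lf Lf) -/(n2 (U f)) E (sqnormD sh LS LM).
by rewrite KS.2 ?mulr0 ?addr0 ?lerDl ?(sqnorm_ge0 sh)//; exact: (hardy_k bs).
Qed.

Lemma model_orbit n f : K f -> K (iter n Sop f).
Proof. by move=> Kf; elim: n => //= n; exact: (model_compression sh bs im). Qed.

Lemma sqnorm_orbit n f : K f -> n2 (iter n Sop f) <= n2 f.
Proof.
by move=> Kf; elim: n => //= n; apply: le_trans; exact/sqnorm_compression/model_orbit.
Qed.

Lemma iterUD n f g : iter n U (f + g) = iter n U f + iter n U g.
Proof. by rewrite -[f in LHS]scale1r (iterUP bs) scale1r. Qed.

Lemma iterUN n f : iter n U (- f) = - iter n U f.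
Proof.
have U0 : U 0 = 0 by rewrite -[0 in LHS](subrr 0) (shiftUB bs) subrr.
by elim: n => //= n ->; rewrite -[- _]sub0r (shiftUB bs) U0 sub0r.
Qed.

Lemma innerMD f g : M (f + g) = M f + M g.
Proof. by rewrite -[f in LHS]scale1r (im_MP im) scale1r. Qed.

(** Each application of S multiplies by z and subtracts Theta times a constant c. As z^(n+1) \bar
    z^(n+1) c = c, this constant is the contribution of the new term of s. So z^n s is in H^2
    although s has only negative degrees. *)
Lemma orbitE n f : K f -> let s := fsum bw (fun i => cvec (iter i Sop f)) n in
  hardy L ip W k (iter n U s) /\ iter n Sop f = iter n U (f - M s).
Proof.
move=> Kf; elim: n => [|n [IH1 IH2]].
  rewrite /= /fsum big_ord0 (innerM0 im) subr0; split=> //.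
  exact: (model_hardy (model0 sh bs im)).
rewrite /= /fsum big_ord_recr /=; set s := \sum_(i < n) _ in IH1 IH2 *.
set c := cvec _; have Ubw : U (iter n U (bw n c)) = k c by exact: (iterUK bs n.+1).
split.
  rewrite iterUD -[iter n U s]scale1r (bs_UP bs) scale1r Ubw.
  rewrite -[U _]scale1r; apply: (hardyP sh bs); last exact: (hardy_k bs).
  exact: (hardy_U bs).
rewrite innerMD opprD addrA -[in RHS]/(iter n.+1 U _) iterUD iterUN -(innerM_iterU im).
by rewrite [iter n.+1 U (bw n c)]Ubw [iter n.+1 _ _]/= -IH2.
Qed.

(** By [orbitE], S^n f and z^n f differ by an element of Theta H^2. *)
Lemma ip_orbit n f h : K f -> K h -> ip h (iter n Sop f) = ip h (iter n U f).
Proof.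
move=> Kf Kh; have Lf := KL Kf; have Lh := KL Kh; have [Hs ->] := orbitE n Kf.
set s := fsum _ _ _ in Hs *; have Ls : L s := fsumL sh (bwL bs) _ _.
have Lb : L (iter n U f) := iterUL bs n Lf.
rewrite iterUD iterUN -(innerM_iterU im) (sh_ipBr sh)//; last exact/(im_ML im)/(iterUL bs).
by rewrite Kh.2// subr0.
Qed.

(** <c(S^n f), x> = <S^n f, J x> = <z^n f, J x> = <z^(n+1) f, Theta x> = <Theta^* f, \bar z^(n+1)
    x>. *)
Lemma defect_vector_orbit n f : K f -> cvec (iter n Sop f) = coef dot ip bw (N f) n.
Proof.
move=> Kf; have Lf := KL Kf; have LN := im_NL im Lf.
apply: (dot_inj (dot := dot)) => x; rewrite (dot_coef _ sh (bwP bs) (bwL bs))//.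
have KS := model_orbit n Kf; have LS := KL KS.
have KJ := model_defect_map sh bs im x; have LJ := KL KJ.
have HU : hardy L ip W k (iter n U f).
  by elim: n {KS LS} => [|n IH] /=; [exact: model_hardy Kf|exact: (hardy_U bs)].
have LU : L (iter n U f) := iterUL bs n Lf.
rewrite -(ip_defect_map sh bs im)//; last exact: model_hardy KS.
rewrite (sh_ipC sh)// ip_orbit// -(sh_ipC sh)// (ip_defect_map sh bs im)//.
have Lk := bs_kL bs x; have LMk := im_ML im Lk.
rewrite (dot_defect_vector sh bs im)// -[U _]/(iter n.+1 U f) (ip_iterU bs)//.
rewrite -(iterUK bs n.+1 (k x)) (innerM_iterU im) (iterWK bs).
rewrite (sh_ipC sh)//; last exact/(im_ML im)/(bwL bs).
by rewrite (im_ip im)// -?(sh_ipC sh)//; exact: (bwL bs).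
Qed.

(** Take norms in S^n f = z^n (f - Theta s). Thus a single limit shows both that S^n f tends to 0
    and that the sums s converge to Theta^* f. *)
Lemma sqnorm_orbitE n f : K f ->
  n2 (iter n Sop f) = n2 (N f - fsum bw (fun i => cvec (iter i Sop f)) n).
Proof.
move=> Kf; have Lf := KL Kf; have LN := im_NL im Lf; have [_ ->] := orbitE n Kf.
set s := fsum _ _ _; have Ls : L s := fsumL sh (bwL bs) _ _.
have LM := im_ML im Ls; have Lfs := sh_B sh Lf LM.
rewrite /sqnorm (ip_iterU bs)// ?(iterWK bs); last exact: (iterUL bs).
rewrite -!/(n2 _) (sqnormB sh)// (sqnormB sh)//.
rewrite (sh_ipC sh)// (im_ip im)// -(sh_ipC sh)//.
by rewrite /sqnorm (im_isoM im)// (im_isoN im).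
Qed.

(** As f is orthogonal to Theta H^2, Theta^* f has only negative degrees, and the c(S^n f) are its
    coefficients. *)
Lemma orbit_cvg f : K f -> forall e : R, 0 < e -> exists n0, forall n, (n0 <= n)%N ->
  n2 (N f - fsum bw (fun i => cvec (iter i Sop f)) n) < e.
Proof.
move=> Kf; have Lf := KL Kf; have LN := im_NL im Lf.
have -> : (fun i => cvec (iter i Sop f)) = coef dot ip bw (N f).
  by apply/funext => n; exact: defect_vector_orbit.
apply: (anti_fsum_cvg sh bs LN) => n x; have Lb := buL bs n x; have LMb := im_ML im Lb.
rewrite (sh_ipC sh)// -(im_ip im)// -(sh_ipC sh)// Kf.2//.
rewrite -[bu n x]/(iter n U (k x)); elim: n {Lb LMb} => [|n IH] /=;
  [exact: (hardy_k bs)|exact: (hardy_U bs)].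
Qed.

End ShiftOrbit.

(** * The defect identity of a truncated Toeplitz operator *)

Section TruncatedToeplitz.
Variables (R : realType) (H : vectType R[i]) (dot : {dot H for Num.conj}).
Variables (V : lmodType R[i]) (L : V -> Prop) (ip : V -> V -> R[i]).
Variables (U W : V -> V) (k : H -> V).
Hypothesis sh : semi_hilbert L ip.
Hypothesis bs : bilateral_shift dot L ip U W k.
Local Notation n2 := (sqnorm ip).
Local Notation onb := (onb dot).
Local Notation bw := (comonomial W k).
Local Notation Bop := (backward_shift dot ip U W k).
Variables M1 N1 M2 N2 : V -> V.
Hypothesis im1 : inner_multiplier L ip U W k M1 N1.
Hypothesis im2 : inner_multiplier L ip U W k M2 N2.
Local Notation K1 := (model L ip W k M1).
Local Notation K2 := (model L ip W k M2).
Local Notation S1 := (compression dot ip U k M1).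
Local Notation S2 := (compression dot ip U k M2).
Local Notation c1 := (defect_vector dot ip U k M1).
Local Notation c2 := (defect_vector dot ip U k M2).
Local Notation J1 := (defect_map dot ip U W k M1).

(** [A] acts on representatives, so additivity can only be asked up to a null vector. *)
Record bounded_on (K K' : V -> Prop) (A : V -> V) : Prop := {
  bo_K : forall f, K f -> K' (A f);
  bo_B : forall f g, K f -> K g -> n2 (A (f - g) - (A f - A g)) = 0;
  bo_bd : exists2 C : R, 0 <= C & forall f, K f -> n2 (A f) <= C * n2 f }.

Variable A : V -> V.
Hypothesis bA : bounded_on K1 K2 A.

Variable Bd : V -> Prop.
Hypothesis BdP : forall a f g, Bd f -> Bd g -> Bd (a *: f + g).
Hypothesis Bd0 : Bd 0.
Hypothesis BdU : forall f, Bd f -> Bd (U f).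
Hypothesis BdM1 : forall f, Bd f -> Bd (M1 f).
Hypothesis Bdk : forall x, Bd (k x).

Let K1L f : K1 f -> L f. Proof. exact: model_L. Qed.
Let K2L f : K2 f -> L f. Proof. exact: model_L. Qed.
Let A_K f : K1 f -> K2 (A f). Proof. exact: bo_K bA _. Qed.

Lemma linear_expansion (E : H -> V) x : (forall a u v, E (a *: u + v) = a *: E u + E v) ->
  E x = \sum_(e <- onb) dot x e *: E e.
Proof.
move=> EP; have E0 : E 0 = 0.
  by have := EP 1 0 0; rewrite !scale1r !addr0 => /(canLR (addrK _)); rewrite subrr.
rewrite {1}(onb_expansion dot x); elim: onb => [|e r IH]; first by rewrite !big_nil E0.
by rewrite !big_cons EP IH.
Qed.

Definition bounded_functional (Lam : V -> R[i]) :=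
  (forall f g, K1 f -> K1 g -> Lam (f - g) = Lam f - Lam g) /\
  exists C : R, forall f, K1 f -> sqmod (Lam f) <= C * n2 f.

Lemma bounded_functionalB Lam Lam' : bounded_functional Lam -> bounded_functional Lam' ->
  bounded_functional (fun f => Lam f - Lam' f).
Proof.
move=> [LB [C LC]] [LB' [C' LC']]; split=> [f g Kf Kg|].
  by rewrite LB// LB'//; ring.
exists (2 * C + 2 * C') => f Kf; apply: le_trans (sqmodD _ _) _.
have -> : sqmod (- Lam' f) = sqmod (Lam' f).
  by case: (Lam' f) => a b; rewrite /sqmod /= !sqrrN.
by have := LC f Kf; have := LC' f Kf; lra.
Qed.

Lemma bounded_functional_ip G : L G -> bounded_functional (fun f => ip f G).
Proof.
move=> LG; split=> [f g /K1L Lf /K1L Lg|]; first by rewrite (sh_ipBl sh).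
by exists (n2 G) => f /K1L Lf; rewrite mulrC; exact: (sh_CauchySchwarz sh).
Qed.

Lemma bounded_functional_A g : L g -> bounded_functional (fun f => ip (A f) g).
Proof.
move=> Lg; have [C C0 AC] := bo_bd bA.
split=> [f h Kf Kh|].
  have Lf := K2L (A_K Kf); have Lh := K2L (A_K Kh).
  rewrite -(sh_ipBl sh)//; apply: (sqnorm0_subl sh) => //.
  - exact/K2L/A_K/(modelB sh bs im1).
  - exact: (sh_B sh).
  - exact: bo_B bA _ _ Kf Kh.
exists (C * n2 g) => f Kf; have Lf := K2L (A_K Kf).
apply: le_trans (sh_CauchySchwarz sh Lf Lg) _.
by rewrite mulrAC ler_wpM2r ?(sqnorm_ge0 sh)//; exact: AC.
Qed.

Lemma compressionB f g : K1 f -> K1 g -> S1 (f - g) = S1 f - S1 g.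
Proof.
move=> /K1L Lf /K1L Lg; have Lfg := sh_B sh Lf Lg.
have c1B : c1 (f - g) = c1 f - c1 g.
  apply: (dot_inj (dot := dot)) => z; rewrite linearBl /= !(dot_defect_vector sh bs im1)//.
  rewrite (shiftUB bs) (sh_ipBl sh)//; try exact: bs_UL bs _ _.
  exact/(im_ML im1)/(bs_kL bs).
rewrite /compression (shiftUB bs) c1B (shift_kB bs) (innerMB im1).
by rewrite !opprD !opprK addrACA.
Qed.

Lemma bounded_functional_AS g : L g -> bounded_functional (fun f => ip (A (S1 f)) g).
Proof.
move=> Lg; have [AB [C AC]] := bounded_functional_A Lg; split=> [f h Kf Kh|].
  by rewrite compressionB// AB//; exact: (model_compression sh bs im1).
exists (`|C|) => f Kf; have KS := model_compression sh bs im1 Kf.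
apply: le_trans (AC _ KS) _; apply: (@le_trans _ _ (`|C| * n2 (S1 f))).
  by rewrite ler_wpM2r ?ler_norm// (sqnorm_ge0 sh)//; exact: K1L.
by rewrite ler_wpM2l// (sqnorm_compression sh bs im1).
Qed.

(** This extends an identity from the bounded vectors, to which the symbol may be applied, to all of
    K_{Theta_1}. The constant of a bounded functional carries no sign, hence the absolute value. *)
Lemma bounded_functional_eq0 Lam : bounded_functional Lam ->
  (forall f, K1 f -> Bd f -> Lam f = 0) -> forall f, K1 f -> Lam f = 0.
Proof.
move=> [LB [C LC]] L0 f Kf; apply: sqmod_eq0; apply/eqP.
rewrite eq_le sqmod_ge0 andbT; apply: (@le0_of_small _ _ `|C|) => e e0.
have [h [Kh Bh fh]] := model_dense sh bs im1 BdP Bd0 BdU BdM1 Bdk Kf e0.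
have -> : Lam f = Lam (f - h) by rewrite LB// (L0 h)// subr0.
have Kfh := modelB sh bs im1 Kf Kh; apply: le_trans (LC _ Kfh) _.
have n0 := sqnorm_ge0 sh (K1L Kfh).
apply: (@le_trans _ _ (`|C| * n2 (f - h))); first by rewrite ler_wpM2r ?ler_norm.
by rewrite mulrC ler_wpM2r// ltW.
Qed.

Definition defect_identity (E1 E2 : H -> V) := forall f g, K1 f -> K2 g ->
  ip (A f) g - ip (A (S1 f)) (S2 g) = ip (E1 (c1 f)) g + ip f (E2 (c2 g)).

Lemma ip_linear_l (E : H -> V) x g : (forall y, L (E y)) -> L g ->
  (forall a u v, E (a *: u + v) = a *: E u + E v) ->
  ip (E x) g = \sum_(e <- onb) dot x e * ip (E e) g.
Proof.
move=> LE Lg EP; rewrite (linear_expansion x EP) (sh_ip_suml sh)//; last first.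
  by move=> e; exact: (sh_Z sh).
by apply: eq_bigr => e _; rewrite (sh_ipZl sh).
Qed.

Section SymbolToDefect.
Variables (F : V -> V) (Psi : H -> V).
Hypothesis FP : forall a f g, F (a *: f + g) = a *: F f + F g.
Hypothesis FU : forall f, F (U f) = U (F f).
Hypothesis FL : forall f, L f -> Bd f -> L (F f).
Hypothesis PsiL : forall x, L (Psi x).
Hypothesis FPsi : forall f y, L f -> Bd f -> ip (F f) (M2 (k y)) = ip f (Psi y).
Hypothesis AF : forall f g, K1 f -> Bd f -> K2 g -> ip (A f) g = ip (F f) g.

(** [F] is multiplication by Phi and [Psi y] is Phi^* Theta_2 y. For fixed g, the difference of the
    two sides of the defect identity is a bounded functional of f, so that bounded f suffice. *)
Lemma defect_of_symbol : exists E1 E2 : H -> V,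
  [/\ forall x, K2 (E1 x), forall x, K1 (E2 x),
      forall a x y, E1 (a *: x + y) = a *: E1 x + E1 y,
      forall a x y, E2 (a *: x + y) = a *: E2 x + E2 y
    & defect_identity E1 E2].
Proof.
have UL f : L f -> L (U f) by exact: bs_UL bs _.
have WL f : L f -> L (W f) by exact: bs_WL bs _.
have kL x : L (k x) by exact: bs_kL bs _.
have M1k x : L (M1 (k x)) by apply: im_ML im1 _ _.
have M2k x : L (M2 (k x)) by apply: im_ML im2 _ _.
have LF x : L (F (M1 (k x))) by apply: FL => //; exact: BdM1.
have [p1 p1P] := choice (fun x => model_projection sh bs im2 (LF x)).
have [p2 p2P] := choice (fun x => model_projection sh bs im1 (WL _ (PsiL x))).
(* The projections [p1] and [p2] are chosen vector by vector and are linear only up to null vectors;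
   keeping their values on an orthonormal basis makes [E1] and [E2] exactly linear. *)
pose E1 x := \sum_(e <- onb) dot x e *: Bop (p1 e).
pose E2 x := \sum_(e <- onb) dot x e *: p2 e.
have KE1 x : K2 (E1 x).
  rewrite /E1; elim: onb => [|e r IH]; first by rewrite big_nil; exact: (model0 sh bs im2).
  by rewrite big_cons; apply: (modelP sh bs im2) => //; apply: (model_backward_shift sh bs im2); case: (p1P e).
have KE2 x : K1 (E2 x).
  rewrite /E2; elim: onb => [|e r IH]; first by rewrite big_nil; exact: (model0 sh bs im1).
  by rewrite big_cons; apply: (modelP sh bs im1) => //; case: (p2P e).
have lin (G : H -> V) a x y : \sum_(e <- onb) dot (a *: x + y) e *: G e =
    a *: (\sum_(e <- onb) dot x e *: G e) + \sum_(e <- onb) dot y e *: G e.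
  by rewrite scaler_sumr -big_split; apply: eq_bigr => e _; rewrite linearPl /= scalerDl scalerA.
exists E1, E2; split=> [//|//|a x y|a x y|]; [exact: lin|exact: lin|].
have FM1P a u v : F (M1 (k (a *: u + v))) = a *: F (M1 (k u)) + F (M1 (k v)).
  by rewrite (bs_kP bs) (im_MP im1) FP.
(* In effect E_1 x = S_2^* P_2 (Phi Theta_1 x): the backward shift realises S_2^*, and the
   projection disappears against S_2 g, which lies in K_{Theta_2}. *)
have ipE1 x g : K2 g -> ip (E1 x) g = ip (F (M1 (k x))) (S2 g).
  move=> Kg; have Lg := K2L Kg; have KS := model_compression sh bs im2 Kg; have LS := K2L KS.
  have Lp e : L (p1 e) by apply: K2L; case: (p1P e).
  have LB e : L (Bop (p1 e)) by apply: K2L; apply: (model_backward_shift sh bs im2); case: (p1P e).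
  rewrite (ip_linear_l (E := fun u => F (M1 (k u))) x LF LS FM1P) (sh_ip_suml sh)//; last by move=> e; exact: (sh_Z sh).
  apply: eq_bigr => e _; rewrite (sh_ipZl sh)//; congr (_ * _).
  have -> : ip (Bop (p1 e)) g = ip (W (p1 e)) g.
    apply/eqP; rewrite eq_sym -subr_eq0 -(sh_ipBl sh)//; last exact: WL.
    by rewrite (backward_shift_perp sh bs)//; exact: model_hardy Kg.
  rewrite (ipWU bs)//; have -> : ip (p1 e) (U g) = ip (p1 e) (S2 g).
    apply/eqP; rewrite -subr_eq0 -(sh_ipBr sh)//; last exact: UL.
    rewrite (sh_ipC sh)//; last by apply: (sh_B sh) => //; exact: UL.
    by rewrite (compression_perp sh bs im2)// ?rmorph0//; case: (p1P e).
  apply/eqP; rewrite eq_sym -subr_eq0 -(sh_ipBl sh)//.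
  by apply/eqP; case: (p1P e) => _; apply.
have ipE2 f y : K1 f -> Bd f -> ip f (E2 y) = ip (U (F f)) (M2 (k y)).
  move=> Kf Bf; have Lf := K1L Kf; have Lp e : L (p2 e) by apply: K1L; case: (p2P e).
  have LFf := FL Lf Bf; have LUF := UL _ LFf.
  have MkP a u v : M2 (k (a *: u + v)) = a *: M2 (k u) + M2 (k v).
    by rewrite (bs_kP bs) (im_MP im2).
  rewrite (linear_expansion (E := fun u => M2 (k u)) y MkP) !(sh_ip_sumr sh)//; try by move=> e; exact: (sh_Z sh).
  apply: eq_bigr => e _; rewrite !(sh_ipZr sh)//; congr (_ * _).
  rewrite -FU FPsi//; [|exact: UL|exact: BdU].
  rewrite (ipUW bs)//; have LWP := WL _ (PsiL e); have LD := sh_B sh LWP (Lp e).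
  apply/eqP; rewrite eq_sym -subr_eq0 -(sh_ipBr sh)//.
  rewrite (sh_ipC sh)//; case: (p2P e) => _ /(_ f Kf) ->.
  by rewrite rmorph0.
move=> f g Kf Kg; apply/eqP; rewrite -subr_eq0 opprD addrA; apply/eqP; move: f Kf.
have Lg := K2L Kg; have KS := model_compression sh bs im2 Kg; have LS := K2L KS.
have LE1 x := K2L (KE1 x).
(* G is J_1 E_1^* g: since c_1 = J_1^*, it turns f |-> <E_1 c_1(f), g> into the functional <f, G>,
   which is visibly bounded. *)
pose G := \sum_(e <- onb) Num.conj (ip (E1 e) g) *: J1 e.
have LG : L G.
  by apply: (sh_sum sh) => e; apply: (sh_Z sh); exact/K1L/(model_defect_map sh bs im1).
have GE f : K1 f -> ip (E1 (c1 f)) g = ip f G.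
  move=> Kf; have Lf := K1L Kf; rewrite (ip_linear_l (E := E1) _ LE1 Lg (lin _)).
  have LJ e : L (J1 e) by exact/K1L/(model_defect_map sh bs im1).
  rewrite (sh_ip_sumr sh)//; last by move=> e; exact: (sh_Z sh).
  apply: eq_bigr => e _; rewrite (sh_ipZr sh)// conjCK mulrC (ip_defect_map sh bs im1)//.
  exact: model_hardy Kf.
suff main : forall f, K1 f ->
    ip (A f) g - ip (A (S1 f)) (S2 g) - ip f G - ip f (E2 (c2 g)) = 0.
  by move=> f Kf; rewrite GE// main.
apply: bounded_functional_eq0.
  apply: bounded_functionalB; last exact/bounded_functional_ip/K1L/KE2.
  apply: bounded_functionalB; last exact: bounded_functional_ip.
  apply: bounded_functionalB; [exact: bounded_functional_A|exact: bounded_functional_AS].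
move=> f Kf Bf; have Lf := K1L Kf; have LFf := FL Lf Bf; have LUF := UL _ LFf.
(* S_1 f is again bounded, being z f minus Theta_1 times a constant, so [AF] applies to it as
   well. *)
have BS : Bd (S1 f).
  by rewrite /compression addrC -scaleN1r; apply: BdP; [exact: BdM1|exact: BdU].
rewrite AF// AF//; [|exact: (model_compression sh bs im1)].
rewrite -GE// ipE1// ipE2//.
have -> : F (S1 f) = U (F f) - F (M1 (k (c1 f))).
  by rewrite /compression addrC -scaleN1r FP FU scaleN1r addrC.
rewrite (sh_ipBl sh)//.
have -> : ip (U (F f)) (S2 g) = ip (F f) g - ip (U (F f)) (M2 (k (c2 g))).
  by rewrite /compression (sh_ipBr sh)//; [rewrite (bs_ipU bs)|exact: UL].
by ring.
Qed.

End SymbolToDefect.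

Section DefectToSymbol.
Hypothesis BdM2 : forall f, Bd f -> Bd (M2 f).
Variables (E1 E2 : H -> V) (T1 T2 : V -> V).
Hypothesis LE1 : forall x, L (E1 x).
Hypothesis LE2 : forall x, L (E2 x).
Hypothesis E12 : defect_identity E1 E2.
Hypothesis T1L : forall g, L g -> Bd g -> L (T1 g).
Hypothesis T2L : forall g, L g -> Bd g -> L (T2 g).
(** [T1] and [T2] will be the pointwise adjoints E_i(t)^*, known here only through their values
    against \bar z^n x. *)
Hypothesis T1E : forall n x g, L g -> Bd g ->
  ip (iter n W (E1 x)) g = ip (iter n W (k x)) (T1 g).
Hypothesis T2E : forall n x g, L g -> Bd g ->
  ip (iter n W (E2 x)) g = ip (iter n W (k x)) (T2 g).

(* Summing the defect identity along the orbits of [f] and [g] telescopes, and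
   the orbits tend to [0]. *)
Lemma symbol_of_defect f g : K1 f -> Bd f -> K2 g -> Bd g ->
  (forall x, K2 (E1 x)) -> (forall x, K1 (E2 x)) ->
  ip (A f) g = ip (U (N1 f)) (T1 g) + Num.conj (ip (U (N2 g)) (T2 f)).
Proof.
move=> Kf Bf Kg Bg KE1 KE2.
have Lf := K1L Kf; have Lg := K2L Kg; have LT1 := T1L Lg Bg; have LT2 := T2L Lf Bf.
have LUN1 := bs_UL bs (im_NL im1 Lf); have LUN2 := bs_UL bs (im_NL im2 Lg).
have bwL := bwL bs; have UL := @bs_UL _ _ _ _ _ _ _ _ _ bs.
pose s1 n := fsum bw (fun i => c1 (iter i S1 f)) n.
pose s2 n := fsum bw (fun i => c2 (iter i S2 g)) n.
have Ls1 n : L (s1 n) by exact: (fsumL sh).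
have Ls2 n : L (s2 n) by exact: (fsumL sh).
have UbwS n x : U (bw n x) = iter n W (k x) by rewrite /comonomial iterS (bs_UW bs).
have UD u v : U (u + v) = U u + U v by rewrite -[u in LHS]scale1r (bs_UP bs) scale1r.
have tele n : ip (A f) g = ip (A (iter n S1 f)) (iter n S2 g) +
    (ip (U (s1 n)) (T1 g) + Num.conj (ip (U (s2 n)) (T2 f))).
  elim: n => [|n IH].
    have U0 : U 0 = 0 by rewrite -[0 in LHS](subrr 0) (shiftUB bs) subrr.
    rewrite /s1 /s2 /fsum !big_ord0 U0 !(sh_ip0l sh)//.
    by rewrite rmorph0 !addr0.
  have KS1 := model_orbit sh bs im1 n Kf; have KS2 := model_orbit sh bs im2 n Kg.
  have := E12 KS1 KS2 => /eqP; rewrite subr_eq => /eqP E.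
  rewrite IH E /s1 /s2 /fsum !big_ord_recr /= -!/(fsum _ _ _) -/(s1 n) -/(s2 n).
  rewrite !UD !(sh_ipDl sh)//; try solve [exact/UL/bwL|exact: UL (Ls1 n)|exact: UL (Ls2 n)].
  set d1 := c1 _; set d2 := c2 _.
  (* [E1 d1] lies in K_{Theta_2}, so S_2^n g may be replaced by z^n g; the factor z^n then moves to
     the left, where [T1E] applies. The next term is the same with the roles exchanged. *)
  have -> : ip (E1 d1) (iter n S2 g) = ip (U (bw n d1)) (T1 g).
    by rewrite (ip_orbit sh bs im2)// -(ip_iterW bs)// T1E// UbwS.
  have -> : ip (iter n S1 f) (E2 d2) = Num.conj (ip (U (bw n d2)) (T2 f)).
    rewrite (sh_ipC sh)//; last exact: K1L KS1.
    by rewrite (ip_orbit sh bs im1)// -(ip_iterW bs)// T2E// UbwS.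
  by rewrite rmorphD /=; ring.
apply/eqP; rewrite -subr_eq0; apply/eqP; apply: sqmod_eq0; apply/eqP.
rewrite eq_le sqmod_ge0 andbT.
have [C C0 AC] := bo_bd bA.
apply: (@le0_of_small _ _ (2 * (C * n2 g) + 2 * (2 * n2 (T1 g) + 2 * n2 (T2 f)))) => e e0.
have [n1 h1] := orbit_cvg sh bs im1 Kf e0.
have [n2' h2] := orbit_cvg sh bs im2 Kg e0.
have {}h1 := h1 _ (leq_maxl n1 n2'); have {}h2 := h2 _ (leq_maxr n1 n2').
set n := maxn n1 n2' in h1 h2; rewrite (tele n).
have LN1 := im_NL im1 Lf; have LN2 := im_NL im2 Lg.
have LD1 := sh_B sh LN1 (Ls1 n); have LD2 := sh_B sh LN2 (Ls2 n).
have KS1 := model_orbit sh bs im1 n Kf; have KS2 := model_orbit sh bs im2 n Kg.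
(* After [tele] there remain the orbit term and the tails of the series for Theta_1^* f and
   Theta_2^* g. *)
have -> : ip (A (iter n S1 f)) (iter n S2 g) +
    (ip (U (s1 n)) (T1 g) + Num.conj (ip (U (s2 n)) (T2 f))) -
    (ip (U (N1 f)) (T1 g) + Num.conj (ip (U (N2 g)) (T2 f))) =
  ip (A (iter n S1 f)) (iter n S2 g) +
    (ip (- U (N1 f - s1 n)) (T1 g) + Num.conj (ip (- U (N2 g - s2 n)) (T2 f))).
  rewrite !(sh_ipNl sh) ?(shiftUB bs)//; try exact: UL.
  - rewrite !(sh_ipBl sh)//; try exact: UL.
    by rewrite opprB opprB rmorphB /=; ring.
  - by apply: (sh_B sh) => //; exact: UL.
  - by apply: (sh_B sh) => //; exact: UL.
have CS a b : L a -> L b -> n2 a <= e -> sqmod (ip (- U a) b) <= e * n2 b.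
  move=> La Lb ae; have LU := UL _ La; apply: le_trans (sh_CauchySchwarz sh (sh_N sh LU) Lb) _.
  rewrite ler_wpM2r ?(sqnorm_ge0 sh)// (sqnormN sh)//.
  by rewrite /sqnorm (bs_ipU bs).
have b1 := CS _ _ LD1 LT1 (ltW h1); have b2 := CS _ _ LD2 LT2 (ltW h2).
have sqJ z : sqmod (Num.conj z) = sqmod z by case: z => a b; rewrite /sqmod /= sqrrN.
(* One small factor is enough: the squared norm of S_1^n f equals that of a tail, at most e, and the
   squared norm of S_2^n g is at most [n2 g]. *)
have b3 : sqmod (ip (A (iter n S1 f)) (iter n S2 g)) <= e * (C * n2 g).
  apply: le_trans (sh_CauchySchwarz sh (K2L (A_K KS1)) (K2L KS2)) _.
  have := sqnorm_orbit sh bs im2 n Kg; have := AC _ KS1.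
  have := ltW h1; rewrite /s1 -(sqnorm_orbitE sh bs im1)//.
  have := sqnorm_ge0 sh (K2L (A_K KS1)); have := sqnorm_ge0 sh (K2L KS2).
  have := sqnorm_ge0 sh (K1L KS1); have := sqnorm_ge0 sh Lg.
  move: (n2 g) (n2 (iter n S1 f)) (n2 (iter n S2 g)) (n2 (A _)) => a b c d.
  move=> a0 b0 c0 d0 be dCb ca; apply: (@le_trans _ _ (C * e * a)); last first.
    by rewrite mulrCA mulrA.
  by apply: ler_pM => //; apply: (le_trans dCb); rewrite ler_wpM2l.
apply: le_trans (sqmodD _ _) _; have := sqmodD (ip (- U (N1 f - s1 n)) (T1 g))
  (Num.conj (ip (- U (N2 g - s2 n)) (T2 f))).
rewrite sqJ; move: b1 b2 b3; set x1 := sqmod (ip (- _) _); set x2 := sqmod (ip (- _) _).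
set x3 := sqmod (ip (A _) _); set x4 := sqmod (_ + _).
move: x1 x2 x3 x4 (n2 g) (n2 (T1 g)) (n2 (T2 f)) => x1 x2 x3 x4 a b c.
have -> : e * (2 * (C * a) + 2 * (2 * b + 2 * c)) =
  2 * (e * (C * a)) + 4 * (e * b) + 4 * (e * c) by ring.
by move: (e * (C * a)) (e * b) (e * c) => p q r; lra.
Qed.

End DefectToSymbol.
End TruncatedToeplitz.

(** * Square-integrable functions on the circle *)

Section ComplexIntegral.
Variable R : realType.
Local Notation Re := (@complex.Re R).
Local Notation Im := (@complex.Im R).
Local Notation leb := (@leb R).
Local Notation unitI := (@unitI R).
Implicit Types (f g : R -> R[i]) (c z : R[i]).

Lemma measurable_unitI : measurable (unitI : set (measurableTypeR R)).
Proof. exact: measurable_itv. Qed.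
Local Hint Resolve measurable_unitI : core.

Lemma leb_unitI : leb unitI = 1%E.
Proof. by have := @lebesgue_measure_itv R `[0, 1]; rewrite /= lte_fin ltr01 sube0. Qed.

Lemma integrable_cst_unitI (M : R) : leb.-integrable unitI (EFin \o (fun=> M)).
Proof.
apply/integrableP; split; first exact: measurable_cst.
have -> : (fun t => `|(EFin \o (fun=> M)) t|%E) = cst (`|M|%:E : \bar R) by [].
by rewrite integral_cst// leb_unitI mule1 ltry.
Qed.

Lemma cmeasurable_cst c : cmeasurable (fun=> c).
Proof. by split; exact: measurable_cst. Qed.

Lemma cmeasurableD f g : cmeasurable f -> cmeasurable g ->
  cmeasurable (fun t => f t + g t).
Proof.
move=> [f1 f2] [g1 g2]; split.
  by apply: (eq_measurable_fun ((Re \o f) \+ (Re \o g))) => [t _|];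
    [rewrite /= ReD | exact: measurable_funD].
by apply: (eq_measurable_fun ((Im \o f) \+ (Im \o g))) => [t _|];
  [rewrite /= ImD | exact: measurable_funD].
Qed.

Lemma cmeasurableM f g : cmeasurable f -> cmeasurable g ->
  cmeasurable (fun t => f t * g t).
Proof.
move=> [f1 f2] [g1 g2]; split.
  apply: (eq_measurable_fun (((Re \o f) \* (Re \o g)) \- ((Im \o f) \* (Im \o g)))).
    by move=> t _; rewrite /= ReM.
  by apply: measurable_funB; exact: measurable_funM.
apply: (eq_measurable_fun (((Re \o f) \* (Im \o g)) \+ ((Im \o f) \* (Re \o g)))).
  by move=> t _; rewrite /= ImM.
by apply: measurable_funD; exact: measurable_funM.
Qed.

Lemma cmeasurableJ f : cmeasurable f -> cmeasurable (fun t => Num.conj (f t)).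
Proof.
move=> [f1 f2]; split.
  by apply: (eq_measurable_fun (Re \o f)) => // t _; rewrite /= ReJ.
apply: (eq_measurable_fun (\- (Im \o f))) => [t _|]; first by rewrite /= ImJ.
exact: measurableT_comp.
Qed.

Lemma cmeasurable_sum I (r : seq I) (P : pred I) (F : I -> R -> R[i]) :
  (forall i, P i -> cmeasurable (F i)) -> cmeasurable (fun t => \sum_(i <- r | P i) F i t).
Proof.
move=> mF; elim: r => [|i r IH].
  by rewrite (_ : (fun _ => _) = fun=> 0); [exact: cmeasurable_cst|
    apply/funext => t; rewrite big_nil].
rewrite (_ : (fun _ => _) = fun t => (if P i then F i t else 0) +
  \sum_(j <- r | P j) F j t); last first.
  by apply/funext => t; rewrite big_cons; case: ifP; rewrite ?add0r.
by apply: cmeasurableD => //; case: (boolP (P i)) => [/mF|_] //; exact: cmeasurable_cst.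
Qed.

Definition aeI (P : R -> Prop) := \forall t \ae leb, unitI t -> P t.

Lemma aeI_imp (P Q : R -> Prop) :
  (forall t, unitI t -> P t -> Q t) -> aeI P -> aeI Q.
Proof.
have F : Filter (nbhs (almost_everywhere leb)) by exact: ae_filter_ringOfSetsType.
by move=> PQ; apply: (@filterS _ _ F) => t + It => /(_ It); exact: PQ.
Qed.

Lemma aeI_and (P Q : R -> Prop) : aeI P -> aeI Q -> aeI (fun t => P t /\ Q t).
Proof.
have F : Filter (nbhs (almost_everywhere leb)) by exact: ae_filter_ringOfSetsType.
by apply: (@filterS2 _ _ F) => t p q It; split; [exact: p|exact: q].
Qed.

Lemma aeI_all (P : R -> Prop) : (forall t, unitI t -> P t) -> aeI P.
Proof. by move=> aP; apply: aeW. Qed.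

Definition cintegrable f :=
  leb.-integrable unitI (EFin \o (Re \o f)) /\ leb.-integrable unitI (EFin \o (Im \o f)).

Lemma cintegrable_measurable f : cintegrable f -> cmeasurable f.
Proof.
by move=> [i1 i2]; split; apply/measurable_EFinP;
  [exact: measurable_int i1|exact: measurable_int i2].
Qed.

Lemma cintegrableD f g : cintegrable f -> cintegrable g ->
  cintegrable (fun t => f t + g t).
Proof.
move=> [f1 f2] [g1 g2]; split.
  by apply: eq_integrable (integrableD _ f1 g1) => // t _; rewrite /= ReD.
by apply: eq_integrable (integrableD _ f2 g2) => // t _; rewrite /= ImD.
Qed.

Lemma cintegrableZ c f : cintegrable f -> cintegrable (fun t => c * f t).
Proof.
move=> [f1 f2]; split.
  apply: eq_integrable (integrableB _ (integrableZl _ (Re c) f1)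
    (integrableZl _ (Im c) f2)) => // t _.
  by rewrite /= ReM EFinB !EFinM.
apply: eq_integrable (integrableD _ (integrableZl _ (Re c) f2)
  (integrableZl _ (Im c) f1)) => // t _.
by rewrite /= ImM EFinD !EFinM.
Qed.

Lemma cintegrable0 : cintegrable (fun=> 0).
Proof. by split; apply: eq_integrable (integrable0 leb unitI). Qed.

Lemma cintegrable_dom f (u : R -> R) : cmeasurable f ->
  leb.-integrable unitI (EFin \o u) ->
  (forall t, unitI t -> `|Re (f t)| <= u t /\ `|Im (f t)| <= u t) -> cintegrable f.
Proof.
move=> [mf1 mf2] iu fu; split.
  apply: le_integrable iu => //; first exact/measurable_EFinP.
  by move=> t It; rewrite /= lee_fin (le_trans (fu t It).1)// ler_norm.
apply: le_integrable iu => //; first exact/measurable_EFinP.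
by move=> t It; rewrite /= lee_fin (le_trans (fu t It).2)// ler_norm.
Qed.

Lemma cintD f g : cintegrable f -> cintegrable g ->
  cint (fun t => f t + g t) = cint f + cint g.
Proof.
move=> [f1 f2] [g1 g2]; apply: eq_complexP; rewrite /cint ?ReD ?ImD /=.
  by rewrite -RintegralD//; apply: eq_Rintegral => t _; rewrite ReD.
by rewrite -RintegralD//; apply: eq_Rintegral => t _; rewrite ImD.
Qed.

Lemma cintZ c f : cintegrable f -> cint (fun t => c * f t) = c * cint f.
Proof.
move=> [f1 f2]; have I x u : leb.-integrable unitI (EFin \o u) ->
    leb.-integrable unitI (EFin \o (fun t => x * u t)).
  by move=> iu; apply: eq_integrable (integrableZl _ x iu) => // t _.
apply: eq_complexP; rewrite /cint ?ReM ?ImM /=.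
  rewrite -!RintegralZl// -RintegralB//; [|exact: I..].
  by apply: eq_Rintegral => t _; rewrite ReM.
rewrite -!RintegralZl// -RintegralD//; [|exact: I..].
by apply: eq_Rintegral => t _; rewrite ImM.
Qed.

Lemma cintJ f : cintegrable f -> cint (fun t => Num.conj (f t)) = Num.conj (cint f).
Proof.
move=> [f1 f2]; apply: eq_complexP; rewrite /cint ?ReJ ?ImJ /=.
  by apply: eq_Rintegral => t _; rewrite ReJ.
rewrite -mulN1r -RintegralZl//.
by apply: eq_Rintegral => t _; rewrite ImJ mulN1r.
Qed.

Lemma cint0 : cint (fun=> 0 : R[i]) = 0.
Proof. by rewrite /cint /= /Rintegral integral0. Qed.

Lemma cintegrable_sum I (r : seq I) (P : pred I) (F : I -> R -> R[i]) :
  (forall i, P i -> cintegrable (F i)) ->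
  cintegrable (fun t => \sum_(i <- r | P i) F i t) /\
  cint (fun t => \sum_(i <- r | P i) F i t) = \sum_(i <- r | P i) cint (F i).
Proof.
move=> mF; elim: r => [|i r [IH1 IH2]].
  rewrite big_nil (_ : (fun _ => _) = fun=> 0).
    by split; [exact: cintegrable0|exact: cint0].
  by apply/funext => t; rewrite big_nil.
rewrite (_ : (fun _ => _) = fun t => (if P i then F i t else 0) +
  \sum_(j <- r | P j) F j t); last first.
  by apply/funext => t; rewrite big_cons; case: ifP; rewrite ?add0r.
rewrite big_cons; case: (boolP (P i)) => [/mF Pi|_].
  by split; [exact: cintegrableD|rewrite cintD// IH2].
split; first by apply: cintegrableD => //; exact: cintegrable0.
by rewrite cintD// ?cint0 ?add0r//; exact: cintegrable0.
Qed.

Lemma eq_cint f g : (forall t, unitI t -> f t = g t) -> cint f = cint g.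
Proof.
by move=> fg; apply: eq_complexP; apply: eq_Rintegral => t /set_mem It; rewrite fg.
Qed.

Lemma ae_eq_cint f g : cmeasurable f -> cmeasurable g -> aeeq f g -> cint f = cint g.
Proof.
move=> [f1 f2] [g1 g2] fg; apply: eq_complexP; rewrite /= /Rintegral;
  congr fine; apply: ae_eq_integral => //; try exact/measurable_EFinP.
- by apply: aeI_imp fg => t _ /= ->.
- by apply: aeI_imp fg => t _ /= ->.
Qed.

End ComplexIntegral.

Section VectorFunctions.
Variables (R : realType) (U : vectType R[i]).
Local Notation b := (vbasis (@fullv _ U)).
Implicit Types (f g : R -> U) (phi : U -> R[i]).

Lemma scalar0 phi : scalar phi -> phi 0 = 0.
Proof.
move=> sphi; apply/(addrI (phi 0)); rewrite addr0.
by have := sphi 1 0 0; rewrite scale1r mul1r addr0 => <-.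
Qed.

Lemma scalar_sum phi I (r : seq I) (a : I -> R[i]) (u : I -> U) : scalar phi ->
  phi (\sum_(i <- r) a i *: u i) = \sum_(i <- r) a i * phi (u i).
Proof.
move=> sphi; elim: r => [|i r IH]; first by rewrite !big_nil scalar0.
by rewrite !big_cons sphi IH.
Qed.

Lemma scalar_coord phi x : scalar phi ->
  phi x = \sum_i coord b i x * phi b`_i.
Proof. by move=> sphi; rewrite {1}(coord_vbasis (memvf x)) scalar_sum. Qed.

Lemma vmeasurable_scalar phi f : scalar phi -> vmeasurable f ->
  cmeasurable (fun t => phi (f t)).
Proof.
move=> sphi mf; under eq_fun do rewrite (scalar_coord _ sphi).
by apply: cmeasurable_sum => i _; apply: cmeasurableM => //; exact: cmeasurable_cst.
Qed.

(** [vint] is defined by coordinates in a fixed basis; this frees it from the basis, and every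
    vector integral is then tested by linear functionals. *)
Lemma scalar_vint phi f : scalar phi ->
  (forall psi, scalar psi -> cintegrable (fun t => psi (f t))) ->
  phi (vint f) = cint (fun t => phi (f t)).
Proof.
move=> sphi cf; rewrite /vint scalar_sum//.
transitivity (cint (fun t => \sum_(i < \dim (@fullv _ U)) phi b`_i * coord b i (f t))); last first.
  by apply: eq_cint => t _; rewrite [RHS]scalar_coord//; apply: eq_bigr => i _; rewrite mulrC.
have ci i : cintegrable (fun t => coord b i (f t)).
  by apply: cf => a u v /=; rewrite linearP.
rewrite (cintegrable_sum _ _).2 => [|i _]; last exact: cintegrableZ.
by apply: eq_bigr => i _; rewrite cintZ// mulrC.
Qed.

Lemma vmeasurable_lincomb I (r : seq I) (a : I -> R -> R[i]) (u : I -> U) :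
  (forall i, cmeasurable (a i)) -> vmeasurable (fun t => \sum_(i <- r) a i t *: u i).
Proof.
move=> ma k; under eq_fun do rewrite linear_sum/=.
apply: cmeasurable_sum => i _; under eq_fun do rewrite linearZ/=.
by apply: cmeasurableM => //; exact: cmeasurable_cst.
Qed.

Lemma vmeasurableD f g : vmeasurable f -> vmeasurable g ->
  vmeasurable (fun t => f t + g t).
Proof.
by move=> mf mg k; under eq_fun do rewrite linearD/=; exact: cmeasurableD.
Qed.

Lemma vmeasurableZ (a : R -> R[i]) f : cmeasurable a -> vmeasurable f ->
  vmeasurable (fun t => a t *: f t).
Proof.
by move=> ma mf k; under eq_fun do rewrite linearZ/=; exact: cmeasurableM.
Qed.

Lemma vmeasurable_cst (x : U) : vmeasurable (fun=> x).
Proof. by move=> k; exact: cmeasurable_cst. Qed.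

End VectorFunctions.

Section OrthonormalBasis.
Variables (R : realType) (H : vectType R[i]) (dot : {dot H for Num.conj}).
Local Notation onb := (onb dot).
Local Notation Re := (@complex.Re R).
Local Notation Im := (@complex.Im R).

Lemma scalar_dotl x : scalar (fun y => dot y x).
Proof. by move=> a u v; rewrite linearPl. Qed.

Lemma dot_onb x y : dot x y = \sum_(e <- onb) dot x e * Num.conj (dot y e).
Proof.
rewrite {1}(onb_expansion dot y) linear_sumr; apply: eq_bigr => e _.
by rewrite linearZr_LR /= mulrC.
Qed.

Lemma hnorm_sqr x : hnorm dot x ^+ 2 = Re (dot x x).
Proof. by rewrite /hnorm sqr_sqrtr//; case/ge0_Re_Im: (dnorm_ge0 dot x). Qed.

Lemma hnorm_ge0 x : 0 <= hnorm dot x. Proof. exact: sqrtr_ge0. Qed.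

Lemma dot_hnorm x : dot x x = Complex (hnorm dot x ^+ 2) 0.
Proof.
by rewrite hnorm_sqr; have [_] := ge0_Re_Im (dnorm_ge0 dot x); case: (dot x x) => a c /= ->.
Qed.

Lemma hnorm_eq0 x : hnorm dot x = 0 -> x = 0.
Proof.
by move=> x0; apply/eqP; rewrite -(dnorm_eq0 dot) dot_hnorm x0 expr0n /= eqxx.
Qed.

(** Expand |x + y|^2 >= 0 and |x - y|^2 >= 0; the bound is cruder than Cauchy-Schwarz but directly
    dominates an integrand. *)
Lemma Re_dot_le x y : `|Re (dot x y)| <= hnorm dot x ^+ 2 + hnorm dot y ^+ 2.
Proof.
have p z : 0 <= Re (dot z z) by case/ge0_Re_Im: (dnorm_ge0 dot z).
have := p (x - y); have := p (x + y); rewrite dnormB dnormD !hnorm_sqr.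
move: (p x) (p y); case: (dot x x) (dot y y) (dot x y) => [a ?] [c ?] [d ?] /=.
move=> a0 c0 h1 h2; rewrite ler_norml; lra.
Qed.

Lemma hnormZ (c : R[i]) x : hnorm dot (c *: x) ^+ 2 = (Re c ^+ 2 + Im c ^+ 2) * hnorm dot x ^+ 2.
Proof.
by rewrite !hnorm_sqr dnormZ -add_Re2_Im2 ReM /= mul0r subr0.
Qed.

Lemma Im_dot_le x y : `|Im (dot x y)| <= hnorm dot x ^+ 2 + hnorm dot y ^+ 2.
Proof.
(* Im w = Re (-i w), and -i x has the norm of x. *)
have -> : hnorm dot x ^+ 2 = hnorm dot (Complex 0 (-1) *: x) ^+ 2.
  by rewrite hnormZ /= expr0n /= add0r sqrrN expr1n mul1r.
have -> : Im (dot x y) = Re (dot (Complex 0 (-1) *: x) y).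
  by rewrite linearZl_LR /= ReM /= mul0r mulN1r opprK add0r.
exact: Re_dot_le.
Qed.

Lemma hnormD_le x y : hnorm dot (x + y) ^+ 2 <= 2 * hnorm dot x ^+ 2 + 2 * hnorm dot y ^+ 2.
Proof.
have := dnorm_ge0 dot (x - y); move=> /ge0_Re_Im[+ _].
rewrite !hnorm_sqr dnormB dnormD.
case: (dot x x) (dot y y) (dot x y) => [a ?] [c ?] [d ?] /=; lra.
Qed.

Lemma hnorm_onb x : hnorm dot x ^+ 2 =
  \sum_(e <- onb) (Re (dot x e) ^+ 2 + Im (dot x e) ^+ 2).
Proof.
rewrite hnorm_sqr dot_onb; elim: onb => [|e r IH]; first by rewrite !big_nil.
by rewrite !big_cons ReD IH ReM ReJ ImJ; congr (_ + _); ring.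
Qed.

End OrthonormalBasis.

Section SquareIntegrable.
Variables (R : realType) (H : vectType R[i]) (dot : {dot H for Num.conj}).
Local Notation onb := (onb dot).
Local Notation Re := (@complex.Re R).
Local Notation Im := (@complex.Im R).
Local Notation leb := (@leb R).
Local Notation unitI := (@unitI R).
Implicit Types f g : R -> H.

Lemma vmeasurable_onb f : (forall e, e \in onb -> cmeasurable (fun t => dot (f t) e)) ->
  vmeasurable f.
Proof.
move=> mf; rewrite (_ : f = fun t => \sum_(i < size onb) dot (f t) (nth 0 onb i) *: nth 0 onb i).
  by apply: vmeasurable_lincomb => i; apply: mf; rewrite mem_nth.
by apply/funext => t; rewrite {1}(onb_expansion dot (f t)) (big_nth 0) big_mkord.
Qed.

Lemma cmeasurable_dot f g : vmeasurable f -> vmeasurable g ->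
  cmeasurable (fun t => dot (f t) (g t)).
Proof.
move=> mf mg; under eq_fun do rewrite dot_onb.
apply: cmeasurable_sum => e _; apply: cmeasurableM; last apply: cmeasurableJ.
  exact: vmeasurable_scalar (scalar_dotl _ _) mf.
exact: vmeasurable_scalar (scalar_dotl _ _) mg.
Qed.

Lemma measurable_hnorm2 f : vmeasurable f ->
  measurable_fun unitI (fun t => hnorm dot (f t) ^+ 2).
Proof.
move=> mf; under eq_fun do rewrite hnorm_sqr.
exact: (cmeasurable_dot mf mf).1.
Qed.

Lemma L2P f : L2 dot f <->
  vmeasurable f /\ leb.-integrable unitI (fun t => (hnorm dot (f t) ^+ 2)%:E).
Proof.
split=> [[mf lef]|[mf /integrableP[_ lef]]]; split=> //.
  apply/integrableP; split; first by apply/measurable_EFinP; exact: measurable_hnorm2.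
  apply: le_lt_trans lef; rewrite le_eqVlt; apply/orP; left; apply/eqP.
  by apply: eq_integral => t _; rewrite gee0_abs// lee_fin sqr_ge0.
apply: le_lt_trans lef; rewrite le_eqVlt; apply/orP; left; apply/eqP.
by apply: eq_integral => t _; rewrite gee0_abs// lee_fin sqr_ge0.
Qed.

Lemma L2_dom f (u : R -> R) : vmeasurable f -> leb.-integrable unitI (EFin \o u) ->
  aeI (fun t => hnorm dot (f t) ^+ 2 <= u t) -> L2 dot f.
Proof.
move=> mf iu fu; split => //; move: (iu) => /integrableP[_]; apply: le_lt_trans.
apply: ae_ge0_le_integral => //.
- exact: measurable_unitI.
- by move=> t _; rewrite lee_fin sqr_ge0.
- by apply/measurable_EFinP; exact: measurable_hnorm2.
- by apply: measurableT_comp => //; exact: measurable_int iu.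
- by apply: aeI_imp fu => t _ /= ftu; rewrite lee_fin (le_trans ftu)// ler_norm.
Qed.

Lemma L2_measurable f : L2 dot f -> vmeasurable f. Proof. by case. Qed.

Lemma L2_integrable f : L2 dot f ->
  leb.-integrable unitI (EFin \o (fun t => hnorm dot (f t) ^+ 2)).
Proof. by case/L2P. Qed.

Lemma L2D f g : L2 dot f -> L2 dot g -> L2 dot (f + g).
Proof.
move=> /L2P[mf i_f] /L2P[mg i_g]; apply: (@L2_dom _ (fun t => 2 * hnorm dot (f t) ^+ 2 + 2 * hnorm dot (g t) ^+ 2)).
- exact: vmeasurableD.
- by apply: (integrableD _ (integrableZl _ 2 i_f) (integrableZl _ 2 i_g)) => //;
    exact: measurable_unitI.
- by apply: aeI_all => t _; exact: hnormD_le.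
Qed.

Lemma L2_scale (a : R -> R[i]) (M : R) f : cmeasurable a ->
  aeI (fun t => Re (a t) ^+ 2 + Im (a t) ^+ 2 <= M) -> L2 dot f ->
  L2 dot (fun t => a t *: f t).
Proof.
move=> ma aM /L2P[mf i_f]; apply: (@L2_dom _ (fun t => M * hnorm dot (f t) ^+ 2)).
- exact: vmeasurableZ.
- by apply: (integrableZl _ M i_f) => //; exact: measurable_unitI.
- by apply: aeI_imp aM => t _ /= aM; rewrite hnormZ ler_wpM2r// sqr_ge0.
Qed.

Lemma L2Z (c : R[i]) f : L2 dot f -> L2 dot (c *: f).
Proof.
apply: (@L2_scale (fun=> c) (Re c ^+ 2 + Im c ^+ 2)); first exact: cmeasurable_cst.
exact: aeI_all.
Qed.

Lemma L2_bounded (M : R) f : vmeasurable f -> aeI (fun t => hnorm dot (f t) <= M) ->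
  L2 dot f.
Proof.
move=> mf fM; apply: (@L2_dom _ (fun t => M ^+ 2)) => //.
  exact: integrable_cst_unitI.
by apply: aeI_imp fM => t _ /= fM; rewrite ler_sqr ?nnegrE ?hnorm_ge0// (le_trans _ fM) ?hnorm_ge0.
Qed.

Lemma L2_cst (x : H) : L2 dot (fun=> x).
Proof.
apply: (@L2_bounded (hnorm dot x)); first exact: vmeasurable_cst.
exact: aeI_all.
Qed.

Lemma L20 : L2 dot 0. Proof. exact: (L2_cst 0). Qed.

Lemma L2B f g : L2 dot f -> L2 dot g -> L2 dot (f - g).
Proof. by move=> Lf Lg; rewrite -scaleN1r; apply: L2D => //; exact: L2Z. Qed.

Lemma L2_dot f g : L2 dot f -> L2 dot g -> cintegrable (fun t => dot (f t) (g t)).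
Proof.
move=> /L2P[mf i_f] /L2P[mg i_g].
apply: (@cintegrable_dom _ _ (fun t => hnorm dot (f t) ^+ 2 + hnorm dot (g t) ^+ 2)).
- exact: cmeasurable_dot.
- by apply: (integrableD _ i_f i_g) => //; exact: measurable_unitI.
- by move=> t _; split; [exact: Re_dot_le|exact: Im_dot_le].
Qed.

Lemma ipDl f g h : L2 dot f -> L2 dot g -> L2 dot h ->
  ip dot (f + g) h = ip dot f h + ip dot g h.
Proof.
move=> Lf Lg Lh; rewrite /ip -cintD; [|exact: L2_dot..].
by apply: eq_cint => t _; rewrite linearDl.
Qed.

Lemma ipZl c f h : L2 dot f -> L2 dot h -> ip dot (c *: f) h = c * ip dot f h.
Proof.
move=> Lf Lh; rewrite /ip -cintZ; last exact: L2_dot.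
by apply: eq_cint => t _; rewrite linearZl_LR.
Qed.

Lemma ipC f g : L2 dot f -> L2 dot g -> ip dot f g = Num.conj (ip dot g f).
Proof.
move=> Lf Lg; rewrite /ip -cintJ; last exact: L2_dot.
by apply: eq_cint => t _; rewrite dotC.
Qed.

Lemma ip_ge0 f : L2 dot f -> 0 <= ip dot f f.
Proof.
move=> Lf; rewrite /ip /cint lecE /=; apply/andP; split.
  apply/eqP; rewrite /Rintegral (eq_integral (cst 0%E)) ?integral0// => t _ /=.
  by rewrite dot_hnorm.
by apply: Rintegral_ge0 => t _; rewrite -hnorm_sqr sqr_ge0.
Qed.

Lemma ip_eq0 f : L2 dot f -> ip dot f f = 0 -> aeeq f 0.
Proof.
move=> Lf; rewrite /ip /cint => -[+ _].
rewrite (_ : (fun t => Re (dot (f t) (f t))) = (fun t => hnorm dot (f t) ^+ 2)); last first.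
  by apply/funext => t; rewrite hnorm_sqr.
move=> f0; have /L2P[mf i_f] := Lf.
have mF : measurable_fun unitI (fun t => (hnorm dot (f t) ^+ 2)%:E).
  by apply/measurable_EFinP; exact: measurable_hnorm2.
have [h _] := @ae_eq_integral_abs _ _ _ leb unitI (@measurable_unitI R) _ mF.
have : aeeq (fun t => (hnorm dot (f t) ^+ 2)%:E) (fun=> 0%E).
  apply: h; have /fineK := integrable_fin_num (@measurable_unitI R) i_f.
  have -> : fine (\int[leb]_(t in unitI) (hnorm dot (f t) ^+ 2)%:E) = 0 by exact: f0.
  by move=> I0; apply: (etrans _ (esym I0)); apply: eq_integral => t _; rewrite gee0_abs// lee_fin sqr_ge0.
apply: aeI_imp => t _ /= /eqP; rewrite eqe sqrf_eq0 => /eqP.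
exact: hnorm_eq0.
Qed.

Lemma ae_eq_ip f f' g g' : L2 dot f -> L2 dot f' -> L2 dot g -> L2 dot g' ->
  aeeq f f' -> aeeq g g' -> ip dot f g = ip dot f' g'.
Proof.
move=> Lf Lf' Lg Lg' ff' gg'; apply: ae_eq_cint.
- exact: cmeasurable_dot Lf.1 Lg.1.
- exact: cmeasurable_dot Lf'.1 Lg'.1.
- by apply: aeI_imp (aeI_and ff' gg') => t _ /= [-> ->].
Qed.

End SquareIntegrable.

(** * Completeness of L^2, first for real functions *)

Section RealCompleteness.
Variable R : realType.
Local Notation leb := (@leb R).
Local Notation unitI := (@unitI R).
Implicit Types g : nat -> R -> R.

Lemma limn_einf_le (u : (\bar R)^nat) (l : \bar R) :
  (forall n, (u n <= l)%E) -> (limn_einf u <= l)%E.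
Proof.
move=> ul; rewrite limn_einf_lim; apply: lime_le; first exact: is_cvg_einfs.
by apply: nearW => n; apply: le_trans (ul n); apply: ereal_inf_lbound; exists n => /=.
Qed.

(** The sum of the |g_{n+1} - g_n| has finite integral, so almost everywhere the telescoping series
    converges absolutely. *)
Lemma real_cauchy_ae_cvg g : (forall n, measurable_fun unitI (g n)) ->
  (forall n, (\int[leb]_(t in unitI) ((g n.+1 t - g n t) ^+ 2)%:E <= (4^-1 ^+ n)%:E)%E) ->
  aeI (fun t => cvgn (g ^~ t)).
Proof.
move=> mg gC; pose d n t := `|(g n.+1 t - g n t)%:E|%E.
have mdr n : measurable_fun unitI (fun t => g n.+1 t - g n t) by exact: measurable_funB.
have mdr2 n : measurable_fun unitI (fun t => ((g n.+1 t - g n t) ^+ 2)%:E).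
  by apply/measurable_EFinP; apply: measurable_funX; exact: mdr.
have md n : measurable_fun unitI (d n).
  by apply: measurableT_comp => //; apply/measurable_EFinP; exact: mdr.
have mI : measurable (unitI : set (measurableTypeR R)) by exact: measurable_unitI.
(* Young's inequality |x| <= (p/2) x^2 + 1/(2p) with p = 2^n stands in for Hoelder's: each term
   integrates to at most 2^-n / 2. The total is written 2 / 2^(n+1) to fit [epsilon_trick0]. *)
have d_le n : (\int[leb]_(t in unitI) d n t <= (2 / (2 ^ n.+1)%:R)%:E)%E.
  pose a : R := 2 ^+ n / 2.
  have a0 : 0 <= a by rewrite /a divr_ge0// exprn_ge0.
  apply: (@le_trans _ _ (\int[leb]_(t in unitI)
      (a%:E * ((g n.+1 t - g n t) ^+ 2)%:E + (2^-1 ^+ n / 2)%:E))%E).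
    apply: ge0_le_integral; [exact: mI|by move=> t _; exact: abse_ge0|exact: md|..].
    - apply: emeasurable_funD; last exact: measurable_cst.
      by apply: measurable_funeM; exact: mdr2.
    - move=> t _; rewrite /d lee_fin -[leLHS]/`|_|%R.
      have p0 : 0 < 2 ^+ n :> R by rewrite exprn_gt0.
      move: (g n.+1 t - g n t) => x; rewrite /a exprVn; move: p0; set p := 2 ^+ n => p0.
      have pE : p / 2 * x ^+ 2 + p^-1 / 2 - `|x| = (p * `|x| - 1) ^+ 2 / p / 2.
        by rewrite -[x ^+ 2]real_normK ?num_real//; field; exact: lt0r_neq0.
      by rewrite -subr_ge0 pE !divr_ge0 ?sqr_ge0// ltW.
  rewrite ge0_integralD//; last 2 first.
  - by move=> t _; rewrite -EFinM lee_fin mulr_ge0// sqr_ge0.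
  - by apply: measurable_funeM; exact: mdr2.
  rewrite ge0_integralZl//; last 2 first.
  - exact: mdr2.
  - by move=> t _; rewrite lee_fin sqr_ge0.
  rewrite integral_cst// leb_unitI mule1.
  apply: (@le_trans _ _ (a%:E * (4^-1 ^+ n)%:E + (2^-1 ^+ n / 2)%:E)%E).
    by rewrite leeD2r// lee_wpmul2l ?lee_fin.
  rewrite -EFinM -EFinD lee_fin /a natrX exprS.
  have -> : 4^-1 ^+ n = 2^-1 ^+ n * 2^-1 ^+ n :> R.
    by rewrite -exprMn; congr (_ ^+ n); field.
  rewrite exprVn; have : 2 ^+ n != 0 :> R by rewrite expf_neq0.
  by move: (2 ^+ n) => p p0; rewrite le_eqVlt; apply/orP; left; apply/eqP; field.
have S_lty : (\int[leb]_(t in unitI) (\sum_(0 <= n <oo) d n t) < +oo)%E.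
  rewrite integral_nneseries; [|exact: mI|exact: md|by move=> n t _; exact: abse_ge0].
  apply: (@le_lt_trans _ _ (\sum_(0 <= n <oo) (2 / (2 ^ n.+1)%:R)%:E)%E).
    apply: lee_nneseries => [n _ _|n _]; last exact: d_le.
    by apply: integral_ge0 => t _; exact: abse_ge0.
  by apply: le_lt_trans (epsilon_trick0 _ _) _; rewrite ?ltry.
have mS : measurable_fun unitI (fun t => \sum_(0 <= n <oo) d n t)%E.
  apply: (@ge0_emeasurable_sum _ _ _ _ d xpredT) => [k t _ _|k _]; last exact: md.
  exact: abse_ge0.
have iS : leb.-integrable unitI (fun t => \sum_(0 <= n <oo) d n t)%E.
  apply/integrableP; split => //; apply: le_lt_trans S_lty.
  rewrite le_eqVlt; apply/orP; left; apply/eqP; apply: eq_integral => t _.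
  by rewrite gee0_abs//; apply: nneseries_ge0 => n _ _; exact: abse_ge0.
have := integrable_ae mI iS; apply: aeI_imp => t _ Sfin.
suff : cvgn (series (telescope (g ^~ t))).
  rewrite telescopeK => c.
  have -> : g ^~ t = (fun n => g n t - g 0%N t + g 0%N t).
    by apply/funext => n; rewrite subrK.
  by apply: is_cvgD; [exact: c|exact: is_cvg_cst].
apply: normed_cvg; apply: nondecreasing_is_cvgn.
  by apply: nondecreasing_series => n _ /=.
exists (fine (\sum_(0 <= n <oo) d n t)%E) => _ [n _ <-].
rewrite -lee_fin fineK// /series /= -sumEFin.
exact: nneseries_lim_ge.
Qed.

(** The limit inherits the rate, without loss, from Fatou's lemma applied in m to (g_{n+m} -
    g_n)^2. *)
Lemma real_complete g : (forall n, measurable_fun unitI (g n)) ->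
  (forall n m, (n <= m)%N ->
    (\int[leb]_(t in unitI) ((g m t - g n t) ^+ 2)%:E <= (4^-1 ^+ n)%:E)%E) ->
  exists2 h : R -> R, measurable_fun unitI h &
    forall n, (\int[leb]_(t in unitI) ((h t - g n t) ^+ 2)%:E <= (4^-1 ^+ n)%:E)%E.
Proof.
move=> mg gC; have cg := real_cauchy_ae_cvg mg (fun n => gC n n.+1 (leqnSn n)).
have mI : measurable (unitI : set (measurableTypeR R)) by exact: measurable_unitI.
(* [limn_esup] is defined and measurable whether or not the sequence converges, and [fine] makes its
   values real. *)
pose h t := fine (limn_esup (fun n => (g n t)%:E)).
have mh : measurable_fun unitI h.
  apply: (measurableT_comp (f := fine)); first by apply: fine_measurable; exact: measurableT.
  by apply: measurable_fun_limn_esup => n; apply/measurable_EFinP; exact: mg.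
exists h => // n.
apply: le_trans (limn_einf_le (u := fun m =>
  (\int[leb]_(t in unitI) ((g (n + m)%N t - g n t) ^+ 2)%:E)%E) _); last first.
  by move=> m; apply: gC; rewrite leq_addr.
have mgg m : measurable_fun unitI (fun t => ((g (n + m)%N t - g n t) ^+ 2)%:E).
  by apply/measurable_EFinP; apply: measurable_funX; exact: measurable_funB.
apply: le_trans (fatou _ _ _ _) => //; last by move=> m t _; rewrite lee_fin sqr_ge0.
rewrite le_eqVlt; apply/orP; left; apply/eqP; apply: ae_eq_integral => //.
- by apply/measurable_EFinP; apply: measurable_funX; apply: measurable_funB => //; exact: mg.
- rewrite (_ : (fun _ => _) = fun t => (- limn_esup (-%E \o (fun m => ((g (n + m)%N t - g n t) ^+ 2)%:E)))%E).
    by apply: measurableT_comp => //; apply: measurable_fun_limn_esup => m; apply: measurableT_comp => //; exact: mgg.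
  by apply/funext => t; rewrite limn_esupN oppeK.
apply: aeI_imp cg => t _ /cvg_ex[l gl].
have gl' : (g n t)%:E @[n --> \oo] --> l%:E by apply: cvg_EFin; [exact: nearW|exact: gl].
have ht : h t = l by rewrite /h (cvg_limn_einf_sup gl').2.
have : ((g (n + m)%N t - g n t) ^+ 2)%:E @[m --> \oo] --> ((l - g n t) ^+ 2)%:E.
  apply: cvg_EFin; first exact: nearW.
  have gs : g (n + m)%N t @[m --> \oo] --> l.
    exact: cvg_comp (cvg_addnl n) gl.
  apply: (@cvg_comp _ _ _ (fun m => g (n + m)%N t - g n t) (fun x => x ^+ 2) _ (nbhs (l - g n t))).
    by apply: cvgB; [exact: gs|exact: cvg_cst].
  exact: exprn_continuous.
by move=> /cvg_limn_einf_sup[-> _]; rewrite ht.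
Qed.
End RealCompleteness.

Section HilbertSpace.
Variables (R : realType) (H : vectType R[i]) (dot : {dot H for Num.conj}).
Local Notation onb := (onb dot).
Local Notation Re := (@complex.Re R).
Local Notation Im := (@complex.Im R).
Local Notation leb := (@leb R).
Local Notation unitI := (@unitI R).
Local Notation L2 := (L2 dot).
Local Notation ip := (ip dot).
Implicit Types (f g h : R -> H) (c : R[i]).

Lemma integral_hnorm2 f : L2 f ->
  (\int[leb]_(t in unitI) (hnorm dot (f t) ^+ 2)%:E = (sqnorm ip f)%:E)%E.
Proof.
move=> Lf; have /fineK <- := integrable_fin_num (@measurable_unitI R) (L2_integrable Lf).
congr EFin; rewrite /sqnorm /= /Rintegral; congr fine.
by apply: eq_integral => t _; rewrite -hnorm_sqr.
Qed.

Lemma dot_onb_lincomb (a : H -> R[i]) e : e \in onb ->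
  dot (\sum_(e' <- onb) a e' *: e') e = a e.
Proof.
move=> eo; have [oo _] := onbP dot; have /orthonormalP[uo oE] := oo.
rewrite linear_sumlz (bigD1_seq e)//= big_seq_cond big1 ?addr0.
  by rewrite linearZl_LR /= oE// eqxx mulr1.
by move=> e' /andP[e'o ne]; rewrite linearZl_LR /= oE// (negbTE ne) mulr0.
Qed.

(** The real and imaginary parts of the coordinates in [onb] form 2 dim H real sequences, each at
    squared distance at most 4^-n from its limit; hence the constant. *)
Lemma L2_complete (f : nat -> R -> H) : (forall n, L2 (f n)) ->
  (forall n m, (n <= m)%N -> sqnorm ip (f m - f n) <= 4^-1 ^+ n) ->
  exists2 h, L2 h & forall n, sqnorm ip (h - f n) <= (2 * size onb)%:R * 4^-1 ^+ n.
Proof.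
move=> Lf fC; have mf n := L2_measurable (Lf n).
have md e n : cmeasurable (fun t => dot (f n t) e).
  exact: vmeasurable_scalar (scalar_dotl _ _) (mf n).
have le1 (w : R[i] -> R) e : e \in onb -> (forall z z', w (z - z') = w z - w z') ->
    (forall z, w z ^+ 2 <= Re z ^+ 2 + Im z ^+ 2) ->
    (forall n, measurable_fun unitI (fun t => w (dot (f n t) e))) ->
  exists u : R -> R, measurable_fun unitI u /\
    forall n, (\int[leb]_(t in unitI) ((u t - w (dot (f n t) e)) ^+ 2)%:E <= (4^-1 ^+ n)%:E)%E.
  move=> eo wB wle mw; have [n m nm|u mu uC] := real_complete mw; last by exists u.
  apply: (@le_trans _ _ (\int[leb]_(t in unitI) (hnorm dot ((f m - f n) t) ^+ 2)%:E)%E).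
    apply: ge0_le_integral.
    - exact: measurable_unitI.
    - by move=> t _; rewrite lee_fin sqr_ge0.
    - by apply/measurable_EFinP; apply: measurable_funX; apply: measurable_funB; exact: mw.
    - by apply/measurable_EFinP; apply: measurable_hnorm2; exact: (L2B (Lf m) (Lf n)).1.
    - move=> t _; rewrite lee_fin -wB -linearBl hnorm_onb (bigD1_seq e)//=; last first.
        by have [/orthonormal_free/free_uniq] := onbP dot.
      rewrite (le_trans (wle _))// lerDl sumr_ge0// => e' _.
      by rewrite addr_ge0 ?sqr_ge0.
  by rewrite integral_hnorm2 ?lee_fin; [exact: fC|exact: L2B].
have /choice[u uP] : forall e, exists u : R -> R, measurable_fun unitI u /\
    (e \in onb -> forall n, (\int[leb]_(t in unitI) ((u t - Re (dot (f n t) e)) ^+ 2)%:E <= (4^-1 ^+ n)%:E)%E).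
  move=> e; case: (boolP (e \in onb)) => [eo|_]; last by exists (fun=> 0); split => //; exact: measurable_cst.
  have [z z'|z|n|u [mu uP]] := le1 Re e eo; last by exists u.
  - by case: z z' => [? ?] [? ?].
  - by rewrite lerDl sqr_ge0.
  - exact: (md e n).1.
have /choice[v vP] : forall e, exists u : R -> R, measurable_fun unitI u /\
    (e \in onb -> forall n, (\int[leb]_(t in unitI) ((u t - Im (dot (f n t) e)) ^+ 2)%:E <= (4^-1 ^+ n)%:E)%E).
  move=> e; case: (boolP (e \in onb)) => [eo|_]; last by exists (fun=> 0); split => //; exact: measurable_cst.
  have [z z'|z|n|v [mv vP]] := le1 Im e eo; last by exists v.
  - by case: z z' => [? ?] [? ?].
  - by rewrite lerDr sqr_ge0.
  - exact: (md e n).2.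
pose h t := \sum_(e <- onb) Complex (u e t) (v e t) *: e.
have hd e t : e \in onb -> dot (h t) e = Complex (u e t) (v e t).
  by move=> eo; rewrite /h (dot_onb_lincomb (fun e => Complex (u e t) (v e t))).
have mh : vmeasurable h.
  apply: (@vmeasurable_onb _ _ dot) => e eo; under eq_fun do rewrite hd//.
  by split; [exact: (uP e).1|exact: (vP e).1].
have hI n : (\int[leb]_(t in unitI) (hnorm dot ((h - f n) t) ^+ 2)%:E <=
    ((2 * size onb)%:R * 4^-1 ^+ n)%:E)%E.
  have hE t : (hnorm dot ((h - f n) t) ^+ 2)%:E = (\sum_(e <- onb)
      (((u e t - Re (dot (f n t) e)) ^+ 2)%:E + ((v e t - Im (dot (f n t) e)) ^+ 2)%:E))%E.
    rewrite hnorm_onb -sumEFin big_seq [RHS]big_seq; apply: eq_bigr => e eo.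
    by rewrite linearBl /= hd//; case: (dot (f n t) e).
  under eq_integral do rewrite hE.
  have mu e : measurable_fun unitI (fun t => ((u e t - Re (dot (f n t) e)) ^+ 2)%:E).
    apply/measurable_EFinP; apply: measurable_funX; apply: measurable_funB.
      exact: (uP e).1.
    exact: (md e n).1.
  have mv e : measurable_fun unitI (fun t => ((v e t - Im (dot (f n t) e)) ^+ 2)%:E).
    apply/measurable_EFinP; apply: measurable_funX; apply: measurable_funB.
      exact: (vP e).1.
    exact: (md e n).2.
  rewrite ge0_integral_sum; last 3 first.
  - exact: measurable_unitI.
  - by move=> e; apply: emeasurable_funD; [exact: mu|exact: mv].
  - by move=> e t _; rewrite -EFinD lee_fin addr_ge0 ?sqr_ge0.
  rewrite (_ : (2 * _)%:R * _ = \sum_(e <- onb) (2 * 4^-1 ^+ n)); last first.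
    by rewrite big_const_seq count_predT iter_addr_0 natrM -[RHS]mulr_natl; ring.
  rewrite -sumEFin big_seq [leRHS]big_seq; apply: lee_sum => e eo.
  rewrite ge0_integralD; last 5 first.
  - exact: measurable_unitI.
  - by move=> t _; rewrite lee_fin sqr_ge0.
  - exact: mu.
  - by move=> t _; rewrite lee_fin sqr_ge0.
  - exact: mv.
  by rewrite mulrDl mul1r EFinD; apply: leeD; [exact: (uP e).2|exact: (vP e).2].
(* The estimate for n = 0 gives [h - f 0] a finite integral; h itself is then recovered by adding
   [f 0]. *)
have Lhf : L2 (h - f 0%N).
  split.
    by rewrite -scaleN1r; exact: vmeasurableD mh (L2_measurable (L2Z _ (Lf 0%N))).
  by apply: le_lt_trans (hI 0%N) _; rewrite ltry.
have Lh : L2 h by rewrite -(subrK (f 0%N) h); exact: L2D.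
exists h => // n; rewrite -lee_fin -integral_hnorm2; [exact: hI|exact: L2B].
Qed.

Lemma L2_semi_hilbert : semi_hilbert L2 ip.
Proof.
split.
- by move=> a f g Lf Lg; apply: L2D => //; exact: L2Z.
- exact: L20.
- by move=> a f g h Lf Lg Lh; rewrite ipDl ?ipZl//; exact: L2Z.
- exact: ipC.
- exact: ip_ge0.
- move=> f Lf fC; have [h Lh hC] := L2_complete Lf fC.
  by exists h => //; exists (2 * size onb)%:R.
Qed.

End HilbertSpace.

(** * Uniqueness of Fourier coefficients *)

Section CirclePowers.
Variable R : realType.
Local Notation Re := (@complex.Re R).
Local Notation Im := (@complex.Im R).
Local Notation unitI := (@unitI R).
Implicit Types (t : R) (k : int).

Lemma sqmod_circ t : sqmod (circ t) = 1.
Proof. exact: cos2Dsin2. Qed.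

Lemma circJ t : circ t * Num.conj (circ t) = 1.
Proof.
by apply: eq_complexP; rewrite ?ReM ?ImM ReJ ImJ /=; [rewrite mulrN opprK -!expr2 cos2Dsin2|ring].
Qed.

Lemma circ_neq0 t : circ t != 0.
Proof. by apply/eqP => t0; have := circJ t; rewrite t0 mul0r => /eqP; rewrite eq_sym oner_eq0. Qed.

Lemma circV t : (circ t)^-1 = Num.conj (circ t).
Proof. by apply: (mulfI (circ_neq0 t)); rewrite mulfV ?circ_neq0// circJ. Qed.

Lemma sqmod_circX t k : sqmod (circ t ^ k) = 1.
Proof.
have sX n : sqmod (circ t ^+ n) = 1.
  elim: n => [|n IH]; last by rewrite exprS sqmodM IH sqmod_circ mulr1.
  by rewrite expr0 /sqmod /= expr0n /= addr0 expr1n.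
case: k => n; first exact: sX.
have := sqmodM (circ t ^+ n.+1) (circ t ^- n.+1).
by rewrite mulfV ?expf_neq0 ?circ_neq0// sX mul1r -(sX 0%N) expr0.
Qed.

Lemma circXJ t k : Num.conj (circ t ^ k) = circ t ^ (- k).
Proof.
have X n : Num.conj (circ t ^+ n) = circ t ^- n by rewrite rmorphXn /= -[(circ t)^*]circV exprVn.
case: k => n; first by rewrite -[circ t ^ n]/(circ t ^+ n) X exprnN.
by rewrite NegzE opprK -exprnN -X conjCK.
Qed.

Lemma measurable_trig (h : R -> R) : continuous h ->
  measurable_fun unitI (fun t => h (2 * pi * t)).
Proof.
move=> ch; apply: measurable_funTS; apply: continuous_measurable_fun.
move=> x; apply: continuous_comp; last exact: ch.
by apply: continuousM; [exact: cst_continuous|].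
Qed.

Lemma cmeasurable_circ k : cmeasurable (fun t => circ t ^ k).
Proof.
have m1 : cmeasurable (@circ R).
  by split; apply: measurable_trig; [exact: continuous_cos|exact: continuous_sin].
have mX n : cmeasurable (fun t => circ t ^+ n).
  elim: n => [|n IH]; first exact: cmeasurable_cst.
  by under eq_fun do rewrite exprS; exact: cmeasurableM.
case: k => n; first exact: mX.
rewrite (_ : (fun _ => _) = fun t => Num.conj (circ t ^+ n.+1)); first exact: cmeasurableJ.
by apply/funext => t; rewrite -[circ t ^+ _]/(circ t ^ (n.+1 : int)) circXJ NegzE.
Qed.

Lemma cintegrable_circM k (f : R -> R[i]) : cintegrable f ->
  cintegrable (fun t => circ t ^ k * f t).
Proof.
move=> If; have [i1 i2] := If.
apply: (@cintegrable_dom _ _ (fun t => `|Re (f t)| + `|Im (f t)|)).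
- by apply: cmeasurableM; [exact: cmeasurable_circ|exact: cintegrable_measurable].
- by apply: (integrableD _ (integrable_abse i1) (integrable_abse i2)); exact: measurable_unitI.
move=> t _; have := sqmod_circX t k; move: (circ t ^ k) (f t) => [a b] [c d] /=.
rewrite /sqmod /= => ab.
have a1 : `|a| <= 1.
  by rewrite -(@ler_pXn2r _ 2) ?nnegrE// real_normK ?num_real// expr1n -ab lerDl sqr_ge0.
have b1 : `|b| <= 1.
  by rewrite -(@ler_pXn2r _ 2) ?nnegrE// real_normK ?num_real// expr1n -ab lerDr sqr_ge0.
split.
  rewrite (le_trans (ler_normB _ _))// !normrM lerD//; exact: ler_piMl.
by rewrite (le_trans (ler_normD _ _))// !normrM addrC lerD//; exact: ler_piMl.
Qed.

End CirclePowers.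

(** * Polynomials approximating a step at 1/2 *)

Section StepApproximation.
Variable R : realType.
Implicit Types x y : R.

Lemma bernoulli_le x m : 0 <= x <= 1 -> 1 - x *+ m <= (1 - x) ^+ m.
Proof.
move=> /andP[x0 x1]; elim: m => [|m IH]; first by rewrite mulr0n expr0 subr0.
have x1' : 0 <= 1 - x by rewrite subr_ge0.
rewrite exprS; apply: le_trans (ler_wpM2l x1' IH).
have : 0 <= x * (x *+ m) by rewrite mulr_ge0// mulrn_wge0.
by rewrite mulrS mulrBl mul1r mulrBr mulr1; lra.
Qed.

Lemma bernoulli_ge x m : 0 <= x <= 1 -> (1 - x) ^+ m * (1 + x *+ m) <= 1.
Proof.
move=> /andP[x0 x1]; elim: m => [|m IH]; first by rewrite mulr0n expr0 addr0 mulr1.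
rewrite exprSr -mulrA; apply: le_trans IH; rewrite ler_wpM2l ?exprn_ge0 ?subr_ge0//.
have : 0 <= x * (x *+ m) by rewrite mulr_ge0// mulrn_wge0.
have := sqr_ge0 x; rewrite expr2 mulrS; move: (x *+ m) => y; rewrite !mulrDr !mulrBl; lra.
Qed.

(** These are the polynomials of Brosowski and Deutsch's proof of the Stone-Weierstrass theorem.
    Since 2^n y^n = (2y)^n, the two Bernoulli inequalities make them tend on [0, 1] to 1 for y < 1/2
    and to 0 for y > 1/2. *)
Definition step n y := (1 - y ^+ n) ^+ (2 ^ n).

Lemma step_itv n y : 0 <= y <= 1 -> 0 <= step n y <= 1.
Proof.
move=> /andP[y0 y1]; have p0 : 0 <= y ^+ n <= 1 by rewrite exprn_ge0// exprn_ile1.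
by rewrite /step exprn_ge0 ?exprn_ile1//; lra.
Qed.

Lemma step_cvg1 y : 0 <= y -> y < 2^-1 -> step n y @[n --> \oo] --> (1 : R).
Proof.
move=> y0 y1; have e0 : (2 * y) ^+ n @[n --> \oo] --> (0 : R).
  by apply: cvg_expr; rewrite ger0_norm; lra.
apply: (@squeeze_cvgr _ _ _ _ (fun n => 1 - (2 * y) ^+ n) (fun=> 1)).
- apply: nearW => n; have y01 : 0 <= y <= 1 by lra.
  have /andP[_ ->] := step_itv n y01; rewrite andbT.
  have p0 : 0 <= y ^+ n <= 1 by move: y01 => /andP[? ?]; rewrite exprn_ge0// exprn_ile1.
  by have := bernoulli_le (2 ^ n) p0; rewrite exprMn -(mulr_natl (y ^+ n)) natrX.
- by rewrite -[X in _ --> X]subr0; apply: cvgB => //; exact: cvg_cst.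
- exact: cvg_cst.
Qed.

Lemma step_cvg0 y : 2^-1 < y -> y <= 1 -> step n y @[n --> \oo] --> (0 : R).
Proof.
move=> y0 y1; have y2 : 0 < 2 * y by lra.
have e0 : ((2 * y)^-1) ^+ n @[n --> \oo] --> (0 : R).
  by apply: cvg_expr; rewrite ger0_norm ?invr_ge0 ?ltW// invf_lt1//; lra.
apply: (@squeeze_cvgr _ _ _ _ (fun=> 0) (fun n => ((2 * y)^-1) ^+ n)) => //.
  apply: nearW => n; have y01 : 0 <= y <= 1 by lra.
  have /andP[s0 _] := step_itv n y01; rewrite s0 /=.
  have p0 : 0 <= y ^+ n <= 1 by move: y01 => /andP[? ?]; rewrite exprn_ge0// exprn_ile1.
  have := bernoulli_ge (2 ^ n) p0; rewrite -/(step n y) -(mulr_natl (y ^+ n)) natrX -exprMn.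
  by rewrite exprVn -div1r ler_pdivlMr ?exprn_gt0//; apply: le_trans; rewrite ler_wpM2l// lerDr.
exact: cvg_cst.
Qed.
End StepApproximation.

Section Uniqueness.
Variable R : realType.
Local Notation Re := (@complex.Re R).
Local Notation Im := (@complex.Im R).
Local Notation leb := (@leb R).
Local Notation unitI := (@unitI R).

Section Annihilator.
Variable f : R -> R[i].

(** All frequencies k are included so that the condition survives multiplication by z^j, hence by
    any trigonometric polynomial. *)
Definition annihilates (p : R -> R[i]) := forall k : int,
  cintegrable (fun t => circ t ^ k * (p t * f t)) /\
  cint (fun t => circ t ^ k * (p t * f t)) = 0.

Lemma annihilatesP a p q : annihilates p -> annihilates q ->
  annihilates (fun t => a * p t + q t).
Proof.
move=> hp hq k; have [ip p0] := hp k; have [iq q0] := hq k.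
rewrite (_ : (fun t => _) = fun t => a * (circ t ^ k * (p t * f t)) + circ t ^ k * (q t * f t)).
  have iap := cintegrableZ a ip; split; first exact: cintegrableD.
  by rewrite cintD// cintZ// p0 q0 mulr0 addr0.
by apply/funext => t; ring.
Qed.

Lemma annihilatesX j p : annihilates p -> annihilates (fun t => circ t ^ j * p t).
Proof.
move=> hp k; rewrite (_ : (fun t => _) = fun t => circ t ^ (k + j) * (p t * f t)).
  exact: hp.
by apply/funext => t; rewrite expfzDr ?circ_neq0//; ring.
Qed.

(** The factor is [step n] of a trigonometric polynomial of degree one, multiplied out one factor at
    a time. *)
Lemma annihilates_step (a b c : R[i]) p n :
  annihilates p -> annihilates (fun t =>
    (1 - (a + b * circ t + c * circ t ^ (-1)) ^+ n) ^+ (2 ^ n) * p t).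
Proof.
pose y t := a + b * circ t + c * circ t ^ (-1).
have eqa q q' : q =1 q' -> annihilates q -> annihilates q' by move=> /funext ->.
have Y q : annihilates q -> annihilates (fun t => y t * q t).
  move=> hq; have h1 := annihilatesX 1 hq; have h2 := annihilatesX (-1) hq.
  have h0 : annihilates (fun t => 0 * q t + q t) by exact: annihilatesP.
  have z0 : annihilates (fun t => (-1) * q t + q t) by exact: annihilatesP.
  apply: eqa (annihilatesP a hq (annihilatesP b h1 (annihilatesP c h2 z0))) => t.
  by rewrite /y expr1z; ring.
have YX q m : annihilates q -> annihilates (fun t => y t ^+ m * q t).
  move=> hq; elim: m => [|m IH].
    by apply: eqa hq => t; rewrite expr0 mul1r.
  by apply: eqa (Y _ IH) => t; rewrite exprS mulrA.
move=> hp; elim: (2 ^ n)%N => [|m IH].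
  by apply: eqa hp => t; rewrite expr0 mul1r.
apply: eqa (annihilatesP (-1) (YX _ n IH) IH) => t.
by rewrite -/(y t) exprS; ring.
Qed.

End Annihilator.

(** In product form the sign, inside and outside the arc, is read off from sin > 0 on (0, pi). *)
Lemma cos_diff (u r : R) :
  cos (2 * pi * u) - cos (2 * pi * r) = 2 * (sin (pi * (r + u)) * sin (pi * (r - u))).
Proof.
have -> : 2 * pi * u = pi * (r + u) - pi * (r - u) by ring.
have -> : 2 * pi * r = pi * (r + u) + pi * (r - u) by ring.
by rewrite cosB cosD; ring.
Qed.

Lemma sin_pi_gt0 (x : R) : 0 < x < 1 -> 0 < sin (pi * x).
Proof.
move=> /andP[x0 x1]; apply: sin_gt0_pi.
by rewrite mulr_gt0 ?pi_gt0//= gtr_pMr ?pi_gt0.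
Qed.

Lemma cos_arc_in (c r t : R) : 0 < c - r -> c + r < 1 -> c - r < t -> t < c + r ->
  0 < cos (2 * pi * (t - c)) - cos (2 * pi * r).
Proof.
move=> c0 c1 t0 t1; rewrite cos_diff mulr_gt0// mulr_gt0// sin_pi_gt0//; lra.
Qed.

Lemma cos_arc_out (c r t : R) : 0 < r -> 0 < c - r -> c + r < 1 -> 0 <= t <= 1 ->
  t < c - r \/ c + r < t -> cos (2 * pi * (t - c)) - cos (2 * pi * r) < 0.
Proof.
move=> r0 c0 c1 /andP[t0 t1] [tc|tc]; rewrite cos_diff pmulr_rlt0//.
  have -> : r + (t - c) = - (c - r - t) by ring.
  rewrite mulrN sinN mulNr oppr_lt0 mulr_gt0// sin_pi_gt0//; lra.
have -> : r - (t - c) = - (t - c - r) by ring.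
rewrite mulrN sinN mulrN oppr_lt0 mulr_gt0// sin_pi_gt0//; lra.
Qed.

(* The trigonometric polynomial [y] takes values below [1/2] exactly on the arc
   of centre [c] and half-width [r], so [step n y] tends to its indicator. *)
Lemma arc_integral0 (f : R -> R[i]) (c r : R) : cintegrable f ->
  (forall k : int, cint (fun t => circ t ^ k * f t) = 0) ->
  0 < r -> 0 < c - r -> c + r < 1 ->
  \int[leb]_(t in `]c - r, c + r[) Re (f t) = 0 /\
  \int[leb]_(t in `]c - r, c + r[) Im (f t) = 0.
Proof.
move=> If f0 r0 c0 c1; have [i1 i2] := If.
(* A difference of two cosines is at most 2 in absolute value, so division by 4 keeps y in [0, 1],
   as [step] requires. *)
pose y t := 2^-1 - (cos (2 * pi * (t - c)) - cos (2 * pi * r)) / 4.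
have y01 t : 0 <= y t <= 1.
  rewrite /y; have := cos_le1 (2 * pi * (t - c)); have := cos_geN1 (2 * pi * (t - c)).
  have := cos_le1 (2 * pi * r); have := cos_geN1 (2 * pi * r); lra.
have ann1 : annihilates f (fun=> 1).
  move=> k; rewrite (_ : (fun t => _) = fun t => circ t ^ k * f t).
    by split; [exact: cintegrable_circM|exact: f0].
  by apply/funext => t; rewrite mul1r.
have my : measurable_fun unitI y.
  apply: measurable_funB; first exact: measurable_cst.
  apply: measurable_funM; last exact: measurable_cst.
  apply: measurable_funB; last exact: measurable_cst.
  under eq_fun do rewrite mulrBr.
  apply: (@measurable_trig _ (fun x => cos (x - 2 * pi * c))) => x.
  apply: continuous_comp; last exact: continuous_cos.
  by apply: continuousB => //; exact: cst_continuous.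
(* Euler's formula for cos (2 pi (t - c)) halves the factor 1/4, whence 1/8, and brings in the
   phases \bar{circ c} and circ c. *)
pose a0 : R[i] := (2^-1 + cos (2 * pi * r) / 4)%:C%C.
pose b0 : R[i] := (- 8^-1)%:C%C * Num.conj (circ c).
pose d0 : R[i] := (- 8^-1)%:C%C * circ c.
have yE t : (y t)%:C%C = a0 + b0 * circ t + d0 * circ t ^ (-1).
  rewrite -[circ t ^ (-1)]/((circ t)^-1) circV /y mulrBr cosB.
  by apply: eq_complexP; rewrite /a0 /b0 /d0 /circ /=; field.
have stepE n t : (step n (y t))%:C%C =
    (1 - (a0 + b0 * circ t + d0 * circ t ^ (-1)) ^+ n) ^+ (2 ^ n).
  by rewrite -yE /step rmorphXn rmorphB rmorph1 rmorphXn.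
have int0 n : \int[leb]_(t in unitI) (step n (y t) * Re (f t)) = 0 /\
    \int[leb]_(t in unitI) (step n (y t) * Im (f t)) = 0.
  have [_] := annihilates_step a0 b0 d0 n ann1 0.
  rewrite (_ : (fun t => _) = fun t => (step n (y t))%:C%C * f t); last first.
    by apply/funext => t; rewrite stepE expr0z mul1r mulr1.
  rewrite /cint => -[ha hb]; split; [rewrite -[RHS]ha|rewrite -[RHS]hb];
    by apply: eq_Rintegral => t _; case: (f t) => u v /=; ring.
have lim (g : R -> R) : leb.-integrable unitI (EFin \o g) ->
    (forall n, \int[leb]_(t in unitI) (step n (y t) * g t) = 0) ->
    \int[leb]_(t in `]c - r, c + r[) g t = 0.
  move=> ig g0; pose A : set R := `]c - r, c + r[%classic.
  have mA : measurable (A : set (measurableTypeR R)) by exact: measurable_itv.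
  have mI : measurable (unitI : set (measurableTypeR R)) by exact: measurable_unitI.
  have mg : measurable_fun unitI g by apply/measurable_EFinP; exact: measurable_int ig.
  have AI : A `<=` unitI.
    by move=> t; rewrite /A /Defs.unitI /= !in_itv /= => /andP[? ?]; lra.
  have mstep n : measurable_fun unitI (fun t => step n (y t)).
    by apply: measurable_funX; apply: measurable_funB; [exact: measurable_cst|exact: measurable_funX].
  have P1 n : measurable_fun unitI (fun t => (step n (y t) * g t)%:E).
    by apply/measurable_EFinP; apply: measurable_funM => //; exact: mstep.
  have P2 : measurable_fun unitI (fun t => ((g \_ A) t)%:E).
    apply/measurable_EFinP; apply/(measurable_restrict _ mA mI).
    by apply: measurable_funS mg => //; exact: subIsetr.
  (* At the endpoints of the arc y = 1/2, where [step n y] tends to 1/e rather than to 0 or 1; they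
     form a null set. *)
  have ne a : \forall t \ae leb, unitI t -> t <> a.
    exists [set a]; split; [exact: measurable_set1|exact: lebesgue_measure_set1|].
    by move=> t /= /not_implyP[_ /contrapT].
  have P3 : \forall t \ae leb, unitI t -> (step n (y t) * g t)%:E @[n --> \oo] --> ((g \_ A) t)%:E.
    apply: aeI_imp (aeI_and (ne (c - r)) (ne (c + r))) => t It [tm tp].
    apply: cvg_EFin; first exact: nearW.
    have /andP[y0 y1] := y01 t.
    have [tA|tA] := boolP (t \in A).
      rewrite /patch tA -[X in _ --> X]mul1r; apply: cvgM; last exact: cvg_cst.
      apply: step_cvg1 => //; move: tA; rewrite inE /A /= in_itv /= => /andP[? ?].
      have := @cos_arc_in c r t; rewrite /y; lra.
    rewrite /patch (negbTE tA) -[X in _ --> X](mul0r (g t)); apply: cvgM; last exact: cvg_cst.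
    apply: step_cvg0 => //; have out : t < c - r \/ c + r < t.
      move: tA; rewrite notin_setE /A /= in_itv /= => /negP.
      rewrite negb_and -!leNgt => /orP[h|h]; [left|right]; rewrite lt_def h andbT; apply/eqP => e.
        by apply: tm; rewrite e.
      by apply: tp; rewrite e.
    have := @cos_arc_out c r t r0 c0 c1 _ out; rewrite /y.
    by move: It; rewrite /Defs.unitI /= in_itv /= => It /(_ It); lra.
  have P4 := integrable_abse ig.
  have P5 : \forall t \ae leb, forall n, unitI t ->
      (`|(step n (y t) * g t)%:E| <= `|(g t)%:E|)%E.
    apply: aeW => t n _; rewrite lee_fin normrM; apply: ler_piMl => //.
    by have /andP[? ?] := step_itv n (y01 t); rewrite ger0_norm.
  have [_ _ lim] := @dominated_convergence _ _ _ leb unitI mI _ _ _ P1 P2 P3 P4 P5.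
  have zn n : (\int[leb]_(t in unitI) (step n (y t) * g t)%:E)%E = 0%E.
    have Isg : leb.-integrable unitI (fun t => (step n (y t) * g t)%:E).
      apply: (le_integrable mI (P1 n) _ P4) => t It /=.
      rewrite lee_fin normr_id normrM; apply: ler_piMl => //.
      by have /andP[? ?] := step_itv n (y01 t); rewrite ger0_norm.
    by rewrite -[LHS](fineK (integrable_fin_num mI Isg)) -[0%E]/(0%:E) -(g0 n).
  move: lim; under eq_fun do rewrite zn; move=> lim.
  have lim0 : (\int[leb]_(t in unitI) ((g \_ A) t)%:E)%E = 0%E.
    rewrite -(cvg_lim (@ereal_hausdorff R) lim).
    by apply: cvg_lim; [exact: ereal_hausdorff|exact: cvg_cst].
  have : \int[leb]_(t in unitI) (g \_ A) t = 0 by rewrite /Rintegral lim0.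
  by rewrite -Rintegral_mkcondr (setIidr AI).
have [z1 z2] : (forall n, \int[leb]_(t in unitI) (step n (y t) * Re (f t)) = 0) /\
    (forall n, \int[leb]_(t in unitI) (step n (y t) * Im (f t)) = 0).
  by split=> n; case: (int0 n).
by split; [exact: (lim (Re \o f))|exact: (lim (Im \o f))].
Qed.
End Uniqueness.

Section FourierUniqueness.
Variable R : realType.
Local Notation Re := (@complex.Re R).
Local Notation Im := (@complex.Im R).
Local Notation leb := (@leb R).
Local Notation unitI := (@unitI R).

(** Let x in (0, 1) be a Lebesgue point. The mean of |g - g(x)| over a small ball around x is at
    least |g(x)|, as the mean of g there is 0; and it tends to 0 with the radius. *)
Lemma ae_eq0_of_arcs (g : R -> R) : leb.-integrable unitI (EFin \o g) ->
  (forall c r, 0 < r -> 0 < c - r -> c + r < 1 ->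
    \int[leb]_(t in `]c - r, c + r[) g t = 0) -> aeeq g (fun=> 0).
Proof.
(* Extension by 0, because Lebesgue differentiation is applied on the whole line. *)
move=> ig g0; pose g' := g \_ unitI.
have mI : measurable (unitI : set (measurableTypeR R)) by exact: measurable_unitI.
have ig' : leb.-integrable setT (EFin \o g').
  by rewrite /g' -restrict_EFin; apply/(integrable_mkcond _ mI).
have locg : locally_integrable setT g'.
  by apply: open_integrable_locally => //; exact: openT.
have ne a : \forall t \ae leb, unitI t -> t <> a.
  exists [set a]; split; [exact: measurable_set1|exact: lebesgue_measure_set1|].
  by move=> t /= /not_implyP[_ /contrapT].
have lp : aeI (fun t => lebesgue_pt g' t).
  have [A [mA A0 sA]] := lebesgue_differentiation locg.
  by exists A; split => // t h; apply: sA => lt; apply: h => _.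
apply: aeI_imp (aeI_and lp (aeI_and (ne 0) (ne 1))) => x Ix [xlp [x0 x1]].
have {x0 x1}xI : 0 < x < 1.
  move: Ix; rewrite /Defs.unitI /= in_itv /= => /andP[? ?].
  apply/andP; split; rewrite lt_neqAle; apply/andP; split => //; apply/eqP => //.
  exact: nesym.
have g'x : g' x = g x by rewrite /g' /patch mem_set.
have key r : 0 < r -> r < x -> r < 1 - x -> (`|g x|%:E <= davg g' x r)%E.
  move=> r0 rx r1x.
  pose B := ball x r.
  have BE : B = `]x - r, x + r[%classic by rewrite /B ball_itv.
  have mB : measurable (B : set (measurableTypeR R)) by exact: measurable_ball.
  have BI : B `<=` unitI.
    by move=> t; rewrite BE /Defs.unitI /= !in_itv /= => /andP[? ?]; lra.
  have iB : leb.-integrable B (EFin \o g') by exact: integrableS ig'.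
  have lB : leb B = (r *+ 2)%:E by exact: lebesgue_measure_ball (ltW r0).
  have icst : leb.-integrable B (EFin \o (fun=> g' x)).
    apply/integrableP; split; first exact: measurable_cst.
    have -> : (fun t => `|(EFin \o (fun=> g' x)) t|%E) = cst (`|g' x|%:E : \bar R) by [].
    by rewrite integral_cst// lB -EFinM ltry.
  have ih : leb.-integrable B (fun t => (g' t - g' x)%:E).
    by apply: (integrableB mB iB icst).
  have Ih : (\int[leb]_(t in B) (g' t - g' x)%:E)%E = (- (g x * (r *+ 2)))%:E.
    rewrite -[LHS](fineK (integrable_fin_num mB ih)); congr EFin.
    rewrite -[LHS]/(\int[leb]_(t in B) (g' t - g' x)) RintegralB//.
    have -> : \int[leb]_(t in B) g' t = 0.
      have [h1 h2] : 0 < x - r /\ x + r < 1 by split; lra.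
      rewrite -(g0 x r r0 h1 h2) BE; apply: eq_Rintegral => t; rewrite -BE inE => Bt.
      by rewrite /g' /patch mem_set//; exact: BI.
    by rewrite sub0r Rintegral_cst// lB /= g'x.
  rewrite /davg /iavg -/B.
  have -> : ((lebesgue_measure B)^-1 = ((r *+ 2)^-1)%:E :> \bar R)%E.
    by rewrite [lebesgue_measure B]lB inver ifF//; apply/negbTE; rewrite mulrn_eq0 /= gt_eqF.
  have := le_abse_integral leb mB (measurable_int _ ih); rewrite Ih => le1.
  apply: (@le_trans _ _ (((r *+ 2)^-1)%:E * `|(- (g x * (r *+ 2)))%:E|)%E).
    rewrite /= -EFinM lee_fin normrN normrM (ger0_norm (mulrn_wge0 _ (ltW r0))).
    by rewrite mulrCA mulVf ?mulr1// mulrn_eq0 /= gt_eqF.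
  by apply: lee_wpmul2l; [rewrite lee_fin invr_ge0 mulrn_wge0// ltW|exact: le1].
have : (`|g x|%:E <= 0 :> \bar R)%E.
  apply: (cvge_ge _ xlp); near=> r; apply: key; near: r.
  - exact: nbhs_right_gt.
  - by apply: nbhs_right_lt; case/andP: xI.
  - by apply: nbhs_right_lt; case/andP: xI => _; rewrite subr_gt0.
by rewrite lee_fin normr_le0 => /eqP.
Unshelve. all: by end_near. Qed.

Lemma fourier_unique (f : R -> R[i]) : cintegrable f ->
  (forall k : int, cint (fun t => circ t ^ k * f t) = 0) -> aeeq f (fun=> 0).
Proof.
move=> If f0; have [i1 i2] := If.
have h1 : aeeq (Re \o f) (fun=> 0).
  by apply: ae_eq0_of_arcs => // c r r0 c0 c1; have [] := arc_integral0 If f0 r0 c0 c1.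
have h2 : aeeq (Im \o f) (fun=> 0).
  by apply: ae_eq0_of_arcs => // c r r0 c0 c1; have [] := arc_integral0 If f0 r0 c0 c1.
by apply: aeI_imp (aeI_and h1 h2) => t _ [] /= ? ?; exact: eq_complexP.
Qed.

End FourierUniqueness.

(** * Model spaces of inner functions *)

Section ConcreteShift.
Variables (R : realType) (H : vectType R[i]) (dot : {dot H for Num.conj}).
Local Notation onb := (onb dot).
Local Notation Re := (@complex.Re R).
Local Notation Im := (@complex.Im R).
Local Notation leb := (@leb R).
Local Notation unitI := (@unitI R).
Local Notation L2 := (L2 dot).
Local Notation ip := (ip dot).
Implicit Types f g : R -> H.

Definition shiftU f : R -> H := fun t => circ t *: f t.
Definition shiftW f : R -> H := fun t => Num.conj (circ t) *: f t.
Definition cstH (x : H) : R -> H := fun=> x.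

Lemma circD (s t : R) : circ (s + t) = circ s * circ t.
Proof.
by rewrite /circ mulrDr cosD sinD; apply: eq_complexP; rewrite /=; ring.
Qed.

Lemma circX n (t : R) : circ t ^+ n = circ (n%:R * t).
Proof.
elim: n => [|n IH]; first by rewrite mul0r expr0 /circ mulr0 cos0 sin0.
by rewrite exprS IH -circD -natr1 mulrDl mul1r addrC.
Qed.

Lemma Rintegral_FTC (F h : R -> R) : continuous h ->
  (forall x : R, is_derive x (1 : R) F (h x)) -> \int[leb]_(t in unitI) h t = F 1 - F 0.
Proof.
move=> ch dF; rewrite /Rintegral (@continuous_FTC2 _ h F)//.
- exact: continuous_subspaceT.
- split.
  + by move=> x _; apply: ex_derive.
  + apply: cvg_at_right_filter; apply: differentiable_continuous; apply/derivable1_diffP.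
    exact: ex_derive.
  + apply: cvg_at_left_filter; apply: differentiable_continuous; apply/derivable1_diffP.
    exact: ex_derive.
- by move=> x _; rewrite derive1E; apply: derive_val.
Qed.

Lemma cint_circ n : cint (fun t : R => circ t ^+ n.+1) = 0.
Proof.
pose w : R := 2 * pi * n.+1%:R.
have w0 : w != 0 by rewrite !mulf_neq0// ?pnatr_eq0// gt_eqF// pi_gt0.
have cw (h : R -> R) : continuous h -> continuous (fun t => h (w * t)).
  move=> ch x; apply: continuous_comp; last exact: ch.
  by apply: continuousM; [exact: cst_continuous|].
have E t : circ t ^+ n.+1 = Complex (cos (w * t)) (sin (w * t)).
  by rewrite circX /circ mulrA.
have wE : w = 0 + (pi *+ 2) *+ n.+1 by rewrite add0r /w mulr_natr -(mulr_natl pi 2).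
have c1 : cos w = 1 by rewrite wE (periodicn (@cosD2pi R)) cos0.
have s1 : sin w = 0 by rewrite wE (periodicn (@sinD2pi R)) sin0.
have dw (x : R) : is_derive x (1 : R) (fun t => w * t) w.
  by apply: is_derive_eq; rewrite ?scaler1 ?mulr1.
have D1 (x : R) : is_derive x (1 : R) (fun t => w^-1 * sin (w * t)) (cos (w * x)).
  have := is_deriveZ w^-1 (is_derive1_comp (is_derive_sin (w * x)) (dw x)).
  have e : w^-1 * (cos (w * x) * w) = cos (w * x) by rewrite mulrCA mulVf// mulr1.
  by move=> d; rewrite -[X in is_derive _ _ _ X]e; exact: d.
have D2 (x : R) : is_derive x (1 : R) (fun t => - w^-1 * cos (w * t)) (sin (w * x)).
  have := is_deriveZ (- w^-1) (is_derive1_comp (is_derive_cos (w * x)) (dw x)).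
  have e : - w^-1 * (- sin (w * x) * w) = sin (w * x).
    by rewrite mulNr mulNr mulrN opprK mulrCA mulVf// mulr1.
  by move=> d; rewrite -[X in is_derive _ _ _ X]e; exact: d.
apply: eq_complexP; rewrite /cint /=; under eq_Rintegral do rewrite E /=.
  rewrite (Rintegral_FTC (cw _ (@continuous_cos R)) D1).
  by rewrite mulr0 mulr1 s1 sin0 subrr.
rewrite (Rintegral_FTC (cw _ (@continuous_sin R)) D2).
by rewrite mulr0 mulr1 c1 cos0 subrr.
Qed.

Lemma iter_shiftU n f : iter n shiftU f = fun t => circ t ^+ n *: f t.
Proof.
elim: n => [|n IH]; first by apply/funext => t; rewrite /= scale1r.
by rewrite iterS IH; apply/funext => t; rewrite /shiftU scalerA exprS.
Qed.

Lemma iter_shiftW n f : iter n shiftW f = fun t => Num.conj (circ t ^+ n) *: f t.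
Proof.
elim: n => [|n IH]; first by apply/funext => t; rewrite /= rmorph1 scale1r.
by rewrite iterS IH; apply/funext => t; rewrite /shiftW scalerA exprS rmorphM.
Qed.

Lemma cint_cst (c : R[i]) : cint (fun=> c) = c.
Proof.
apply: eq_complexP; rewrite /cint /= Rintegral_cst ?leb_unitI ?mulr1//;
  exact: measurable_unitI.
Qed.

Lemma cintegrable_cst (c : R[i]) : cintegrable (fun=> c).
Proof. by split; exact: integrable_cst_unitI. Qed.

Lemma ip_circX f k x : ip f (fun t => circ t ^ k *: x) = cint (fun t => circ t ^ (- k) * dot (f t) x).
Proof. by apply: eq_cint => t _; rewrite linearZr_LR /= circXJ. Qed.

Lemma aeI_seq (I : eqType) (s : seq I) (P : I -> R -> Prop) :
  (forall i, i \in s -> aeI (P i)) -> aeI (fun t => forall i, i \in s -> P i t).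
Proof.
elim: s => [|i s IH] h; first exact: aeI_all.
have h1 : aeI (P i) by apply: h; rewrite mem_head.
have h2 : aeI (fun t => forall j, j \in s -> P j t).
  by apply: IH => j js; apply: h; rewrite in_cons js orbT.
apply: aeI_imp (aeI_and h1 h2) => t _ [p1 p2] j.
by rewrite in_cons => /orP[/eqP ->|/p2].
Qed.

Lemma ae_eq0_onb f : (forall e, e \in onb -> aeI (fun t => dot (f t) e = 0)) ->
  aeeq f (fun=> 0).
Proof.
move=> /aeI_seq; apply: aeI_imp => t _ f0.
by rewrite (onb_expansion dot (f t)) big_seq big1// => e eo; rewrite f0// scale0r.
Qed.

(** All fields are elementary computations except totality, the last one, which is [fourier_unique]
    applied to each coordinate in [onb]. *)
Lemma shift_bilateral : bilateral_shift dot L2 ip shiftU shiftW cstH.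
Proof.
have Usc f t : (shiftU f) t = circ t *: f t by [].
have mc : cmeasurable (@circ R) by have := cmeasurable_circ R 1.
have bc : aeI (fun t : R => Re (circ t) ^+ 2 + Im (circ t) ^+ 2 <= 1).
  by apply: aeI_all => t _; rewrite -[X in X <= _]/(sqmod (circ t)) sqmod_circ.
have bcJ : aeI (fun t : R => Re (Num.conj (circ t)) ^+ 2 + Im (Num.conj (circ t)) ^+ 2 <= 1).
  by apply: aeI_imp bc => t _; rewrite ReJ ImJ sqrrN.
split.
- move=> a f g; apply/funext => t.
  rewrite -[LHS]/(circ t *: (a *: f t + g t)) -[RHS]/(a *: (circ t *: f t) + circ t *: g t).
  by rewrite scalerDr !scalerA mulrC.
- move=> a f g; apply/funext => t; set w := Num.conj (circ t).
  rewrite -[LHS]/(w *: (a *: f t + g t)) -[RHS]/(a *: (w *: f t) + w *: g t).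
  by rewrite scalerDr !scalerA mulrC.
- by move=> f; apply/funext => t; rewrite /shiftU /shiftW scalerA circJ scale1r.
- by move=> f; apply/funext => t; rewrite /shiftU /shiftW scalerA mulrC circJ scale1r.
- by move=> f; exact: L2_scale mc bc.
- by move=> f; exact: L2_scale (cmeasurableJ mc) bcJ.
- move=> f g _ _; apply: eq_cint => t _.
  by rewrite /shiftU linearZl_LR linearZr_LR /= mulrA circJ mul1r.
- by move=> a x y; apply/funext.
- exact: L2_cst.
- by move=> x y; rewrite /Defs.ip /cstH cint_cst.
- move=> n x y; rewrite iter_shiftU.
  rewrite (_ : ip _ _ = cint (fun t => dot x y * circ t ^+ n.+1)).
    rewrite cintZ ?cint_circ ?mulr0//.
    have := cintegrable_circM n.+1 (cintegrable_cst 1).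
    by under eq_fun do rewrite mulr1.
  by apply: eq_cint => t _; rewrite linearZl_LR mulrC.
- move=> f Lf fU fW.
  have f0 : aeeq f (fun=> 0).
    apply: ae_eq0_onb => e eo; apply: fourier_unique.
      by apply: (L2_dot Lf); exact: L2_cst.
    move=> k; have := ip_circX f (- k) e; rewrite opprK => <-.
    (* Integration against circ t ^ k gives the coefficient of index -k: [fW] covers positive k and
       [fU] the others. The instance at [n.-1] serves only for n > 0. *)
    case: k => n.
      have := fW n.-1 e; have := fU 0%N e; rewrite iter_shiftW.
      case: n => [|n] h1 h2.
        by rewrite -[RHS]h1 /=; congr ip; apply/funext => t; rewrite oppr0 expr0z scale1r.
      rewrite -[RHS]h2; congr ip; apply/funext => t; congr (_ *: _).
      by rewrite -circXJ.
    rewrite -[RHS](fU n.+1 e) iter_shiftU NegzE opprK.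
    by congr ip; apply/funext.
  by rewrite (ae_eq_ip Lf (L20 dot) Lf (L20 dot) f0 f0) (sh_ip0l (L2_semi_hilbert dot) (L20 dot)).
Qed.

Lemma scalar_riesz (phi : H -> R[i]) : scalar phi -> phi = fun x => dot x (riesz dot phi).
Proof. by move=> sphi; apply/funext => x; rewrite dot_riesz. Qed.

Lemma L2_scalar (phi : H -> R[i]) f : scalar phi -> L2 f -> cintegrable (fun t => phi (f t)).
Proof.
by move=> /scalar_riesz -> Lf; exact: (L2_dot Lf (L2_cst dot (riesz dot phi))).
Qed.

Lemma L2_circX k f : L2 f -> L2 (fun t => circ t ^ k *: f t).
Proof.
apply: (@L2_scale _ _ _ _ 1); first exact: cmeasurable_circ.
by apply: aeI_all => t _; rewrite -[X in X <= _]/(sqmod (circ t ^ k)) sqmod_circX.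
Qed.

Lemma scalar_fourier (phi : H -> R[i]) f k : scalar phi -> L2 f ->
  phi (fourier f k) = cint (fun t => circ t ^ (- k) * phi (f t)).
Proof.
move=> sphi Lf; rewrite /fourier scalar_vint//; last first.
  by move=> psi spsi; apply: L2_scalar spsi _; exact: L2_circX.
apply: eq_cint => t _; have := sphi (circ t ^ (- k)) (f t) 0.
by rewrite scalar0// !addr0.
Qed.

Lemma dot_fourier f k x : L2 f -> dot (fourier f k) x = ip f (fun t => circ t ^ k *: x).
Proof. by move=> Lf; rewrite (scalar_fourier k (scalar_dotl dot x) Lf) ip_circX. Qed.

Lemma H2P f : H2 dot f <-> hardy L2 ip shiftW cstH f.
Proof.
have bwE n x : comonomial shiftW cstH n x = fun t => circ t ^ (- n.+1%:Z) *: x.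
  by rewrite /comonomial iter_shiftW; apply/funext => t; rewrite -circXJ.
split=> -[Lf f0]; split=> //.
  by move=> n x; rewrite bwE -dot_fourier// f0 ?linear0l// oppr_lt0.
case=> n // _; apply: (dot_inj (dot := dot)) => x.
by rewrite dot_fourier// linear0l NegzE -bwE f0.
Qed.

End ConcreteShift.

Section ConcreteInner.
Variables (R : realType) (H : vectType R[i]) (dot : {dot H for Num.conj}).
Local Notation hsL2 := (@Defs.L2 R 'End(H) (hs dot)).
Local Notation onb := (onb dot).
Local Notation L2 := (L2 dot).
Local Notation ip := (ip dot).
Local Notation U := (@shiftU R H).
Local Notation W := (@shiftW R H).
Local Notation k := (@cstH R H).
Implicit Types (f g : R -> H) (T : 'End(H)).

Lemma L2_le (E : vectType R[i]) (dotE : {dot E for Num.conj}) f (g : R -> E) (C : R) :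
  vmeasurable f -> Defs.L2 dotE g ->
  aeI (fun t => hnorm dot (f t) ^+ 2 <= C * hnorm dotE (g t) ^+ 2) -> L2 f.
Proof.
move=> mf Lg fg; apply: (L2_dom mf _ fg).
by apply: (integrableZl _ C (L2_integrable Lg)) => //; exact: measurable_unitI.
Qed.

Lemma dot_CauchySchwarz x y : sqmod (dot x y) <= hnorm dot x ^+ 2 * hnorm dot y ^+ 2.
Proof.
have [+ _] := CauchySchwarz dot x y; rewrite -add_Re2_Im2 !dot_hnorm.
by rewrite lecE /= !mul0r !mulr0 subr0 addr0 eqxx.
Qed.

Lemma vmeasurable_sum I (r : seq I) (F : I -> R -> H) :
  (forall i, vmeasurable (F i)) -> vmeasurable (fun t => \sum_(i <- r) F i t).
Proof.
move=> mF; elim: r => [|i r IH].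
  by under eq_fun do rewrite big_nil; exact: vmeasurable_cst.
by under eq_fun do rewrite big_cons; exact: vmeasurableD.
Qed.

Lemma vmeasurable_app (Phi : R -> 'End(H)) f : vmeasurable Phi -> vmeasurable f ->
  vmeasurable (mulop Phi f).
Proof.
move=> mPhi mf; rewrite (_ : mulop Phi f = fun t => \sum_(e <- onb) dot (f t) e *: Phi t e).
  apply: vmeasurable_sum => e; apply: vmeasurableZ.
    exact: vmeasurable_scalar (scalar_dotl dot e) mf.
  move=> i; apply: (vmeasurable_scalar (phi := fun T => coord (vbasis (@fullv _ H)) i (T e))) => //.
  by move=> a S T; rewrite add_lfunE scale_lfunE linearP.
apply/funext => t; rewrite /mulop {1}(onb_expansion dot (f t)) linear_sum.
by apply: eq_bigr => e _; rewrite linearZ.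
Qed.

(** T^* y, written in the orthonormal basis so that the measurability of t |-> Theta(t)^* f(t)
    reduces to that of scalar products. *)
Definition adjv T y : H := \sum_(e <- onb) dot y (T e) *: e.

Lemma dot_adjv T x y : dot (T x) y = dot x (adjv T y).
Proof.
rewrite /adjv linear_sumr {1}(onb_expansion dot x) linear_sum linear_sumlz.
apply: eq_bigr => e _; rewrite linearZ linearZl_LR linearZr_LR /= mulrC.
by rewrite [in RHS](dotC dot y) conjCK.
Qed.

Lemma vmeasurable_apply (Phi : R -> 'End(H)) x : vmeasurable Phi ->
  vmeasurable (fun t => Phi t x).
Proof. by move=> mPhi; exact: (vmeasurable_app mPhi (vmeasurable_cst x)). Qed.

Lemma vmeasurable_adj (Phi : R -> 'End(H)) f : vmeasurable Phi -> vmeasurable f ->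
  vmeasurable (fun t => adjv (Phi t) (f t)).
Proof.
move=> mPhi mf; apply: vmeasurable_sum => e; apply: vmeasurableZ; last exact: vmeasurable_cst.
exact: cmeasurable_dot (vmeasurable_apply e mPhi).
Qed.

Variable Theta : R -> 'End(H).
Hypothesis inner : inner_function dot Theta.

Let M := mulop Theta.
Let N f : R -> H := fun t => adjv (Theta t) (f t).

Lemma inner_L2 : hsL2 Theta. Proof. by case: inner => -[[]]. Qed.

(** Surjectivity gives Theta Theta^* = 1: if y = Theta x, then Theta^* y = x because Theta is
    isometric. *)
Lemma inner_ae : aeI (fun t => isometry dot dot (Theta t) /\
  (forall y, Theta t (adjv (Theta t) y) = y) ).
Proof.
have [_ ae] := inner; apply: aeI_imp ae => t _ [iso full]; split=> // y.
have : y \in limg (Theta t) by rewrite full memvf.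
case/memv_imgP => x _ ->; congr (Theta t _).
by apply: (dot_inj (dot := dot)) => z; rewrite (dotC dot) -dot_adjv iso -(dotC dot).
Qed.

Lemma hnorm_iso T x : isometry dot dot T -> hnorm dot (T x) = hnorm dot x.
Proof. by move=> iso; rewrite /hnorm iso. Qed.

Lemma mult_L2 f : L2 f -> L2 (M f).
Proof.
move=> Lf; apply: (@L2_le _ dot _ f 1) => //.
  by apply: vmeasurable_app; [exact: L2_measurable inner_L2|exact: L2_measurable Lf].
by apply: aeI_imp inner_ae => t _ [iso _]; rewrite mul1r hnorm_iso.
Qed.

Lemma adj_L2 f : L2 f -> L2 (N f).
Proof.
move=> Lf; apply: (@L2_le _ dot _ f 1) => //.
  exact: vmeasurable_adj (L2_measurable inner_L2) (L2_measurable Lf).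
apply: aeI_imp inner_ae => t _ [iso full].
by rewrite mul1r -[in leRHS](full (f t)) hnorm_iso.
Qed.

Lemma inner_is_multiplier : inner_multiplier L2 ip U W k M N.
Proof.
split.
- by move=> a f g; apply/funext => t; rewrite /M /mulop linearP.
- exact: mult_L2.
- exact: adj_L2.
- by move=> f g _ _; apply: eq_cint => t _; rewrite /M /mulop dot_adjv.
- move=> f g Lf Lg; apply: ae_eq_cint.
  + exact: cmeasurable_dot (L2_measurable (mult_L2 Lf)) (L2_measurable (mult_L2 Lg)).
  + exact: cmeasurable_dot (L2_measurable Lf) (L2_measurable Lg).
  + by apply: aeI_imp inner_ae => t _ [iso _]; exact: iso.
- move=> f g Lf Lg; apply: ae_eq_cint.
  + exact: cmeasurable_dot (L2_measurable (adj_L2 Lf)) (L2_measurable (adj_L2 Lg)).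
  + exact: cmeasurable_dot (L2_measurable Lf) (L2_measurable Lg).
  + apply: aeI_imp inner_ae => t _ [iso full].
    by rewrite /N -iso !full.
- by move=> f; apply/funext => t; rewrite /M /mulop /shiftU linearZ.
- move=> n x y.
  have -> : ip (M (k x)) (comonomial W k n y) =
      cint (fun t => circ t ^ (- (- n.+1%:Z)) * dot (Theta t x) y).
    rewrite /comonomial iter_shiftW; apply: eq_cint => t _; rewrite linearZr_LR /= conjCK.
    by rewrite opprK.
  (* The negative Fourier coefficients of Theta vanish as operators; the functional T |-> <T x, y>
     turns this into the scalar statement. *)
  have sphi : scalar (fun T : 'End(H) => dot (T x) y).
    by move=> a S T; rewrite add_lfunE scale_lfunE linearPl.
  rewrite -(@scalar_fourier R 'End(H) (hs dot) _ _ (- n.+1%:Z) sphi inner_L2).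
  by have [[[_ f0] _] _] := inner; rewrite f0 ?zero_lfunE ?linear0l// oppr_lt0.
Qed.

Lemma model_spaceP f : model_space dot Theta f <-> model L2 ip W k M f.
Proof.
by split=> -[/H2P Hf fK]; split=> // g /H2P; exact: fK.
Qed.

(** At 0 the Cauchy kernel is 1, so the extension is the Fourier coefficient of index 0. *)
Lemma extension0 x : extension Theta 0 x = value0 dot ip U k M x.
Proof.
have -> : extension Theta 0 = fourier Theta 0.
  rewrite /extension /fourier /vint; apply: eq_bigr => i _; congr (_ *: _).
  by apply: eq_cint => t _; rewrite mul0r subr0 invr1 oppr0 expr0z.
have sphi y : scalar (fun T : 'End(H) => dot (T x) y).
  by move=> a S T; rewrite add_lfunE scale_lfunE linearPl.
apply: (dot_inj (dot := dot)) => y.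
rewrite (@scalar_fourier R 'End(H) (hs dot) _ _ 0 (sphi y) inner_L2).
rewrite (dot_constant_term (L2_semi_hilbert dot) (shift_bilateral dot)); last exact/mult_L2/L2_cst.
by apply: eq_cint => t _; rewrite oppr0 expr0z mul1r.
Qed.

End ConcreteInner.

Section ConcreteModel.
Variables (R : realType) (H : vectType R[i]) (dot : {dot H for Num.conj}).
Local Notation L2 := (L2 dot).
Local Notation ip := (ip dot).
Local Notation n2 := (sqnorm ip).
Local Notation U := (@shiftU R H).
Local Notation W := (@shiftW R H).
Local Notation k := (@cstH R H).
Local Notation sh := (L2_semi_hilbert dot).
Local Notation bs := (shift_bilateral dot).
Implicit Types (f g h p : R -> H).

Lemma sqnorm_ae f g : L2 f -> L2 g -> aeeq f g <-> n2 (f - g) = 0.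
Proof.
move=> Lf Lg; have Lfg := L2B Lf Lg; split=> [fg|fg0].
  have fg0 : aeeq (f - g) (fun=> 0).
    by apply: aeI_imp fg => t _ fgt; rewrite -[LHS]/(f t - g t) fgt subrr.
  by rewrite /sqnorm (ae_eq_ip Lfg (L20 dot) Lfg (L20 dot) fg0 fg0) (sh_ip0l sh (L20 dot)).
have : aeeq (f - g) 0 by apply: (ip_eq0 Lfg); rewrite (ip_sqnorm sh Lfg) fg0.
by apply: aeI_imp => t _ /eqP; rewrite -[(f - g) t]/(f t - g t) subr_eq0 => /eqP.
Qed.

Lemma L2norm_sqr f : L2 f -> L2norm dot f ^+ 2 = n2 f.
Proof. by move=> Lf; rewrite sqr_sqrtr//; exact: (sqnorm_ge0 sh). Qed.

Variable Theta : R -> 'End(H).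
Hypothesis inner : inner_function dot Theta.
Local Notation M := (mulop Theta).
Local Notation K := (model L2 ip W k M).
Local Notation S := (compression dot ip U k M).
Local Notation c := (defect_vector dot ip U k M).
Local Notation J := (defect_map dot ip U W k M).
Local Notation B := (backward_shift dot ip U W k).
Local Notation im := (inner_is_multiplier inner).
Local Notation P := (model_proj dot Theta).

Let KL f : K f -> L2 f. Proof. exact: model_L. Qed.
Let UL f : L2 f -> L2 (U f). Proof. exact: (bs_UL bs). Qed.
Let WL f : L2 f -> L2 (W f). Proof. exact: (bs_WL bs). Qed.

Lemma model_projP f : L2 f -> K (P f) /\ forall g, K g -> ip (f - P f) g = 0.
Proof.
move=> Lf; have [p [Kp fp]] := model_projection sh bs im Lf.
have [|Pf fPf] := @xgetPex _ (fun=> 0)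
  [set p | model_space dot Theta p /\
    forall g, model_space dot Theta g -> ip (fun t => f t - p t) g = 0].
  exists p; split; first exact/model_spaceP.
  by move=> g /model_spaceP; exact: fp.
split; first exact/model_spaceP.
by move=> g /model_spaceP; exact: fPf.
Qed.

Lemma model_proj_unique f p : L2 f -> K p -> (forall g, K g -> ip (f - p) g = 0) ->
  n2 (P f - p) = 0.
Proof.
move=> Lf Kp fp; have [KP fP] := model_projP Lf.
have Kd := modelB sh bs im KP Kp; have Ld := KL Kd.
have L1 := L2B Lf (KL KP); have L2' := L2B Lf (KL Kp).
have E : P f - p = (f - p) - (f - P f) by rewrite [RHS]addrC opprB addrA subrK.
by rewrite /sqnorm {1}E (sh_ipBl sh)// fp// fP// subrr.
Qed.

Lemma compressed_shiftE f : K f -> K (compressed_shift dot Theta f) /\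
  n2 (compressed_shift dot Theta f - S f) = 0.
Proof.
move=> Kf; have LU := UL (KL Kf); split; first by case: (model_projP LU).
apply: model_proj_unique => //; first exact: (model_compression sh bs im).
by move=> g Kg; exact: (compression_perp sh bs im).
Qed.

Lemma compressed_shift_adj_model h : L2 h -> K (compressed_shift_adj dot Theta h).
Proof. by move=> Lh; case: (model_projP (WL Lh)). Qed.

Lemma ip_compressed_shift_adj h g : K h -> K g ->
  ip (compressed_shift_adj dot Theta h) g = ip h (S g).
Proof.
move=> Kh Kg; have Lh := KL Kh; have Lg := KL Kg; have [KP hP] := model_projP (WL Lh).
have LS := KL (model_compression sh bs im Kg); have LUg := UL Lg; have LW := WL Lh.
have -> : ip (compressed_shift_adj dot Theta h) g = ip (W h) g.
  apply/eqP; rewrite eq_sym -subr_eq0 -(sh_ipBl sh LW (KL KP) Lg); apply/eqP.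
  exact: hP.
rewrite (ipWU bs Lh Lg); apply/eqP; rewrite -subr_eq0 -(sh_ipBr sh LUg LS Lh).
by rewrite (sh_ipC sh Lh (L2B LUg LS)) (compression_perp sh bs im Kg Kh) rmorph0.
Qed.

Lemma defect_mapE x : J x = fun t => Num.conj (circ t) *: (Theta t x - extension Theta 0 x).
Proof. by rewrite (extension0 inner). Qed.

Lemma DspaceP f : Dspace dot Theta f <-> L2 f /\ exists x, aeeq f (J x).
Proof. by split=> -[Lf [x fx]]; split=> //; exists x; move: fx; rewrite defect_mapE. Qed.

Lemma DspaceJ x : Dspace dot Theta (J x).
Proof.
apply/DspaceP; split; first exact/KL/(model_defect_map sh bs im).
by exists x; exact: aeI_all.
Qed.

Lemma Dspace_linear (a : R[i]) f g : Dspace dot Theta f -> Dspace dot Theta g ->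
  Dspace dot Theta (a *: f + g).
Proof.
move=> /DspaceP[Lf [x fx]] /DspaceP[Lg [y gy]]; apply/DspaceP.
split; first exact: (sh_P sh).
exists (a *: x + y); rewrite (defect_mapP sh bs im); apply: aeI_imp (aeI_and fx gy) => t _ [ft gt].
by rewrite -[LHS]/(a *: f t + g t) ft gt.
Qed.

Lemma ae_model f g : L2 f -> K g -> aeeq f g -> K f.
Proof.
move=> Lf [[Lg g0] gK] fg; have ipfg h : L2 h -> ip f h = ip g h.
  by move=> Lh; apply: (ae_eq_ip Lf Lg Lh Lh fg); exact: aeI_all.
split; first by split=> // n x; rewrite ipfg// ; exact: (bwL bs).
by move=> h Hh; rewrite ipfg ?gK//; apply: (im_ML im); case: Hh.
Qed.

Lemma Dspace_model f : Dspace dot Theta f -> K f.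
Proof. by move=> /DspaceP[Lf [x fx]]; apply: (ae_model Lf _ fx); exact: (model_defect_map sh bs im). Qed.

(** The projections chosen inside [Dop] agree up to null functions with the explicit [S] and [B],
    since \bar z S f - B (S f) is orthogonal to H^2. The rest is [defect]. *)
Lemma DopE f : K f -> K (Dop dot Theta f) /\ aeeq (Dop dot Theta f) (J (c f)).
Proof.
move=> Kf; have Lf := KL Kf; have [Kcs csS] := compressed_shiftE Kf; have Lcs := KL Kcs.
have KS := model_compression sh bs im Kf; have LS := KL KS; have KB := model_backward_shift sh bs im KS.
have KJ := model_defect_map sh bs im (c f).
have LB := KL KB; have Ka := compressed_shift_adj_model Lcs; have LWc := WL Lcs; have LWS := WL LS.
have h0 : n2 (compressed_shift_adj dot Theta (compressed_shift dot Theta f) - B (S f)) = 0.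
  apply: (model_proj_unique LWc KB) => g Kg; have Lg := KL Kg.
  have -> : ip (W (compressed_shift dot Theta f) - B (S f)) g = ip (W (S f) - B (S f)) g.
    rewrite (sh_ipBl sh LWc LB Lg) (sh_ipBl sh LWS LB Lg); congr (_ - _).
    rewrite (ipWU bs Lcs Lg) (ipWU bs LS Lg).
    exact: (sqnorm0_subl sh Lcs LS (UL Lg) csS).
  by apply: (backward_shift_perp sh bs LS); exact: model_hardy Kg.
have KD : K (Dop dot Theta f) by exact: (modelB sh bs im Kf Ka).
split=> //; apply/(sqnorm_ae (KL KD) (KL KJ)).
rewrite -(defect sh bs im Kf) -[Dop dot Theta f]/(f - _).
rewrite opprB addrC addrA subrK.
by rewrite (sqnormBC sh LB (KL Ka)).
Qed.

Lemma Dspace_Dop f : K f -> Dspace dot Theta (Dop dot Theta f).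
Proof. by move=> Kf; have [KD DJ] := DopE Kf; apply/DspaceP; split; [exact: KL|exists (c f)]. Qed.

(** |J x|^2 = |x|^2 - |Theta(0) x|^2 >= (1 - q^2) |x|^2, where q is the norm of Theta(0) and q < 1
    by purity. *)
Lemma defect_map_bounded_below : is_pure dot Theta ->
  exists2 d : R, 0 < d & forall x, d * hnorm dot x ^+ 2 <= n2 (J x).
Proof.
move=> pure; pose T : 'End(H) := extension Theta 0; pose q := opnorm dot T.
have nJ x : n2 (J x) = hnorm dot x ^+ 2 - hnorm dot (T x) ^+ 2.
  by rewrite (sqnorm_defect_map sh bs im) /T (extension0 inner) !hnorm_sqr.
have T1 x : hnorm dot (T x) <= hnorm dot x.
  rewrite -(@ler_pXn2r _ 2) ?nnegrE ?hnorm_ge0// -subr_ge0 -nJ.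
  exact/(sqnorm_ge0 sh)/KL/(model_defect_map sh bs im).
(* [opnorm] is a supremum in R and bounds |Theta(0) x| only once the set is known to be bounded; the
   bound 1 comes from |J x|^2 >= 0. *)
have ub : has_ubound [set hnorm dot (T x) | x in [set x | hnorm dot x <= 1]].
  by exists 1 => _ [x x1 <-]; exact: le_trans (T1 x) x1.
have Tq x : hnorm dot x <= 1 -> hnorm dot (T x) <= q.
  by move=> x1; apply: ub_le_sup => //; exists x.
have q0 : 0 <= q.
  apply: le_trans (Tq 0 _); first exact: hnorm_ge0.
  by rewrite /hnorm linear0l /= sqrtr0.
have q1 : q < 1 by exact: pure.
exists (1 - q ^+ 2); first by rewrite subr_gt0 expr_lt1.
move=> x; rewrite nJ mulrBl mul1r lerD2l lerN2.
have [x0|x0] := eqVneq (hnorm dot x) 0.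
  by rewrite x0 expr0n mulr0 (le_trans _ (lexx 0))// (hnorm_eq0 x0) linear0 /hnorm linear0l /= sqrtr0 expr0n.
have xp : 0 < hnorm dot x by rewrite lt_def x0 hnorm_ge0.
pose a : R[i] := (hnorm dot x)^-1%:C%C.
have na y : hnorm dot (a *: y) ^+ 2 = (hnorm dot x) ^- 2 * hnorm dot y ^+ 2.
  by rewrite hnormZ /= expr0n /= addr0 exprVn.
have a1 : hnorm dot (a *: x) <= 1.
  by rewrite -(@ler_pXn2r _ 2) ?nnegrE ?hnorm_ge0// na mulVf ?expf_neq0// expr1n.
have aT : T (a *: x) = a *: T x by rewrite linearZ.
have : hnorm dot (T (a *: x)) ^+ 2 <= q ^+ 2.
  by rewrite ler_pXn2r ?nnegrE ?hnorm_ge0//; exact: Tq.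
rewrite aT na.
by rewrite mulrC ler_pdivrMr ?exprn_gt0.
Qed.

End ConcreteModel.

(** * The defect equation *)

Section BoundedOperators.
Variables (R : realType) (H : vectType R[i]) (dot : {dot H for Num.conj}).
Local Notation L2 := (L2 dot).
Local Notation ip := (ip dot).
Local Notation n2 := (sqnorm ip).
Local Notation sh := (L2_semi_hilbert dot).
Variables (V W : set (R -> H)) (A : (R -> H) -> R -> H).
Hypothesis VL : forall f, V f -> L2 f.
Hypothesis WL : forall f, W f -> L2 f.
Hypothesis bA : bounded_operator dot V W A.
Implicit Types f g h : R -> H.

Lemma bounded_operator_L2 f : V f -> L2 (A f).
Proof. by case: bA => VW _ _ _ Vf; exact/WL/VW. Qed.

Lemma bounded_operator_ip (a : R[i]) f g h : V (a *: f + g) -> V f -> V g -> L2 h ->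
  ip (A (a *: f + g)) h = a * ip (A f) h + ip (A g) h.
Proof.
case: bA => _ _ Alin _ Vfg Vf Vg Lh.
have Lf := bounded_operator_L2 Vf; have Lg := bounded_operator_L2 Vg.
have Laf := sh_Z sh a Lf.
rewrite -(sh_ipZl sh a Lf Lh) -(sh_ipDl sh Laf Lg Lh).
apply: (ae_eq_ip (bounded_operator_L2 Vfg) (sh_D sh Laf Lg) Lh Lh (Alin a f g Vf Vg)).
exact: aeI_all.
Qed.

Lemma bounded_operator_ae f g h : V f -> V g -> aeeq f g -> L2 h -> ip (A f) h = ip (A g) h.
Proof.
case: bA => _ Aae _ _ Vf Vg fg Lh.
apply: (ae_eq_ip (bounded_operator_L2 Vf) (bounded_operator_L2 Vg) Lh Lh (Aae _ _ Vf Vg fg)).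
exact: aeI_all.
Qed.

Lemma bounded_operator_sqnorm :
  exists2 C : R, 0 <= C & forall f, V f -> n2 (A f) <= C * n2 f.
Proof.
case: bA => _ _ _ [M AM]; exists (M ^+ 2); first exact: sqr_ge0.
move=> f Vf; have Lf := VL Vf; have LA := bounded_operator_L2 Vf.
rewrite -(L2norm_sqr LA) -(L2norm_sqr Lf) -exprMn ler_pXn2r ?nnegrE ?AM ?sqrtr_ge0//.
by apply: le_trans (AM _ Vf); exact: sqrtr_ge0.
Qed.

End BoundedOperators.

Section DefectSpace.
Variables (R : realType) (H : vectType R[i]) (dot : {dot H for Num.conj}).
Local Notation onb := (onb dot).
Local Notation L2 := (L2 dot).
Local Notation ip := (ip dot).
Local Notation n2 := (sqnorm ip).
Local Notation U := (@shiftU R H).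
Local Notation W := (@shiftW R H).
Local Notation k := (@cstH R H).
Local Notation sh := (L2_semi_hilbert dot).
Local Notation bs := (shift_bilateral dot).
Implicit Types (f g h p : R -> H).

Lemma linear_sqnorm_bound (E : H -> R -> H) : (forall x, L2 (E x)) ->
  (forall a x y, E (a *: x + y) = a *: E x + E y) ->
  exists2 C : R, 0 <= C & forall x, n2 (E x) <= C * hnorm dot x ^+ 2.
Proof.
move=> LE EP.
suff [C C0 EC] : exists2 C : R, 0 <= C & forall x,
    n2 (\sum_(e <- onb) dot x e *: E e) <= C * hnorm dot x ^+ 2.
  by exists C => // x; rewrite (linear_expansion dot x EP).
elim: onb => [|e r [C C0 IH]].
  exists 0 => // x; rewrite big_nil mul0r /sqnorm (sh_ip0l sh (L20 dot)).
  exact: lexx.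
have ne := sqnorm_ge0 sh (LE e).
exists (2 * (hnorm dot e ^+ 2 * n2 (E e)) + 2 * C).
  by rewrite addr_ge0// mulr_ge0// mulr_ge0// sqr_ge0.
move=> x; rewrite big_cons; have Ls : L2 (\sum_(j <- r) dot x j *: E j).
  by apply: (sh_sum sh) => j; exact: (sh_Z sh).
apply: le_trans (sqnormD_le sh (sh_Z sh (dot x e) (LE e)) Ls) _.
rewrite (sqnormZ sh _ (LE e)) [leRHS]mulrDl lerD// -!mulrA ler_wpM2l//.
rewrite [leRHS](_ : _ = hnorm dot x ^+ 2 * hnorm dot e ^+ 2 * n2 (E e)); last by ring.
by rewrite ler_wpM2r// dot_CauchySchwarz.
Qed.

(** The linearity of [g] is forced by that of [phi] in its first argument. Being an element of
    ['End(H)], [G] has a kernel and an image to which dimension counting applies. *)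
Lemma dot_represents (g : H -> H) (phi : H -> H -> R[i]) :
  (forall w z, dot (g w) z = phi w z) ->
  (forall a x y z, phi (a *: x + y) z = a * phi x z + phi y z) ->
  exists G : 'End(H), forall w z, dot (G w) z = phi w z.
Proof.
move=> gphi phiP; have glin : linear g.
  by move=> a x y; apply: (dot_inj (dot := dot)) => z; rewrite linearPl /= !gphi phiP.
pose gl := GRing.isLinear.Build _ _ _ _ _ glin.
exists (linfun (HB.pack_for {linear H -> H} g gl)) => w z.
by rewrite lfunE /= gphi.
Qed.

Variable Theta : R -> 'End(H).
Hypothesis inner : inner_function dot Theta.
Hypothesis pure : is_pure dot Theta.
Local Notation M := (mulop Theta).
Local Notation K := (model L2 ip W k M).
Local Notation c := (defect_vector dot ip U k M).
Local Notation J := (defect_map dot ip U W k M).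
Local Notation im := (inner_is_multiplier inner).
Local Notation D := (Dspace dot Theta).

Let KJ x : K (J x). Proof. exact: (model_defect_map sh bs im). Qed.
Let LJ x : L2 (J x). Proof. exact: model_L (KJ x). Qed.

Lemma defect_map_eq0 x : n2 (J x) = 0 -> x = 0.
Proof.
move=> J0; have [d d0 dJ] := defect_map_bounded_below inner pure.
apply: (hnorm_eq0 (dot := dot)); have := dJ x; rewrite J0 pmulr_rle0// => x0.
by apply/eqP; rewrite -sqrf_eq0 eq_le x0 sqr_ge0.
Qed.

Lemma defect_map_ae_inj x y : aeeq (J x) (J y) -> x = y.
Proof.
move/(sqnorm_ae (LJ x) (LJ y)); have -> : J x - J y = J (x - y).
  by rewrite addrC -scaleN1r -(defect_mapP sh bs im) scaleN1r addrC.
by move/defect_map_eq0/eqP; rewrite subr_eq0 => /eqP.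
Qed.

(** B f = E x, where f = J x almost everywhere. As J is bounded below, x is unique and |x|^2 <=
    |f|^2 / d, so sqrt (C / d) is a bound for B. *)
Lemma Dspace_operator (W' : set (R -> H)) (E : H -> R -> H) : (forall f, W' f -> L2 f) ->
  (forall x, W' (E x)) -> (forall a x y, E (a *: x + y) = a *: E x + E y) ->
  exists2 B, bounded_operator dot D W' B & forall x, B (J x) = E x.
Proof.
move=> WL WE EP; have exx f : exists x, D f -> aeeq f (J x).
  have [/(DspaceP inner)[_ [x fx]]|nD] := pselect (D f); first by exists x.
  (* A default outside [D], which lets [choice] range over all functions. *)
  by exists 0.
have [x Dx] := choice exx.
have xE f y : D f -> aeeq f (J y) -> x f = y.
  move=> /Dx fx fy; apply: defect_map_ae_inj.
  by apply: aeI_imp (aeI_and fx fy) => t _ [-> ->].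
exists (fun f => E (x f)); last first.
  by move=> y; rewrite (xE _ y (DspaceJ inner y))//; exact: aeI_all.
split=> [f _|f g Df Dg fg|a f g Df Dg|]; first exact: WE.
- rewrite (xE f (x g))//; first exact: aeI_all.
  by apply: aeI_imp (aeI_and fg (Dx _ Dg)) => t _ [-> ->].
- rewrite (xE (fun t => a *: f t + g t) (a *: x f + x g)); first 1 last.
  + exact: (Dspace_linear inner).
  + rewrite (defect_mapP sh bs im); apply: aeI_imp (aeI_and (Dx _ Df) (Dx _ Dg)) => t _ [ft gt].
    by rewrite ft gt.
  by rewrite EP; exact: aeI_all.
have LE y := WL _ (WE y).
have [C C0 EC] := linear_sqnorm_bound LE EP; have [d d0 dJ] := defect_map_bounded_below inner pure.
exists (Num.sqrt (C / d)) => f Df; have Lf : L2 f by case/(DspaceP inner): Df.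
have Cd : 0 <= C / d by rewrite divr_ge0// ltW.
rewrite /= -(@ler_pXn2r _ 2) ?nnegrE ?mulr_ge0 ?sqrtr_ge0//.
rewrite exprMn (sqr_sqrtr Cd) (L2norm_sqr (LE (x f))) (L2norm_sqr Lf).
have -> : n2 f = n2 (J (x f)).
  by rewrite /sqnorm (ae_eq_ip Lf (LJ (x f)) Lf (LJ (x f)) (Dx _ Df) (Dx _ Df)).
apply: le_trans (EC _) _; rewrite mulrAC -mulrA ler_wpM2l// ler_pdivlMr// mulrC.
exact: dJ.
Qed.

(** [adjoint_on] is a choice, so an adjoint has to be exhibited. With v representing x |-> <B (J x),
    f>, one needs w such that J^* J w = v; then J w is the value sought. The Gram operator G = J^* J
    is injective since J is bounded below, hence onto in finite dimension. *)
Lemma adjoint_onP W' B f : (forall f, W' f -> L2 f) -> bounded_operator dot D W' B -> L2 f ->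
  D (adjoint_on dot D B f) /\
  forall g, D g -> ip (B g) f = ip g (adjoint_on dot D B f).
Proof.
move=> WL bB Lf; have DL g : D g -> L2 g by case/(DspaceP inner).
have DJ := DspaceJ inner.
suff [w Bw] : exists w, forall x, ip (B (J x)) f = ip (J x) (J w).
  have [|] // := @xgetPex _ (fun=> 0)
    [set d | D d /\ forall g, D g -> ip (B g) f = ip g d].
  exists (J w); split=> [|g Dg]; first exact: DJ.
  have [Lg [x gx]] := (DspaceP inner g).1 Dg.
  rewrite (bounded_operator_ae WL bB Dg (DJ x) gx Lf) Bw.
  have ww : aeeq (J w) (J w) by exact: aeI_all.
  by rewrite (ae_eq_ip Lg (LJ x) (LJ w) (LJ w) gx ww).
have sphi : scalar (fun x => ip (B (J x)) f).
  by move=> a x y; rewrite (defect_mapP sh bs im) (bounded_operator_ip WL bB)// -(defect_mapP sh bs im).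
pose v := riesz dot (fun x => ip (B (J x)) f).
have vB x : dot x v = ip (B (J x)) f by exact: dot_riesz.
have cJ w z : dot (c (J w)) z = ip (J w) (J z).
  by rewrite (ip_defect_map sh bs im)//; exact: model_hardy (KJ w).
have [G GE] : exists G : 'End(H), forall w z, dot (G w) z = ip (J w) (J z).
  apply: (dot_represents cJ) => a x y z; rewrite (defect_mapP sh bs im).
  by rewrite (sh_ipDl sh (sh_Z sh a (LJ x)) (LJ y) (LJ z)) (sh_ipZl sh a (LJ x) (LJ z)).
have G0 : lker G == 0%VS.
  rewrite -subv0; apply/subvP => w; rewrite memv_ker memv0 => /eqP Gw.
  by apply/eqP/defect_map_eq0; rewrite /sqnorm -GE Gw linear0l.
have : v \in limg G by rewrite (lker0_limgf G0) memvf.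
case/memv_imgP => w _ vG; exists w => x; rewrite -vB vG.
by rewrite (dotC dot x (G w)) (GE w x) (sh_ipC sh (LJ x) (LJ w)).
Qed.

End DefectSpace.

Section DefectEquation.
Variables (R : realType) (H : vectType R[i]) (dot : {dot H for Num.conj}).
Variables Theta1 Theta2 : R -> 'End(H).
Hypotheses (inner1 : inner_function dot Theta1) (pure1 : is_pure dot Theta1).
Hypotheses (inner2 : inner_function dot Theta2) (pure2 : is_pure dot Theta2).
Local Notation L2 := (L2 dot).
Local Notation ip := (ip dot).
Local Notation U := (@shiftU R H).
Local Notation W := (@shiftW R H).
Local Notation k := (@cstH R H).
Local Notation sh := (L2_semi_hilbert dot).
Local Notation bs := (shift_bilateral dot).
Local Notation M1 := (mulop Theta1).
Local Notation M2 := (mulop Theta2).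
Local Notation K1 := (model L2 ip W k M1).
Local Notation K2 := (model L2 ip W k M2).
Local Notation S1 := (compression dot ip U k M1).
Local Notation S2 := (compression dot ip U k M2).
Local Notation c1 := (defect_vector dot ip U k M1).
Local Notation c2 := (defect_vector dot ip U k M2).
Local Notation J1 := (defect_map dot ip U W k M1).
Local Notation J2 := (defect_map dot ip U W k M2).
Local Notation im1 := (inner_is_multiplier inner1).
Local Notation im2 := (inner_is_multiplier inner2).
Implicit Types (f g h p : R -> H).
Variable A : (R -> H) -> R -> H.
Hypothesis bA : bounded_operator dot (model_space dot Theta1) (model_space dot Theta2) A.

Let mL Theta f : model_space dot Theta f -> L2 f.
Proof. by case=> -[]. Qed.

Lemma bounded_operator_on : bounded_on ip K1 K2 A.
Proof.
split=> [f /model_spaceP Kf|f g Kf Kg|].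
- by apply/model_spaceP; case: bA => + _ _ _; apply.
- have Kfg := modelB sh bs im1 Kf Kg; have E : f - g = (-1) *: g + f by rewrite scaleN1r addrC.
  have LA h : K1 h -> L2 (A h).
    by move=> /model_spaceP; exact: (bounded_operator_L2 (@mL Theta2) bA).
  apply/(sqnorm_ae (LA _ Kfg) (L2B (LA _ Kf) (LA _ Kg))).
  case: bA => _ _ /(_ (-1) g f) lin _; rewrite E.
  apply: aeI_imp (lin _ _) => [t _ ->||]; try exact/model_spaceP.
  by rewrite scaleN1r addrC.
- have [C C0 AC] := bounded_operator_sqnorm (@mL Theta1) (@mL Theta2) bA.
  by exists C => // f /model_spaceP; exact: AC.
Qed.

Let AK f : K1 f -> K2 (A f). Proof. exact: bo_K bounded_operator_on _. Qed.

Lemma ip_operator_defect f g : K1 f -> K2 g ->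
  ip (A f - compressed_shift_adj dot Theta2 (A (compressed_shift dot Theta1 f))) g =
  ip (A f) g - ip (A (S1 f)) (S2 g).
Proof.
move=> Kf Kg; have [Kcs csS] := compressed_shiftE inner1 Kf; have KS := model_compression sh bs im1 Kf.
have Lg := model_L Kg; have LA := model_L (AK Kf); have KS2 := model_compression sh bs im2 Kg.
have Kc := compressed_shift_adj_model inner2 (model_L (AK Kcs)).
rewrite (sh_ipBl sh LA (model_L Kc) Lg) (ip_compressed_shift_adj inner2 (AK Kcs) Kg); congr (_ - _).
apply: (bounded_operator_ae (@mL Theta2) bA _ _ _ (model_L KS2)); try exact/model_spaceP.
exact/(sqnorm_ae (model_L Kcs) (model_L KS)).
Qed.

Variables B1 B2 : (R -> H) -> R -> H.
Hypothesis bB1 : bounded_operator dot (Dspace dot Theta1) (model_space dot Theta2) B1.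
Hypothesis bB2 : bounded_operator dot (Dspace dot Theta2) (model_space dot Theta1) B2.

(** The defect operator D_2 is J_2 J_2^*, hence self-adjoint: with d = B_2^* f, <D_2 d, g> = <d, D_2
    g> = <f, B_2 D_2 g>. *)
Lemma ip_defect_sum f g : K1 f -> K2 g ->
  ip (fun t => B1 (Dop dot Theta1 f) t
        + Dop dot Theta2 (adjoint_on dot (Dspace dot Theta2) B2 f) t) g =
  ip (B1 (J1 (c1 f))) g + ip f (B2 (J2 (c2 g))).
Proof.
move=> Kf Kg; have Lf := model_L Kf; have Lg := model_L Kg.
have [Dd dE] := adjoint_onP inner2 pure2 (@mL Theta1) bB2 Lf.
set d := adjoint_on _ _ _ _ in Dd dE *; have Kd := Dspace_model inner2 Dd.
have [KD DJ] := DopE inner2 Kd; have [_ DJ1] := DopE inner1 Kf.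
have DD1 := Dspace_Dop inner1 Kf; have DJc1 := DspaceJ inner1 (c1 f).
have DJc2 := DspaceJ inner2 (c2 g).
have LB1 := bounded_operator_L2 (@mL Theta2) bB1 DD1.
rewrite (sh_ipDl sh LB1 (model_L KD) Lg); congr (_ + _).
  exact: (bounded_operator_ae (@mL Theta2) bB1 DD1 DJc1 DJ1 Lg).
have LJ x : L2 (J2 x) by exact: model_L (model_defect_map sh bs im2 x).
have gg : aeeq g g by exact: aeI_all.
rewrite (ae_eq_ip (model_L KD) (LJ (c2 d)) Lg Lg DJ gg).
rewrite (sh_ipC sh (LJ (c2 d)) Lg) (ip_defect_map sh bs im2 _ (model_hardy Kg)).
rewrite -(dotC dot) -(ip_defect_map sh bs im2 _ (model_hardy Kd)).
have LB2 := bounded_operator_L2 (@mL Theta1) bB2 DJc2.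
rewrite (sh_ipC sh (model_L Kd) (LJ (c2 g))) -(dE _ DJc2).
by rewrite (sh_ipC sh Lf LB2).
Qed.

(** Both sides of the operator equation lie in K_{Theta_2}, so testing them against K_{Theta_2}
    loses nothing: from right to left, the test vector is their difference. *)
Lemma defect_equationP :
  (forall f, model_space dot Theta1 f ->
    aeeq (fun t => A f t
            - compressed_shift_adj dot Theta2 (A (compressed_shift dot Theta1 f)) t)
         (fun t => B1 (Dop dot Theta1 f) t
            + Dop dot Theta2 (adjoint_on dot (Dspace dot Theta2) B2 f) t)) <->
  (forall f g, K1 f -> K2 g -> ip (A f) g - ip (A (S1 f)) (S2 g) =
    ip (B1 (J1 (c1 f))) g + ip f (B2 (J2 (c2 g)))).
Proof.
have Kl f : K1 f ->
    K2 (A f - compressed_shift_adj dot Theta2 (A (compressed_shift dot Theta1 f))).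
  move=> Kf; have [Kcs _] := compressed_shiftE inner1 Kf.
  exact: (modelB sh bs im2 (AK Kf) (compressed_shift_adj_model inner2 (model_L (AK Kcs)))).
have Kr f : K1 f -> K2 (B1 (Dop dot Theta1 f)
            + Dop dot Theta2 (adjoint_on dot (Dspace dot Theta2) B2 f)).
  move=> Kf; have [Dd _] := adjoint_onP inner2 pure2 (@mL Theta1) bB2 (model_L Kf).
  have [KD _] := DopE inner2 (Dspace_model inner2 Dd).
  have KB : K2 (B1 (Dop dot Theta1 f)).
    by apply/model_spaceP; case: bB1 => + _ _ _; apply; exact: Dspace_Dop.
  by rewrite -[B1 _]scale1r; exact: (modelP sh bs im2).
split=> [eqAB f g Kf Kg|eqAB f /model_spaceP Kf].
  have Lg := model_L Kg; rewrite -ip_operator_defect// -ip_defect_sum//.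
  have gg : aeeq g g by exact: aeI_all.
  have fm : model_space dot Theta1 f by exact/model_spaceP.
  exact: (ae_eq_ip (model_L (Kl f Kf)) (model_L (Kr f Kf)) Lg Lg (eqAB f fm) gg).
apply/(sqnorm_ae (model_L (Kl f Kf)) (model_L (Kr f Kf))).
have Kd := modelB sh bs im2 (Kl f Kf) (Kr f Kf).
rewrite /sqnorm (sh_ipBl sh (model_L (Kl f Kf)) (model_L (Kr f Kf)) (model_L Kd)).
by rewrite (ip_operator_defect Kf Kd) (ip_defect_sum Kf Kd) eqAB// subrr.
Qed.

End DefectEquation.

Section Symbols.
Variables (R : realType) (H : vectType R[i]) (dot : {dot H for Num.conj}).
Local Notation hsL2 := (@Defs.L2 R 'End(H) (hs dot)).
Local Notation onb := (onb dot).
Local Notation Re := (@complex.Re R).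
Local Notation Im := (@complex.Im R).
Local Notation L2 := (L2 dot).
Local Notation ip := (ip dot).
Local Notation hsnorm := (@hnorm R 'End(H) (hs dot)).
Local Notation adjv := (adjv dot).
Local Notation U := (@shiftU R H).
Local Notation W := (@shiftW R H).
Local Notation k := (@cstH R H).
Implicit Types (f g h : R -> H) (T : 'End(H)) (Phi Theta : R -> 'End(H)).

Definition ess_bounded f := exists C : R, aeI (fun t => hnorm dot (f t) ^+ 2 <= C).

Lemma ess_boundedP a f g : ess_bounded f -> ess_bounded g -> ess_bounded (a *: f + g).
Proof.
move=> [C fC] [C' gC']; exists (2 * (sqmod a * C) + 2 * C').
apply: aeI_imp (aeI_and fC gC') => t _ [fC_ gC_].
apply: le_trans (hnormD_le _ _ _) _; rewrite hnormZ.
by rewrite lerD// ler_wpM2l// ler_wpM2l// sqmod_ge0.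
Qed.

Lemma ess_bounded_cst x : ess_bounded (k x).
Proof. by exists (hnorm dot x ^+ 2); exact: aeI_all. Qed.

Lemma ess_bounded0 : ess_bounded 0. Proof. exact: (ess_bounded_cst 0). Qed.

Lemma ess_boundedU f : ess_bounded f -> ess_bounded (U f).
Proof.
move=> [C fC]; exists C; apply: aeI_imp fC => t _ fC.
by rewrite hnormZ -/(sqmod _) sqmod_circ mul1r.
Qed.

Lemma ess_bounded_mult Theta f : inner_function dot Theta ->
  ess_bounded f -> ess_bounded (mulop Theta f).
Proof.
move=> inner [C fC]; exists C; apply: aeI_imp (aeI_and (inner_ae inner) fC).
by move=> t _ [[iso _] fC_]; rewrite /mulop hnorm_iso.
Qed.

Lemma ess_bounded_adj Theta f : inner_function dot Theta ->
  ess_bounded f -> ess_bounded (fun t => adjv (Theta t) (f t)).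
Proof.
move=> inner [C fC]; exists C; apply: aeI_imp (aeI_and (inner_ae inner) fC).
by move=> t _ [[iso full] fC_]; rewrite -(hnorm_iso _ iso) full.
Qed.

Lemma model_space_infP Theta f :
  model_space_inf dot Theta f <-> model L2 ip W k (mulop Theta) f /\ ess_bounded f.
Proof.
split=> [[Kf [_ [C fC]]]|[/model_spaceP Kf [C fC]]].
  split; first exact/model_spaceP.
  exists (C ^+ 2); apply: aeI_imp fC => t _ fC.
  by rewrite ler_pXn2r ?nnegrE ?hnorm_ge0// (le_trans _ fC) ?hnorm_ge0.
split=> //; split; first by case: Kf.
(* If x^2 <= C, then x <= 1 or x <= x^2 <= C. *)
exists (1 + C); apply: aeI_imp fC => t _ fC.
have := hnorm_ge0 dot (f t); move: (hnorm _ _) fC => x xC x0.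
have [x1|x1] := leP x 1; first by rewrite ler_wpDr// (le_trans _ xC)// sqr_ge0.
by rewrite (le_trans _ (ler_wpDl _ xC))// expr2 ler_peMr// ltW.
Qed.

Lemma hnorm_hs T : hsnorm T ^+ 2 = \sum_(e <- onb) hnorm dot (T e) ^+ 2.
Proof.
have -> : hsnorm T ^+ 2 = Re (\sum_(e <- onb) dot (T e) (T e)) by rewrite hnorm_sqr.
elim: onb => [|e r IH]; first by rewrite !big_nil.
by rewrite !big_cons ReD IH hnorm_sqr.
Qed.

Lemma hnorm_adjv T x : hnorm dot (adjv T x) ^+ 2 <= hsnorm T ^+ 2 * hnorm dot x ^+ 2.
Proof.
rewrite hnorm_onb hnorm_hs mulr_suml; apply: ler_sum => e _.
have -> : Re (dot (adjv T x) e) ^+ 2 + Im (dot (adjv T x) e) ^+ 2 = sqmod (dot (T e) x).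
  by rewrite (dotC dot) -dot_adjv ReJ ImJ sqrrN.
exact: dot_CauchySchwarz.
Qed.

(** |T x|^4 = |<x, T^* T x>|^2 is at most |x|^2 times the bound of [hnorm_adjv] for T^* (T x);
    divide by |T x|^2. *)
Lemma hnorm_app T x : hnorm dot (T x) ^+ 2 <= hsnorm T ^+ 2 * hnorm dot x ^+ 2.
Proof.
have h0 (y : H) : 0 <= hnorm dot y ^+ 2 by exact: sqr_ge0.
have := dot_CauchySchwarz dot x (adjv T (T x)); rewrite -dot_adjv dot_hnorm.
rewrite /sqmod /= expr0n addr0 => le1.
have := le_trans le1 (ler_wpM2l (h0 x) (hnorm_adjv T (T x))).
move: (h0 (T x)) (h0 x) (sqr_ge0 (hsnorm T)).
move: (hnorm dot (T x) ^+ 2) (hnorm dot x ^+ 2) (hsnorm T ^+ 2) => a b c a0 b0 c0.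
have [->|a1] := eqVneq a 0; first by rewrite mulr_ge0.
by rewrite expr2 mulrA ler_pM2r ?lt_def ?a1// mulrC.
Qed.

Lemma mulop_L2 Phi f : hsL2 Phi -> L2 f -> ess_bounded f -> L2 (mulop Phi f).
Proof.
move=> LPhi Lf [C fC]; apply: (L2_le (C := C) _ LPhi).
  exact: vmeasurable_app (L2_measurable LPhi) (L2_measurable Lf).
apply: aeI_imp fC => t _ fC; apply: le_trans (hnorm_app _ _) _.
by rewrite mulrC ler_wpM2r// sqr_ge0.
Qed.

Lemma adj_symbol_L2 Phi f : hsL2 Phi -> L2 f -> ess_bounded f ->
  L2 (fun t => adjv (Phi t) (f t)).
Proof.
move=> LPhi Lf [C fC]; apply: (L2_le (C := C) _ LPhi).
  exact: vmeasurable_adj (L2_measurable LPhi) (L2_measurable Lf).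
apply: aeI_imp fC => t _ fC; apply: le_trans (hnorm_adjv _ _) _.
by rewrite mulrC ler_wpM2r// sqr_ge0.
Qed.

(** The squared Hilbert-Schmidt norm is the sum of the |Phi e|^2 over [onb], so square integrability
    is tested column by column. *)
Lemma L2_hs Phi : (forall x, L2 (fun t => Phi t x)) -> hsL2 Phi.
Proof.
move=> LPhi; apply: (@L2_dom _ _ _ _ (fun t => \sum_(e <- onb) hnorm dot (Phi t e) ^+ 2)).
- apply: (@vmeasurable_onb R 'End(H) (hs dot)) => S _; apply: cmeasurable_sum => e _.
  exact: cmeasurable_dot (L2_measurable (LPhi e)) (vmeasurable_cst (S e)).
- elim: onb => [|e r IH].
    by under eq_fun do rewrite big_nil; exact: (integrable_cst_unitI 0).
  under eq_fun do rewrite big_cons.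
  apply: (integrableD _ (L2_integrable (LPhi e)) IH) => //; exact: measurable_unitI.
- by apply: aeI_all => t _; rewrite hnorm_hs.
Qed.

End Symbols.

Section ToeplitzSymbols.
Variables (R : realType) (H : vectType R[i]) (dot : {dot H for Num.conj}).
Variables Theta1 Theta2 : R -> 'End(H).
Hypotheses (inner1 : inner_function dot Theta1) (pure1 : is_pure dot Theta1).
Hypotheses (inner2 : inner_function dot Theta2) (pure2 : is_pure dot Theta2).
Local Notation hsL2 := (@Defs.L2 R 'End(H) (hs dot)).
Local Notation L2 := (L2 dot).
Local Notation ip := (ip dot).
Local Notation U := (@shiftU R H).
Local Notation W := (@shiftW R H).
Local Notation k := (@cstH R H).
Local Notation sh := (L2_semi_hilbert dot).
Local Notation bs := (shift_bilateral dot).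
Local Notation M1 := (mulop Theta1).
Local Notation M2 := (mulop Theta2).
Local Notation K1 := (model L2 ip W k M1).
Local Notation K2 := (model L2 ip W k M2).
Local Notation im1 := (inner_is_multiplier inner1).
Local Notation im2 := (inner_is_multiplier inner2).
Implicit Types (f g h p : R -> H).
Variable A : (R -> H) -> R -> H.
Hypothesis bA : bounded_operator dot (model_space dot Theta1) (model_space dot Theta2) A.
Local Notation adjv := (adjv dot).
Local Notation Bd := (ess_bounded dot).
Local Notation n1 := (fun f t => adjv (Theta1 t) (f t)).
Local Notation n2' := (fun f t => adjv (Theta2 t) (f t)).
Implicit Types E : H -> R -> H.

Let UL f : L2 f -> L2 (U f). Proof. exact: (bs_UL bs). Qed.
Let WL f : L2 f -> L2 (W f). Proof. exact: (bs_WL bs). Qed.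
Let KA : bounded_on ip K1 K2 A. Proof. exact: bounded_operator_on. Qed.
Let AK f : K1 f -> K2 (A f). Proof. exact: bo_K KA _. Qed.

Lemma pointwise_operator E : (forall a x y, E (a *: x + y) = a *: E x + E y) ->
  exists Op : R -> 'End(H), forall t x, Op t x = E x t.
Proof.
move=> EP; have lin t : linear (fun x => E x t) by move=> a x y; rewrite EP.
exists (fun t => linfun (HB.pack_for {linear H -> H} (fun x => E x t)
  (GRing.isLinear.Build _ _ _ _ _ (lin t)))).
by move=> t x; rewrite lfunE.
Qed.

Lemma adjvP (T : 'End(H)) a x y : adjv T (a *: x + y) = a *: adjv T x + adjv T y.
Proof.
have adjl u z : dot (adjv T u) z = dot u (T z) by rewrite (dotC dot) -dot_adjv -(dotC dot).
apply: (dot_inj (dot := dot)) => z.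
by rewrite adjl linearPl [RHS]linearPl /= !adjl.
Qed.

Lemma toeplitz_defect Phi : hsL2 Phi ->
  (forall f, model_space_inf dot Theta1 f -> aeeq (A f) (truncated_toeplitz dot Theta2 Phi f)) ->
  exists E1 E2 : H -> R -> H,
  [/\ forall x, K2 (E1 x), forall x, K1 (E2 x),
      forall a x y, E1 (a *: x + y) = a *: E1 x + E1 y,
      forall a x y, E2 (a *: x + y) = a *: E2 x + E2 y
    & defect_identity dot L2 ip U W k M1 M2 A E1 E2].
Proof.
move=> LPhi AE.
apply: (@defect_of_symbol _ _ _ _ _ _ _ _ _ sh bs _ _ _ _ im1 im2 A KA Bd _ _ _ _ _
  (mulop Phi) (fun y t => adjv (Phi t) (Theta2 t y))).
- exact: ess_boundedP.
- exact: ess_bounded0.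
- exact: ess_boundedU.
- by move=> f; exact: ess_bounded_mult.
- exact: ess_bounded_cst.
- by move=> a f g; apply/funext => t; rewrite /mulop linearP.
- by move=> f; apply/funext => t; rewrite /mulop /shiftU linearZ.
- by move=> f; exact: mulop_L2.
- move=> y; apply: (adj_symbol_L2 (f := M2 (k y)) LPhi).
    exact/(mult_L2 inner2)/L2_cst.
  exact/ess_bounded_mult/ess_bounded_cst.
- by move=> f y Lf Bf; apply: eq_cint => t _; rewrite /mulop dot_adjv.
(* As g lies in K_{Theta_2}, the projection in A f = P_2 (Phi f) is invisible to it. *)
move=> f g Kf Bf Kg.
have LF := mulop_L2 LPhi (model_L Kf) Bf; have Lg := model_L Kg.
have [KP PF] := model_projP inner2 LF.
have fm : model_space_inf dot Theta1 f by exact/model_space_infP.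
have gg : aeeq g g by exact: aeI_all.
rewrite (ae_eq_ip (model_L (AK Kf)) (model_L KP) Lg Lg (AE f fm) gg).
by apply/eqP; rewrite eq_sym -subr_eq0 -(sh_ipBl sh LF (model_L KP) Lg) PF.
Qed.

Lemma defect_toeplitz (E1 E2 : H -> R -> H) :
  (forall x, K2 (E1 x)) -> (forall x, K1 (E2 x)) ->
  (forall a x y, E1 (a *: x + y) = a *: E1 x + E1 y) ->
  (forall a x y, E2 (a *: x + y) = a *: E2 x + E2 y) ->
  defect_identity dot L2 ip U W k M1 M2 A E1 E2 ->
  exists2 Phi, hsL2 Phi & forall f, model_space_inf dot Theta1 f ->
    aeeq (A f) (truncated_toeplitz dot Theta2 Phi f).
Proof.
move=> KE1 KE2 E1P E2P E12.
have LE1 x := model_L (KE1 x); have LE2 x := model_L (KE2 x).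
have [Op1 Op1E] := pointwise_operator E1P; have [Op2 Op2E] := pointwise_operator E2P.
have LOp1 : hsL2 Op1.
  by apply: L2_hs => x; rewrite (_ : (fun t => _) = E1 x)//; apply/funext => t.
have LOp2 : hsL2 Op2.
  by apply: L2_hs => x; rewrite (_ : (fun t => _) = E2 x)//; apply/funext => t.
pose T1 g : R -> H := fun t => adjv (Op1 t) (g t).
pose T2 f : R -> H := fun t => adjv (Op2 t) (f t).
(* F f = z E_1 Theta_1^* f + \bar z Theta_2 E_2^* f acts pointwise and linearly, so Phi can be read
   off from its values at constants. *)
pose F f := U (mulop Op1 (n1 f)) + W (M2 (T2 f)).
have FE f t : F f t = circ t *: Op1 t (adjv (Theta1 t) (f t)) +
  Num.conj (circ t) *: Theta2 t (adjv (Op2 t) (f t)) by [].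
have LF f : L2 f -> Bd f -> L2 (F f).
  move=> Lf Bf; apply: (sh_D sh).
    by apply: UL; exact: (mulop_L2 LOp1 (adj_L2 inner1 Lf) (ess_bounded_adj inner1 Bf)).
  by apply: WL; apply: (mult_L2 inner2); exact: adj_symbol_L2.
have Flin t : linear (fun x => F (k x) t).
  move=> a x y.
  have TP (T : 'End(H)) u v : T (a *: u + v) = a *: T u + T v by exact: linearP.
  by rewrite !FE /cstH !adjvP !TP !scalerDr !scalerA !(mulrC a) addrACA.
pose Phi t : 'End(H) := linfun (HB.pack_for {linear H -> H} (fun x => F (k x) t)
  (GRing.isLinear.Build _ _ _ _ _ (Flin t))).
have PhiE f : mulop Phi f = F f by apply/funext => t; rewrite /mulop lfunE.
have LPhi : hsL2 Phi.
  apply: L2_hs => x; rewrite -[fun t => _]/(mulop Phi (k x)) PhiE.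
  by apply: LF; [exact: L2_cst|exact: ess_bounded_cst].
have LT1 g : L2 g -> Bd g -> L2 (T1 g) by move=> Lg Bg; exact: adj_symbol_L2.
have LT2 f : L2 f -> Bd f -> L2 (T2 f) by move=> Lf Bf; exact: adj_symbol_L2.
have ipF f g : L2 f -> Bd f -> L2 g -> Bd g ->
    ip (F f) g = ip (U (n1 f)) (T1 g) + Num.conj (ip (U (n2' g)) (T2 f)).
  move=> Lf Bf Lg Bg; have LT := LT2 f Lf Bf.
  have Lm : L2 (mulop Op1 (n1 f)).
    exact: (mulop_L2 LOp1 (adj_L2 inner1 Lf) (ess_bounded_adj inner1 Bf)).
  have LM : L2 (M2 (T2 f)) by exact: mult_L2.
  have LN : L2 (n2' g) by exact: adj_L2.
  rewrite (sh_ipDl sh (UL Lm) (WL LM) Lg); congr (_ + _).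
    by apply: eq_cint => t _; rewrite /shiftU /mulop -dot_adjv linearZ.
  rewrite -(sh_ipC sh LT (UL LN)) (ipWU bs LM Lg).
  by apply: eq_cint => t _; rewrite /mulop /shiftU [LHS]linearZr_LR [RHS]linearZr_LR /= dot_adjv.
exists Phi => // f /model_space_infP[Kf Bf]; have Lf := model_L Kf.
have LFf : L2 (mulop Phi f) by rewrite PhiE; exact: LF.
have [KP _] := model_projP inner2 LFf; have LA := model_L (AK Kf).
have LD := L2B LFf LA.
(* A f = P_2 (Phi f) means that Phi f - A f is orthogonal to K_{Theta_2}. [symbol_of_defect] shows
   this against bounded vectors, which are dense. *)
apply/(sqnorm_ae LA (model_L KP)); rewrite (sqnormBC sh LA (model_L KP)).
apply: (model_proj_unique inner2 LFf (AK Kf)) => g Kg; have Lg := model_L Kg.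
rewrite (sh_ipC sh LD Lg).
rewrite (@approximable_ip _ _ _ _ sh (fun h => K2 h /\ Bd h) g (mulop Phi f - A f)) ?rmorph0//.
- by move=> h [Kh _]; exact: model_L Kh.
- move=> e e0; have [|||||h [Kh Bh gh]] := model_dense sh bs im2 (Bd := Bd) _ _ _ _ _ Kg e0.
  + exact: ess_boundedP.
  + exact: ess_bounded0.
  + exact: ess_boundedU.
  + by move=> h; exact: ess_bounded_mult.
  + exact: ess_bounded_cst.
  by exists h.
move=> h [Kh Bh]; have Lh := model_L Kh.
rewrite (sh_ipC sh Lh LD) (sh_ipBl sh LFf LA Lh) PhiE (ipF f h Lf Bf Lh Bh).
rewrite (@symbol_of_defect _ _ _ _ _ _ _ _ _ sh bs _ _ _ _ im1 im2 A KA Bd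
  E1 E2 T1 T2) ?subrr ?rmorph0//.
- move=> n x u Lu Bu; rewrite !iter_shiftW; apply: eq_cint => t _.
  by rewrite -dot_adjv linearZ /= Op1E.
- move=> n x u Lu Bu; rewrite !iter_shiftW; apply: eq_cint => t _.
  by rewrite -dot_adjv linearZ /= Op2E.
Qed.

End ToeplitzSymbols.

Section OperatorKernel.
Variables (R : realType) (H : vectType R[i]) (dot : {dot H for Num.conj}).
Variables Theta Theta' : R -> 'End(H).
Hypothesis inner : inner_function dot Theta.
Local Notation L2 := (L2 dot).
Local Notation ip := (ip dot).
Local Notation onb := (onb dot).
Local Notation k := (@cstH R H).
Local Notation M := (mulop Theta).
Local Notation J := (defect_map dot ip (@shiftU R H) (@shiftW R H) k M).
Local Notation K' := (model L2 ip (@shiftW R H) k (mulop Theta')).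
Local Notation sh := (L2_semi_hilbert dot).
Local Notation bs := (shift_bilateral dot).
Local Notation im := (inner_is_multiplier inner).
Hypothesis inner' : inner_function dot Theta'.
Local Notation im' := (inner_is_multiplier inner').

(** B J is linear only up to null functions that depend on the vectors. Rebuilding it from its
    values on the basis gives an exactly linear E, so that for each t the map x |-> E x t is an
    operator on H. *)
Lemma operator_kernel B :
  bounded_operator dot (Dspace dot Theta) (model_space dot Theta') B ->
  exists E : H -> R -> H, [/\ forall x, K' (E x),
    forall a x y, E (a *: x + y) = a *: E x + E y
    & forall x g, L2 g -> ip (B (J x)) g = ip (E x) g].
Proof.
move=> bB; have mL f : model_space dot Theta' f -> L2 f by case=> -[].
have DJ := DspaceJ inner.
have KB x : K' (B (J x)) by apply/model_spaceP; case: bB => + _ _ _; apply.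
exists (fun x => \sum_(e <- onb) dot x e *: B (J e)); split=> [x|a x y|x g Lg].
- elim: onb => [|e r IH]; first by rewrite big_nil; exact: (model0 sh bs im').
  by rewrite big_cons; exact: (modelP sh bs im').
- rewrite scaler_sumr -big_split; apply: eq_bigr => e _ /=.
  by rewrite linearPl /= scalerDl scalerA.
have sphi : scalar (fun y => ip (B (J y)) g).
  by move=> a y z; rewrite (defect_mapP sh bs im) (bounded_operator_ip mL bB)// -(defect_mapP sh bs im).
have LB e : L2 (dot x e *: B (J e)) by exact: (sh_Z sh _ (model_L (KB e))).
rewrite {1}(onb_expansion dot x) (scalar_sum _ _ _ sphi) (sh_ip_suml sh _ LB Lg).
by apply: eq_bigr => e _; rewrite (sh_ipZl sh _ (model_L (KB e)) Lg).
Qed.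

End OperatorKernel.

Theorem theorem5p5 (R : realType) (H : vectType R[i])
    (dot : {dot H for Num.conj}) (Theta1 Theta2 : R -> 'End(H))
    (inner1 : inner_function dot Theta1) (pure1 : is_pure dot Theta1)
    (inner2 : inner_function dot Theta2) (pure2 : is_pure dot Theta2)
    (A : (R -> H) -> (R -> H))
    (bA : bounded_operator dot (model_space dot Theta1) (model_space dot Theta2) A) :
  MT dot Theta1 Theta2 A <->
  exists B1 B2 : (R -> H) -> (R -> H),
    [/\ bounded_operator dot (Dspace dot Theta1) (model_space dot Theta2) B1,
        bounded_operator dot (Dspace dot Theta2) (model_space dot Theta1) B2
      & forall f, model_space dot Theta1 f ->
          aeeq (fun t => A f t
                  - compressed_shift_adj dot Theta2 (A (compressed_shift dot Theta1 f)) t)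
               (fun t => B1 (Dop dot Theta1 f) t
                  + Dop dot Theta2 (adjoint_on dot (Dspace dot Theta2) B2 f) t)].
Proof.
have mL Theta f : model_space dot Theta f -> Defs.L2 dot f by case=> -[].
split=> [[_ [Phi LPhi AE]]|[B1 [B2 [bB1 bB2]]]].
  have [E1 [E2 [KE1 KE2 E1P E2P E12]]] := toeplitz_defect inner1 inner2 bA LPhi AE.
  have [B1 bB1 B1E] := Dspace_operator inner1 pure1 (mL Theta2)
    (fun x => (model_spaceP _ _ _).2 (KE1 x)) E1P.
  have [B2 bB2 B2E] := Dspace_operator inner2 pure2 (mL Theta1)
    (fun x => (model_spaceP _ _ _).2 (KE2 x)) E2P.
  exists B1, B2; split=> //; apply/(defect_equationP inner1 inner2 pure2 bA bB1 bB2).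
  by move=> f g Kf Kg; rewrite B1E B2E; exact: E12.
move/(defect_equationP inner1 inner2 pure2 bA bB1 bB2) => AB; split=> //.
have [E1 [KE1 E1P E1B]] := operator_kernel inner1 inner2 bB1.
have [E2 [KE2 E2P E2B]] := operator_kernel inner2 inner1 bB2.
apply: (defect_toeplitz inner1 inner2 bA KE1 KE2 E1P E2P) => f g Kf Kg.
have Lf := model_L Kf; have Lg := model_L Kg; rewrite AB// E1B//; congr (_ + _).
pose v := defect_vector dot (ip dot) (@shiftU R H) (@cstH R H) (mulop Theta2) g.
have sh := L2_semi_hilbert dot; have LE := model_L (KE2 v).
have LB := bounded_operator_L2 (mL Theta1) bB2 (DspaceJ inner2 v).
(* [E2B] concerns the first argument of the form, hence the two exchanges. *)
by rewrite (sh_ipC sh Lf LB) E2B// -(sh_ipC sh Lf LE).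
Qed.
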